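(* Let $q>2$. For every $\alpha\in(0,\frac12]$ and every $\lambda>0$ there exists a boundary condition $\xi$ (for each $n$, a partition of $\partial\Lambda_n$, not necessarily realizable by a planar configuration outside $\Lambda_n$) such that when $p=\lambda n^{-\alpha}$ the mixing time of the FK-dynamics on the $n\times n$ box $\Lambda_n$ with boundary condition $\xi$ and parameters $(p,q)$ is $\exp(\Omega(n^{\alpha}))$ as $n\to\infty$.
   Context: $\Lambda_n=\{0,\dots,n\}^2\subset\mathbb Z^2$ with edge set $E(\Lambda_n)$ of all nearest-neighbor pairs in $\Lambda_n$; $\partial\Lambda_n$ is the set of vertices of $\Lambda_n$ adjacent to $\mathbb Z^2\setminus\Lambda_n$. A boundary condition $\xi$ is an arbitrary partition of $\partial\Lambda_n$. The random-cluster measure on $S\subseteq E(\Lambda_n)$ is $\pi^{\xi}_{\Lambda_n,p,q}(S)=\frac1Z p^{|S|}(1-p)^{|E(\Lambda_n)\setminus S|}q^{c(S;\xi)}$, where $c(S;\xi)$ is the number of connected components of the graph on $\Lambda_n$ with edge set $S$ plus auxiliary edges between all pairs of vertices in the same element of $\xi$. The FK-dynamics with boundary condition $\xi$ is the discrete-time Markov chain which from $S_t$ picks $e\in E(\Lambda_n)$ uniformly at random and sets $S_{t+1}=S_t\cup\{e\}$ with probability $\pi(S_t\cup\{e\})/(\pi(S_t\cup\{e\})+\pi(S_t\setminus\{e\}))$, $\pi=\pi^{\xi}_{\Lambda_n,p,q}$, and $S_{t+1}=S_t\setminus\{e\}$ otherwise. The mixing time is the least $t$ such that the total-variation distance to $\pi$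 at time $t$ is at most $1/4$ from every initial state. *)

(* Defs.v *)
From HB Require Import structures.
From mathcomp Require Import all_boot all_order all_algebra.
From mathcomp Require Import all_classical all_reals all_analysis.

Set Implicit Arguments.
Unset Strict Implicit.
Unset Printing Implicit Defensive.

Import Order.TTheory GRing.Theory Num.Theory.

Local Open Scope ring_scope.

Section Box.
Variable n : nat.

Definition vertex : finType := ('I_n.+1 * 'I_n.+1)%type.

Definition to_Z2 (x : vertex) : int * int := (Posz x.1, Posz x.2).

Definition nearest_neighbor (u v : int * int) : bool :=
  (`|u.1 - v.1| + `|u.2 - v.2| == 1)%N.

Definition box_edges : {set {set vertex}} :=
  [set e | [exists x : vertex, exists y : vertex,
     nearest_neighbor (to_Z2 x) (to_Z2 y) && (e == [set x; y])]].

(* An edge is an unordered pair of vertices, so that configurations are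
   exactly the elements of [{set edge}]. *)
Definition edge : finType := {e : {set vertex} | e \in box_edges}.

Definition boundary : {set vertex} :=
  [set x | `[< exists v : int * int,
       nearest_neighbor (to_Z2 x) v /\ ~ exists y : vertex, to_Z2 y = v >]].

Definition boundary_condition (xi : {set {set vertex}}) : bool :=
  finset.partition xi boundary.

Definition wired_rel (S : {set edge}) (xi : {set {set vertex}}) : rel vertex :=
  fun x y => [exists e in S, val e == [set x; y]]
          || [exists B in xi, (x \in B) && (y \in B)].

Definition num_components (S : {set edge}) (xi : {set {set vertex}}) : nat :=
  n_comp (wired_rel S xi) predT.

Section RandomCluster.
Variables (R : realType) (p q : R) (xi : {set {set vertex}}).

Definition rc_weight (S : {set edge}) : R :=
  p ^+ #|S| * (1 - p) ^+ #|~: S| * q ^+ num_components S xi.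

Definition rc_measure (S : {set edge}) : R :=
  rc_weight S / \sum_(T : {set edge}) rc_weight T.

Definition fk_add_prob (S : {set edge}) (e : edge) : R :=
  rc_measure (e |: S) / (rc_measure (e |: S) + rc_measure (S :\ e)).

Definition fk_kernel (S T : {set edge}) : R :=
  \sum_(e : edge) #|edge|%:R^-1 *
    (fk_add_prob S e * (T == e |: S)%:R
     + (1 - fk_add_prob S e) * (T == S :\ e)%:R).

End RandomCluster.
End Box.

Section Mixing.
Variables (R : realType) (X : finType).

Fixpoint chain_law (K : X -> X -> R) (x : X) (t : nat) : X -> R :=
  if t is t'.+1 then fun y => \sum_(z : X) chain_law K x t' z * K z y
  else fun y => (y == x)%:R.

Definition tv_dist (mu nu : X -> R) : R := 2^-1 * \sum_(x : X) `|mu x - nu x|.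

(* The least [t] with distance at most 1/4 from every initial state, with the
   convention that it is [+oo] if there is no such [t]; the latter never
   happens for an irreducible aperiodic chain with stationary law [mu]. *)
Definition mixing_time (K : X -> X -> R) (mu : X -> R) : \bar R :=
  ereal_inf [set t%:R%:E | t in
    [set t : nat | forall x, tv_dist (chain_law K x t) mu <= 4^-1]]%classic.

End Mixing.

Definition fk_mixing_time (n : nat) (R : realType) (p q : R)
    (xi : {set {set vertex n}}) : \bar R :=
  mixing_time (fk_kernel p q xi) (rc_measure p q xi).

(* Main.v *)
Require Import Defs.
From mathcomp Require Import all_classical all_reals all_analysis.
From mathcomp Require Import all_boot all_order all_algebra.
From mathcomp Require Import ring lra zify.

Set Implicit Arguments.
Unset Strict Implicit.
Unset Printing Implicit Defensive.

Import Order.TTheory GRing.Theory Num.Theory.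

Local Open Scope ring_scope.

(** On the complete graph with [N] vertices and edge probability of order
    [1/N], the random-cluster model with [q > 2] has a discontinuous phase
    transition: at the critical density a disordered phase, all of whose
    clusters are small, coexists with an ordered phase with a giant cluster,
    and clusters of intermediate size have probability exponentially small in
    [N].  A single-edge dynamics must pass through such clusters, and so needs a
    time exponential in [N].  Arbitrary wirings plant this model in the box.

    A slot is an edge of the bottom row, and the slots lie at distance from one
    another.  With [N] of order [n ^ alpha] classes and [K * N ^ 2] slots, the
    left end of slot [t] is wired to class [t %% N] and its right end to class
    [(t %/ N) %% N], so that every ordered pair of classes is joined by [K]
    slots.  The bottom row has room for this because [alpha <= 1/2].  The rest of
    the box is harmless because [p] tends to 0: unless two open bonds lie near
    one of its slots, a class meets no other class through the interior
    ([slot_isolated]).  The number of slots with this defect has bounded mean, of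
    order [K * (N * p) ^ 2], and a bounded exponential moment ([busy_moment]),
    hence changes no weight by an exponential factor.

    Since [p] is prescribed, criticality is reached by changing the graph: at
    stage [j] only the first [j] slots have their right end wired.  At stage 0
    the small-cluster phase carries most of the weight ([start_half]); at the last
    stage, where the density [2 * K * N * p] exceeds the critical value
    [2 * (q - 1) * ln (q - 1) / (q - 2)], it carries at most half ([end_half]).
    One more wire changes a weight by a factor between [1 / q] and 1
    ([stage_step]), so at some intermediate stage this phase carries at most half
    and at least a constant fraction of the weight ([tuning]).

    At every stage the configurations in which some cluster contains between
    [M / 2] and [M] classes, with [M] close to [eps * N], have exponentially small
    weight ([medium_cluster_bound]).  A cluster on [s] classes requires all slots
    leaving it to be closed and those inside it to connect it; together with the
    choice of the classes this gives [expR (s * (1 + ln Y - Y))] to leading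
    order, where [Y] is the density divided by [q].  The exponent is negative as
    long as [Y < 1], and the last stage can be chosen so because the critical
    density is smaller than [q] when [q > 2] ([critical_lt]).  Opening one bond
    merges at most two clusters, so a path that leaves the small-cluster
    phase visits a medium cluster ([leave_small_clusters]), and a conductance bound
    ([fk_mixing_time_ge]) yields the theorem.

    The comparison of the phases at the last stage rests on two bounds for
    weights.  From above, each closed slot between two clusters costs a factor
    [1 - p + p / q] ([expect_crossing_le]).  From below, clusters are coloured
    independently with two colours of probabilities [(q - 1) / q] and [1 / q],
    and the resulting spin system is bounded by the Gibbs variational principle
    with the product measure in which the two probabilities are exchanged
    ([colouring_bound], [gibbs], [ordered_bound]). *)

(** * Expectations over random subsets *)

Section RandomSubset.
Variables (R : realFieldType) (T : finType).
Implicit Types (F : seq T) (g h : {set T} -> R) (S : {set T}) (pr : T -> R).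

(** Mean of [g] over the union of [S] and a random subset of [F] that contains
    each [e] independently with probability [pr e].  The recursion on a list makes
    a concatenation of lists an iterated mean, so that bonds can be revealed in
    any order ([expect_cat], [expect_perm]). *)
Fixpoint expect pr F g S : R :=
  if F is e :: F' then pr e * expect pr F' g (e |: S) + (1 - pr e) * expect pr F' g S
  else g S.

Lemma expect_cat pr F1 F2 g S : expect pr (F1 ++ F2) g S = expect pr F1 (expect pr F2 g) S.
Proof. by elim: F1 S => //= e F1 IH S; rewrite !IH. Qed.

(** The invariant [Q] records what the start [S] forces on every set that the
    recursion can reach; the same device is used in [expect_le]. *)
Lemma expect_ext (Q : {set T} -> Prop) pr F g h S :
  (forall e P, e \in F -> Q P -> Q (e |: P)) -> (forall P, Q P -> g P = h P) ->
  Q S -> expect pr F g S = expect pr F h S.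
Proof.
elim: F S => [|e F IH] S HQ Hgh QS /=; first exact: Hgh.
rewrite !IH //; last by apply: HQ; rewrite // mem_head.
all: by move=> e' P He'; apply: HQ; rewrite inE He' orbT.
Qed.

Lemma eq_expect pr F g h S : g =1 h -> expect pr F g S = expect pr F h S.
Proof. by move=> gh; apply: (@expect_ext (fun=> True)). Qed.

Lemma expect_swap pr F1 F2 g S :
  expect pr F1 (expect pr F2 g) S = expect pr F2 (expect pr F1 g) S.
Proof.
elim: F1 S => [|e F1 IH] S //=; rewrite !IH.
elim: F2 S {IH} => [|f F2 IH] S //=.
rewrite -!IH (setUCA [set e]); ring.
Qed.

Lemma expect_perm pr F1 F2 g S : perm_eq F1 F2 -> expect pr F1 g S = expect pr F2 g S.
Proof.
move=> H; apply/esym.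
apply: (@catCA_perm_ind _ (fun F => expect pr F g S = expect pr F1 g S) _ _ _ H) => //.
move=> s1 s2 s3 <-.
by rewrite !catA !expect_cat expect_swap.
Qed.

Lemma expectZ pr F k g S : expect pr F (fun P => k * g P) S = k * expect pr F g S.
Proof. by elim: F S => //= e F IH S; rewrite !IH; ring. Qed.

Lemma expect_sum pr F (I : Type) (r : seq I) (Q : pred I) (g : I -> {set T} -> R) S :
  expect pr F (fun P => \sum_(i <- r | Q i) g i P) S
  = \sum_(i <- r | Q i) expect pr F (g i) S.
Proof.
elim: F S => //= e F IH S.
by rewrite !IH !big_distrr -big_split.
Qed.

Lemma expectD pr F g h S : expect pr F (fun P => g P + h P) S =
  expect pr F g S + expect pr F h S.
Proof. by elim: F S => //= e F IH S; rewrite !IH; ring. Qed.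

Lemma expect_cst pr F k S : expect pr F (fun=> k) S = k.
Proof. by elim: F S => //= e F IH S; rewrite !IH; ring. Qed.

Lemma expect_le (Q : {set T} -> Prop) pr F g h S :
  (forall e, 0 <= pr e <= 1) ->
  (forall e P, e \in F -> Q P -> Q (e |: P)) -> (forall P, Q P -> g P <= h P) ->
  Q S -> expect pr F g S <= expect pr F h S.
Proof.
move=> Hp; elim: F S => [|e F IH] S HQ Hgh QS /=; first exact: Hgh.
have [p0 p1] := andP (Hp e).
apply: lerD; apply: ler_wpM2l; rewrite ?subr_ge0 //; apply: IH => //.
1,3: by move=> e' P He'; apply: HQ; rewrite inE He' orbT.
by apply: HQ; rewrite // mem_head.
Qed.

Lemma expect_ge0 pr F g S : (forall e, 0 <= pr e <= 1) -> (forall P, 0 <= g P) ->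
  0 <= expect pr F g S.
Proof.
move=> Hp Hg; rewrite -(expect_cst pr F 0 S).
by apply: (@expect_le (fun=> True)).
Qed.

(** If adding an element costs [g] at most a factor [tau], each revealed element
    costs the mean at most [1 - p + p * tau]. *)
Lemma expect_ge_pow (p tau : R) F g S : 0 <= p <= 1 -> 0 <= tau ->
  (forall P, 0 <= g P) ->
  (forall e P, e \in F -> tau * g P <= g (e |: P)) ->
  (1 - p + p * tau) ^+ size F * g S <= expect (fun=> p) F g S.
Proof.
move=> Hp tau0 Hg; have /andP[p0 p1] := Hp.
elim: F S => [|e F IH] S Hstep /=; first by rewrite expr0 mul1r.
have IH' P := IH P (fun e' P' He' => Hstep e' P' (mem_behead (s := e :: F) He')).
have H1 := Hstep e S (mem_head _ _).
have A0 : 0 <= (1 - p + p * tau) ^+ size F.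
  by apply: exprn_ge0; rewrite addr_ge0 ?mulr_ge0 // subr_ge0.
have /= H2 := IH' (e |: S); have /= H3 := IH' S.
set A := _ ^+ size F in A0 H2 H3 *.
have H4 : A * (tau * g S) <= expect (fun=> p) F g (e |: S).
  by apply: le_trans H2; apply: ler_wpM2l.
have H5 : p * (A * (tau * g S)) <= p * expect (fun=> p) F g (e |: S) by apply: ler_wpM2l.
have H6 : (1 - p) * (A * g S) <= (1 - p) * expect (fun=> p) F g S.
  by apply: ler_wpM2l; rewrite // subr_ge0.
rewrite exprS -/A; apply: le_trans (lerD H5 H6).
rewrite le_eqVlt; apply/orP; left; apply/eqP; ring.
Qed.

Lemma expect_setU1_le (p : R) F g e S : 0 <= p <= 1 -> (forall f P, g (f |: P) <= g P) ->
  expect (fun=> p) F g (e |: S) <= expect (fun=> p) F g S.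
Proof.
move=> Hp Hg; have /andP[p0 p1] := Hp; elim: F S => [|f F IH] S //=.
rewrite setUCA; apply: lerD; apply: ler_wpM2l; rewrite ?subr_ge0 //.
Qed.

Lemma expect_le_start (p : R) F g S : 0 <= p <= 1 -> (forall f P, g (f |: P) <= g P) ->
  expect (fun=> p) F g S <= g S.
Proof.
move=> Hp Hg; have /andP[p0 p1] := Hp; elim: F S => [|f F IH] S //=.
have H1 : p * expect (fun=> p) F g (f |: S) <= p * g S.
  by apply: ler_wpM2l => //; apply: le_trans (IH _) _.
have H2 : (1 - p) * expect (fun=> p) F g S <= (1 - p) * g S.
  by apply: ler_wpM2l; rewrite ?subr_ge0.
lra.
Qed.

End RandomSubset.

(** * Components of multigraphs *)

Section Multigraph.
Variables (V X : finType) (src tgt : X -> V).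
Implicit Types (P Q : {set X}) (x y z : V) (phi : V -> V).

Definition adj P x y :=
  [exists e in P, (src e == x) && (tgt e == y) || (src e == y) && (tgt e == x)].

Definition conn P := connect (adj P).

Definition comps P := n_comp (adj P) predT.

(** A labelling presents the components as the fibres of a map.  Inductions on
    bonds carry a labelling along, which [merge_labels] updates explicitly. *)
Definition labels P phi := forall x y, conn P x y = (phi x == phi y).

Lemma adj_sym P : symmetric (adj P).
Proof.
by move=> x y; apply/existsP/existsP => -[e /andP[eP H]]; exists e;
  rewrite eP orbC.
Qed.

Lemma conn_sym P : symmetric (conn P).
Proof. exact/sym_connect_sym/adj_sym. Qed.

Lemma conn_trans P : transitive (conn P).
Proof. exact: connect_trans. Qed.

Lemma conn_refl P x : conn P x x.
Proof. exact: connect0. Qed.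

Lemma conn_edge P e : e \in P -> conn P (src e) (tgt e).
Proof.
by move=> eP; apply: connect1; apply/existsP; exists e; rewrite eP !eqxx.
Qed.

Lemma sub_conn P Q x y : P \subset Q -> conn P x y -> conn Q x y.
Proof.
move=> PQ; apply: connect_sub => {}x {}y /existsP[e /andP[eP H]].
by apply: connect1; apply/existsP; exists e; rewrite (subsetP PQ).
Qed.

Lemma labels_root P : labels P (fingraph.root (adj P)).
Proof. by move=> x y; rewrite root_connect //; apply: conn_sym. Qed.

Lemma comps_labels P phi : labels P phi -> comps P = #|[set phi x | x in [set: V]]|.
Proof.
move=> Hphi; rewrite /comps /n_comp_mem -[LHS](@card_in_imset _ _ phi).
  apply: eq_card => u; apply/imsetP/imsetP => -[x xP ->]; first by exists x; rewrite ?inE.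
  exists (fingraph.root (adj P) x); last by apply/eqP; rewrite -Hphi; exact: connect_root.
  by rewrite inE /= andbT; apply: roots_root; exact: conn_sym.
move=> x y /andP[/eqP rx _] /andP[/eqP ry _] /eqP; rewrite -Hphi => /fingraph.rootP.
by rewrite rx ry; apply; exact: conn_sym.
Qed.

Definition merge_labels phi x y z := if phi z == phi y then phi x else phi z.

(** Opening [e] joins the fibres of its two ends.  Either label may survive;
    [spanning_bound] needs this freedom to keep the label of its root. *)
Lemma labels_merge_labels P phi e : labels P phi ->
  labels (e |: P) (merge_labels phi (src e) (tgt e)) /\
  labels (e |: P) (merge_labels phi (tgt e) (src e)).
Proof.
move=> Hphi.
pose r x y := [|| conn P x y, conn P x (src e) && conn P (tgt e) y
                 | conn P x (tgt e) && conn P (src e) y].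
(* a path through [e] may be shortened so as to use it once *)
suff E x y : conn (e |: P) x y = r x y.
  by split=> x y; rewrite E /r !Hphi /merge_labels;
    case: (phi x =P phi (tgt e)); case: (phi y =P phi (tgt e));
    case: (phi x =P phi (src e)); case: (phi y =P phi (src e));
    do ![case: eqP => ? /=]; congruence.
have sub a b : conn P a b -> conn (e |: P) a b by apply: sub_conn; exact: subsetU1.
have ed : conn (e |: P) (src e) (tgt e) by apply: conn_edge; rewrite setU11.
have de : conn (e |: P) (tgt e) (src e) by rewrite conn_sym.
apply/idP/idP; last first.
  case/or3P => [/sub//|/andP[/sub H1 /sub H2]|/andP[/sub H1 /sub H2]].
    exact: conn_trans (conn_trans H1 ed) H2.
  exact: conn_trans (conn_trans H1 de) H2.
have cl : closed (adj (e |: P)) (r x).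
  apply: intro_closed => [|a b]; first exact: conn_sym.
  move=> /existsP[f /andP[]]; rewrite !inE => /orP[/eqP->|fP] H;
    rewrite !unfold_in /r /= => H1.
    case/orP: H H1 => /andP[/eqP<- /eqP<-].
      by case/or3P => [->|/andP[-> _]|/andP[-> _]]; rewrite ?conn_refl ?orbT.
    by case/or3P => [->|/andP[-> _]|/andP[-> _]]; rewrite ?conn_refl ?orbT.
  have ab : conn P a b by apply: connect1; apply/existsP; exists f; rewrite fP.
  case/or3P: H1 => [H1|/andP[-> H1]|/andP[-> H1]];
    by rewrite (conn_trans H1 ab) ?orbT.
move=> H; rewrite -[r x y]/(y \in r x) -(closed_connect cl H).
by rewrite unfold_in /r conn_refl.
Qed.

Lemma labels_setU1_conn P phi e : labels P phi -> conn P (src e) (tgt e) ->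
  labels (e |: P) phi.
Proof.
move=> Hphi; rewrite Hphi => /eqP H x y.
have [-> _] := labels_merge_labels e Hphi.
have E (a b : V) : (if a == b then b else a) = a by case: eqP.
by rewrite /merge_labels -H !E.
Qed.

Lemma imset_merge_labels (D : {set V}) phi x y : phi x != phi y ->
  phi x \in [set phi z | z in D] ->
  [set merge_labels phi x y z | z in D] = [set phi z | z in D] :\ phi y.
Proof.
move=> Hxy xD; apply/setP => u; rewrite !inE; apply/imsetP/andP.
  case=> z zD ->; rewrite /merge_labels; case: (eqVneq (phi z) (phi y)) => Hz; split=> //.
  by apply/imsetP; exists z.
by case=> Hu /imsetP[z zD Ez]; exists z; rewrite // /merge_labels -Ez (negbTE Hu).
Qed.

Lemma comps_setU1 P e :
  (comps (e |: P) + ~~ conn P (src e) (tgt e) = comps P)%N.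
Proof.
have H := @labels_root P; have [c|nc] := boolP (conn P _ _).
  by rewrite (comps_labels H) (comps_labels (labels_setU1_conn H c)) addn0.
have [H' _] := labels_merge_labels e H.
rewrite (comps_labels H) (comps_labels H') imset_merge_labels //.
  3: by apply/imsetP; exists (src e).
  rewrite [RHS](cardsD1 (fingraph.root (adj P) (tgt e))) addnC; congr (_ + _)%N.
  by apply/esym/eqP; rewrite eqb1; apply/imsetP; exists (tgt e).
by rewrite -H.
Qed.

Lemma comps_le P e : (comps (e |: P) <= comps P)%N.
Proof. by rewrite -(comps_setU1 P e) leq_addr. Qed.

End Multigraph.

(** * Exponential moments of rare local events *)

Section Rare.
Variables (R : realFieldType) (X : finType) (p : R).
Hypothesis Hp : 0 <= p <= 1.
Implicit Types (F : seq X) (g h : {set X} -> R) (S P A : {set X}).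

Let p0 : 0 <= p. Proof. by case/andP: Hp. Qed.
Let p1 : 0 <= 1 - p. Proof. by rewrite subr_ge0; case/andP: Hp. Qed.

Definition busy A P := (1 < #|P :&: A|)%N.

Let busy_drop A F h S : (forall P, 0 <= h P) -> (forall f P, h (f |: P) <= h P) ->
  expect (fun=> p) F (fun P => (busy A P)%:R * h P) S <= h S.
Proof.
move=> h0 hd; apply: le_trans (expect_le_start F S Hp hd).
apply: (@expect_le _ _ (fun=> True)) => // P _.
by rewrite -[leRHS]mul1r ler_wpM2r // lern1 leq_b1.
Qed.

Let card_step A e S : (#|(e |: S) :&: A| <= (#|S :&: A|).+1)%N.
Proof.
rewrite setIUl; apply: leq_trans (leq_card_setU _ _) _.
by rewrite -add1n leq_add2r -(cards1 e) subset_leq_card // subsetIl.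
Qed.

Let busy_single A F h S : (forall P, 0 <= h P) -> (forall f P, h (f |: P) <= h P) ->
  (#|S :&: A| <= 1)%N ->
  expect (fun=> p) F (fun P => (busy A P)%:R * h P) S <= h S * ((size F)%:R * p).
Proof.
move=> h0 hd; elim: F S => [|e F IH] S HS /=.
  by rewrite /busy ltnNge HS !mul0r mulr0.
have := IH S HS; have := busy_drop A F (e |: S) h0 hd.
have := hd e S; have := h0 S; rewrite -(natr1 (size F)).
set x := expect _ _ _ _; set y := expect _ _ _ _; set r := (size F)%:R => a1 a2 a3 a4.
have a5 : p * x <= p * h S by apply: ler_wpM2l => //; apply: le_trans a2.
have a6 : (1 - p) * y <= 1 * (h S * (r * p)).
  apply: (@le_trans _ _ ((1-p) * (h S * (r * p)))); first exact: ler_wpM2l.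
  by apply: ler_wpM2r; [rewrite !mulr_ge0 // ler0n | rewrite gerBl].
lra.
Qed.

(** Two elements of [A] have to be drawn, whence the square.  The decreasing
    factor [h] stands for the weight of everything revealed later: a weight that
    does not grow when a bond is opened cannot favour busy sets. *)
Lemma busy_prob A F h S : (forall P, 0 <= h P) -> (forall f P, h (f |: P) <= h P) ->
  S :&: A = set0 ->
  expect (fun=> p) F (fun P => (busy A P)%:R * h P) S <= h S * ((size F)%:R * p) ^+ 2.
Proof.
move=> h0 hd; elim: F S => [|e F IH] S HS /=.
  by rewrite /busy HS cards0 !mul0r expr0n mulr0.
have HS1 : (#|(e |: S) :&: A| <= 1)%N by rewrite (leq_trans (card_step _ _ _)) // HS cards0.
have := IH S HS; have := busy_single F h0 hd HS1.
have := hd e S; have := h0 S; rewrite -(natr1 (size F)).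
have r0 : 0 <= (size F)%:R :> R by rewrite ler0n.
move: r0; set x := expect _ _ _ _; set y := expect _ _ _ _;
  set r := (size F)%:R => r0 a1 a2 a3 a4.
have a5 : p * x <= p * (h S * (r * p)).
  apply: ler_wpM2l => //; apply: le_trans a3 _.
  by apply: ler_wpM2r => //; rewrite mulr_ge0.
have a6 : (1 - p) * y <= 1 * (h S * (r * p)^+2).
  apply: (@le_trans _ _ ((1-p) * (h S * (r * p)^+2))); first exact: ler_wpM2l.
  by apply: ler_wpM2r; [rewrite mulr_ge0 // exprn_ge0 // mulr_ge0 | rewrite gerBl].
have a7 : 0 <= h S * p ^+ 2 * (r + 1) by rewrite !mulr_ge0 // ?exprn_ge0 // addr_ge0.
apply: le_trans (lerD a5 a6) _.
by rewrite -subr_ge0; apply: le_trans a7 _; rewrite le_eqVlt; apply/orP; left; apply/eqP; ring.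
Qed.

(** The blocks [Fr t] are revealed one after the other.  Given the others, block
    [t] multiplies the mean by at most [1 + a * P] with [P] the relative weight of
    [A t] being busy.  The bound [(1 - p) ^+ r] is the chance that the whole block is
    closed, which compares the start of the block with its end. *)
Lemma busy_moment (I : eqType) (ts : seq I) (Fr : I -> seq X) (A : I -> {set X})
    (rest : seq X) g S (r : nat) (a : R) :
  p < 1 -> 1 <= a -> uniq ts -> (forall t, (size (Fr t) <= r)%N) ->
  (forall P, 0 <= g P) -> (forall f P, g (f |: P) <= g P) ->
  {in ts, forall t, S :&: A t = set0} ->
  {in ts &, forall t t', t != t' -> forall e, e \in Fr t' -> e \notin A t} ->
  {in ts, forall t, forall e, e \in rest -> e \notin A t} ->
  expect (fun=> p) (flatten (map Fr ts) ++ rest)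
    (fun P => (\prod_(t <- ts) a ^+ busy (A t) P) * g P) S
  <= (1 + a * (r%:R * p) ^+ 2 / (1 - p) ^+ r) ^+ size ts
     * expect (fun=> p) (flatten (map Fr ts) ++ rest) g S.
Proof.
move=> plt1 a1 + Hr g0 gd; set C := 1 + _.
have q1 : 0 < 1 - p by rewrite subr_gt0.
have C0 : 0 <= C.
  rewrite addr_ge0 // divr_ge0 ?exprn_ge0 // mulr_ge0 ?exprn_ge0 ?mulr_ge0 //.
  by rewrite (le_trans _ a1).
elim: ts S => [|t ts IH] S /= Huniq HS HA Hrest.
  by rewrite expr0 mul1r; apply: (@expect_le _ _ (fun=> True)) => // P _; rewrite big_nil mul1r.
case/andP: Huniq => tts Huniq.
rewrite -!catA !expect_cat -!expect_cat.
set Q := flatten _ ++ rest.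
pose h := expect (fun=> p) Q g.
have h0 P : 0 <= h P by apply: expect_ge0.
have hd f P : h (f |: P) <= h P by apply: expect_setU1_le.
have HQ e : e \in Q -> e \notin A t.
  rewrite mem_cat => /orP[/flatten_mapP[t' t'ts et']|]; last exact: Hrest (mem_head _ _) _.
  apply: (HA t t') et'; rewrite ?mem_head ?inE ?t'ts ?orbT //.
  by apply: contraNneq tts => ->.
rewrite expect_cat [expect _ (_ ++ _) g S]expect_cat -/h.
apply: (@le_trans _ _
    (expect (fun=> p) (Fr t) (fun P => C ^+ size ts * (a ^+ busy (A t) P * h P)) S)).
  apply: (@expect_le _ _ (fun P => {in ts, forall t, P :&: A t = set0})) => //.
  + move=> e P et HP t' t'ts; rewrite setIUl HP // setU0; apply/setP => f.
    rewrite !inE; apply/negbTE; apply/negP => /andP[/eqP->]; apply/negP.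
    apply: (HA t' t) et; rewrite ?mem_head ?inE ?t'ts ?orbT //.
    by apply: contraNneq tts => <-.
  + move=> P HP; rewrite mulrCA.
    have H := IH P Huniq HP
      (fun u v uts vts => HA u v (mem_behead (s := t :: ts) uts)
         (mem_behead (s := t :: ts) vts))
      (fun u uts => Hrest u (mem_behead (s := t :: ts) uts)).
    apply: le_trans (_ : a ^+ busy (A t) P *
        expect (fun=> p) Q (fun P0 => (\prod_(j <- ts) a ^+ busy (A j) P0) * g P0) P <= _);
          last first.
      by apply: ler_wpM2l => //; rewrite exprn_ge0 // (le_trans _ a1).
    rewrite -expectZ le_eqVlt; apply/orP; left; apply/eqP.
    apply: (@expect_ext _ _ (fun P' => P' :&: A t = P :&: A t)) => //.
      move=> e P' eQ <-; rewrite setIUl; suff -> : [set e] :&: A t = set0 by rewrite set0U.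
      apply/setP => f; rewrite !inE; apply/negbTE; apply/negP => /andP[/eqP->].
      by apply/negP; exact: HQ.
    by move=> P' HP'; rewrite big_cons /busy HP' mulrA.
  by move=> t' t'ts; apply: HS; rewrite inE t'ts orbT.
rewrite expectZ exprSr -mulrA; apply: ler_wpM2l; first exact: exprn_ge0.
have HSt : S :&: A t = set0 by apply: HS; rewrite mem_head.
have B := busy_prob (Fr t) h0 hd HSt.
have L : (1 - p) ^+ r * h S <= expect (fun=> p) (Fr t) h S.
  have H : (1 - p + p * 0) ^+ size (Fr t) * h S <= expect (fun=> p) (Fr t) h S.
    by apply: expect_ge_pow => // *; rewrite mul0r.
  rewrite mulr0 addr0 in H.
  apply: le_trans H; apply: ler_wpM2r => //.
  by apply: ler_wiXn2l; rewrite ?gerBl.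
have B' : expect (fun=> p) (Fr t) (fun P => (busy (A t) P)%:R * h P) S <= h S * (r%:R * p)^+2.
  apply: le_trans B _; apply: ler_wpM2l => //.
  by rewrite lerXn2r ?nnegrE ?mulr_ge0 // ler_wpM2r // ler_nat.
apply: le_trans
    (_ : expect (fun=> p) (Fr t) (fun P => h P + a * ((busy (A t) P)%:R * h P)) S <= _).
  apply: (@expect_le _ _ (fun=> True)) => // P _; case: busy;
    rewrite ?expr1 ?expr0 ?mul1r ?mul0r ?mulr0 ?addr0 //.
  by rewrite lerDr.
rewrite expectD expectZ /C mulrDl mul1r lerD2l.
apply: le_trans (_ : a * (h S * (r%:R * p)^+2) <= _).
  by apply: ler_wpM2l => //; rewrite (le_trans _ a1).
have -> : a * (h S * (r%:R * p) ^+ 2) = a * (r%:R * p) ^+ 2 / (1 - p) ^+ r * ((1 - p) ^+ r *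
  h S).
  by field; rewrite expf_neq0 // gt_eqF.
apply: ler_wpM2l => //.
by rewrite divr_ge0 ?exprn_ge0 // mulr_ge0 ?exprn_ge0 ?mulr_ge0 // (le_trans _ a1).
Qed.

End Rare.

(** * Random-cluster weights *)

Section RandomCluster.
Variables (R : realFieldType) (V X : finType) (src tgt : X -> V) (p q : R).
Hypotheses (Hp : 0 <= p <= 1) (plt1 : p < 1) (q1 : 1 <= q).
Implicit Types (F : seq X) (S P : {set X}) (phi : V -> V).

Let p0 : 0 <= p. Proof. by case/andP: Hp. Qed.
Let p1 : 0 <= 1 - p. Proof. by rewrite subr_ge0; case/andP: Hp. Qed.
Let q0 : 0 < q. Proof. exact: lt_le_trans q1. Qed.

Local Notation c := (comps src tgt).
Local Notation conn := (conn src tgt).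
Local Notation E := (expect (fun=> p)).

Definition clusterw P : R := q ^+ c P.

(** Mean cost of a bond that joins two different clusters. *)
Definition bond_factor : R := 1 - p + p / q.
Local Notation rho := bond_factor.

Lemma clusterw_gt0 P : 0 < clusterw P. Proof. exact: exprn_gt0. Qed.
Lemma clusterw_ge0 P : 0 <= clusterw P. Proof. exact/ltW/clusterw_gt0. Qed.

Lemma bond_factor_gt0 : 0 < rho.
Proof. by rewrite /bond_factor ltr_wpDr ?subr_gt0 // divr_ge0 // ltW. Qed.

Lemma bond_factor_le1 : rho <= 1.
Proof.
have : p / q <= p by rewrite ler_pdivrMr // ler_peMr.
by rewrite /bond_factor; lra.
Qed.

Lemma clusterw_setU1 P e :
  clusterw P = q ^+ (~~ conn P (src e) (tgt e)) * clusterw (e |: P).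
Proof. by rewrite /clusterw -exprD addnC comps_setU1. Qed.

Lemma clusterw_setU1_le e P : clusterw (e |: P) <= clusterw P.
Proof. by rewrite /clusterw ler_weXn2l // comps_le. Qed.

Lemma clusterw_setU1_ge e P : q^-1 * clusterw P <= clusterw (e |: P).
Proof.
rewrite ler_pdivrMl // (clusterw_setU1 P e) ler_wpM2r ?clusterw_ge0 //.
by rewrite -[leRHS]expr1 ler_weXn2l // leq_b1.
Qed.

Lemma expect_clusterw_ge F S : rho ^+ size F * clusterw S <= E F clusterw S.
Proof.
by apply: expect_ge_pow => // [|P|e P _];
  rewrite ?invr_ge0 ?clusterw_ge0 ?clusterw_setU1_ge // ltW.
Qed.

Definition crossing F P := count (fun e => ~~ conn P (src e) (tgt e)) F.

(** A bond with unconnected ends changes the total weight by exactly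
    [bond_factor]; dividing by this factor once for each bond that is crossing at
    the end gives a quantity that decreases in mean as bonds are revealed.  Hence a
    configuration with few bonds inside its clusters has weight at
    most about [bond_factor ^+ size F]. *)
Lemma expect_crossing_le F S :
  E F (fun P => clusterw P * rho ^- crossing F P) S <= clusterw S.
Proof.
have r0 := bond_factor_gt0.
elim: F S => [|e F IH] S /=; first by rewrite invr1 mulr1.
have A : E F (fun P => clusterw P * rho ^- crossing (e :: F) P) (e |: S)
         <= clusterw (e |: S).
  apply: le_trans (IH _); rewrite le_eqVlt; apply/orP; left; apply/eqP.
  apply: (@expect_ext _ _ (fun P => e \in P)); [by move=> f P _ eP;
    rewrite inE eP orbT|move=> P eP|by rewrite setU11].
  by rewrite /crossing /= conn_edge.
rewrite (clusterw_setU1 S e) in IH *; have cw := clusterw_ge0 (e |: S).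
have [cS|ncS] := boolP (conn S _ _).
  have B : E F (fun P => clusterw P * rho ^- crossing (e :: F) P) S
         <= clusterw (e |: S).
    rewrite -[leRHS]mul1r -[X in X * _]/(q ^+ (~~ true)) -cS -clusterw_setU1.
    apply: le_trans (IH _); rewrite le_eqVlt; apply/orP; left; apply/eqP.
    apply: (@expect_ext _ _ (fun P => S \subset P)) => // [f P _ SP|P SP].
      exact: subset_trans SP (subsetU1 _ _).
    by rewrite /crossing /= (sub_conn SP).
  move: (ler_wpM2l p0 A) (ler_wpM2l p1 B) => /=; rewrite expr0 mul1r; lra.
have B : E F (fun P => clusterw P * rho ^- crossing (e :: F) P) S
       <= rho^-1 * (q * clusterw (e |: S)).
  rewrite -[X in X * clusterw _]expr1 -[X in q ^+ X]/(nat_of_bool (~~ false)).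
  rewrite -(negbTE ncS) -clusterw_setU1.
  apply: le_trans (_ : rho^-1 * E F (fun P => clusterw P * rho ^- crossing F P) S <= _);
    last first.
    by apply: ler_wpM2l (IH S); rewrite invr_ge0 ltW.
  rewrite -expectZ; apply: (@expect_le _ _ (fun=> True)) => // P _.
  rewrite mulrCA ler_wpM2l ?clusterw_ge0 // /crossing /= addnC.
  rewrite -!exprVn exprD mulrC ler_wpM2r ?exprn_ge0 ?invr_ge0 ?(ltW r0) //.
  by rewrite -[leRHS]expr1 ler_weXn2l ?leq_b1 // invf_ge1 // bond_factor_le1.
have C : p + (1 - p) * (rho^-1 * q) <= q.
  have -> : p + (1 - p) * (rho^-1 * q) = q * (p / q + (1 - p) / rho).
    by field; rewrite !gt_eqF.
  rewrite -[leRHS]mulr1 ler_wpM2l ?(ltW q0) //.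
  have Er : 1 = (p / q + (1 - p)) / rho :> R by rewrite addrC divff // gt_eqF.
  rewrite [leRHS]Er.
  rewrite [leRHS]mulrDl lerD2r ler_peMr ?divr_ge0 ?(ltW q0) //.
  by rewrite invf_ge1 // bond_factor_le1.
move: (ler_wpM2l p0 A) (ler_wpM2l p1 B) (ler_wpM2r cw C) => /=; rewrite expr1; lra.
Qed.

Definition degree F phi u := (\sum_(e <- F) ((phi (src e) == u) + (phi (tgt e) == u)))%N.

Lemma degree_merge_labels F phi a b u : phi a != phi b -> u != phi b ->
  degree F (merge_labels phi a b) u = (degree F phi u + (u == phi a) * degree F phi (phi b))%N.
Proof.
move=> ab ub; rewrite /degree big_distrr -big_split; apply: eq_bigr => e _.
have H x : ((merge_labels phi a b x == u) =
  (phi x == u) + (u == phi a) * (phi x == phi b) :> nat)%N.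
  rewrite /merge_labels; case: (eqVneq (phi x) (phi b)) => [->|] /=.
    by rewrite [phi b == u]eq_sym (negbTE ub) muln1 eq_sym.
  by rewrite muln0 addn0.
by rewrite !H /= mulnDr addnACA.
Qed.

(** If [P] connects [D], the components that meet [D] are joined by a spanning
    tree, in which every component but that of the root [v0] is joined to its
    parent by one of its own bonds.  Each tree bond costs [p / q], so the sum over
    trees is at most a product of degrees.  The induction on [F] is
    deletion-contraction. *)
Lemma spanning_bound F S phi v0 (D : {set V}) : labels src tgt S phi -> v0 \in D ->
  (forall e, e \in F -> phi (src e) \in [set phi x | x in D] /\
                       phi (tgt e) \in [set phi x | x in D]) ->
  E F (fun P => [forall x in D, conn P v0 x]%:R * clusterw P) S
  <= clusterw S * \prod_(u in [set phi x | x in D] :\ phi v0) (p / q * (degree F phi u)%:R).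
Proof.
move=> + v0D; elim: F S phi => [|e F IH] S phi Hphi HF /=.
  case: forall_inP => [H|_]; last first.
    rewrite mul0r mulr_ge0 ?clusterw_ge0 // prodr_ge0 // => u _.
    by rewrite mulr_ge0 ?ler0n // divr_ge0 // ltW.
  rewrite mul1r big1 ?mulr1 // => u; rewrite !inE => /andP[+ /imsetP[x xD ux]].
  by rewrite ux -[_ == _]negbK eq_sym -Hphi H.
have [HsF HtF] := HF e (mem_head _ _).
have HF' f : f \in F -> phi (src f) \in [set phi x | x in D] /\
                       phi (tgt f) \in [set phi x | x in D].
  by move=> fF; apply: HF; rewrite inE fF orbT.
have dS u : degree (e :: F) phi u = ((phi (src e) == u) + (phi (tgt e) == u) + degree F phi
  u)%N.
  by rewrite /degree big_cons.
have IH2 := IH S phi Hphi HF'.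
have y0 : 0 <= p / q by rewrite divr_ge0 // ltW.
have G0 (A : {set V}) (f : V -> nat) : 0 <= \prod_(u in A) (p / q * (f u)%:R).
  by rewrite prodr_ge0 // => u _; rewrite mulr_ge0.
have [cS|ncS] := boolP (conn S (src e) (tgt e)).
  have IH1 := IH (e |: S) phi (labels_setU1_conn Hphi cS) HF'.
  have Ec : clusterw S = clusterw (e |: S) by rewrite (clusterw_setU1 S e) cS mul1r.
  move: (ler_wpM2l p0 IH1) (ler_wpM2l p1 IH2); rewrite -Ec => I1 I2.
  apply: le_trans (_ : clusterw S * \prod_(u in [set phi x | x in D] :\ phi v0) (p / q *
    (degree F phi u)%:R) <= _).
    by move: I1 I2; lra.
  rewrite ler_wpM2l ?clusterw_ge0 //; apply: ler_prod => u _.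
  by rewrite mulr_ge0 //= ler_wpM2l // ler_nat dS leq_addl.
have Ec : clusterw S = q * clusterw (e |: S) by rewrite (clusterw_setU1 S e) ncS expr1.
(* orient the bond so that the component [phi b], which is absorbed, is not that
   of the root *)
have [a [b [[Hab Hb] Ha' Hb' dS' Hm]]] : exists a b, [/\ phi a != phi b /\ phi b != phi v0,
    phi a \in [set phi x | x in D], phi b \in [set phi x | x in D],
    forall u, degree (e :: F) phi u = ((phi a == u) + (phi b == u) + degree F phi u)%N &
    labels src tgt (e |: S) (merge_labels phi a b)].
  have [l1 l2] := labels_merge_labels e Hphi; move: ncS; rewrite Hphi => ncS.
  case: (eqVneq (phi (tgt e)) (phi v0)) => [tv|tv].
    exists (tgt e), (src e); split=> //; first by rewrite -tv eq_sym.
    by move=> u; rewrite dS [X in (X + _)%N]addnC.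
  by exists (src e), (tgt e).
have HF2 f : f \in F -> merge_labels phi a b (src f) \in
    [set merge_labels phi a b x | x in D] /\
    merge_labels phi a b (tgt f) \in [set merge_labels phi a b x | x in D].
  move=> /HF' [/imsetP[x xD Ex1] /imsetP[y yD Ey]].
  by split; apply/imsetP; [exists x|exists y]; rewrite // /merge_labels ?Ex1 ?Ey.
have := IH (e |: S) _ Hm HF2; rewrite imset_merge_labels //.
have -> : merge_labels phi a b v0 = phi v0 by rewrite /merge_labels eq_sym (negbTE Hb).
set A := [set phi x | x in D] in Ha' Hb' IH2 *.
have -> : (A :\ phi b) :\ phi v0 = (A :\ phi v0) :\ phi b by rewrite !setDDl setUC.
have bA : phi b \in A :\ phi v0 by rewrite !inE Hb.
move: (ler_wpM2l p1 IH2) => {IH2}; rewrite !(big_setD1 _ bA) /=.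
set A1 := (A :\ phi v0) :\ phi b.
have -> : \prod_(u in A1) (p / q * (degree F (merge_labels phi a b) u)%:R)
   = \prod_(u in A1) (p / q * (degree F phi u + (u == phi a) * degree F phi (phi b))%N%:R).
  by apply: eq_bigr => u; rewrite !inE => /andP[ub _]; rewrite degree_merge_labels.
have -> : \prod_(u in A1) (p / q * (degree (e :: F) phi u)%:R)
      = \prod_(u in A1) (p / q * ((u == phi a) + degree F phi u)%N%:R).
  apply: eq_bigr => u; rewrite !inE => /andP[ub _].
  by rewrite dS' [phi b == u]eq_sym (negbTE ub) addn0 eq_sym.
have -> : degree (e :: F) phi (phi b) = (degree F phi (phi b)).+1.
  by rewrite dS' (negbTE Hab) eqxx.
set db := degree F phi (phi b).
have cw := clusterw_ge0 (e |: S).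
have db0 : 0 <= db%:R :> R by rewrite ler0n.
case: (boolP (phi a \in A1)) => [aA|aA].
  rewrite !(big_setD1 _ aA) /= !eqxx.
  set A2 := A1 :\ phi a.
  have -> : \prod_(u in A2) (p / q * (degree F phi u + (u == phi a) * db)%N%:R) =
    \prod_(u in A2) (p / q * (degree F phi u)%:R).
    by apply: eq_bigr => u; rewrite !inE => /andP[/negbTE-> _]; rewrite addn0.
  have -> : \prod_(u in A2) (p / q * ((u == phi a) + degree F phi u)%N%:R) =
    \prod_(u in A2) (p / q * (degree F phi u)%:R).
    by apply: eq_bigr => u; rewrite !inE => /andP[/negbTE-> _].
  set da := degree F phi (phi a); rewrite mul1n natrD -natr1 add1n -natr1 Ec.
  set Pi := \prod_(u in A2) _; have Pi0 : 0 <= Pi by apply: G0.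
  have da0 : 0 <= da%:R :> R by rewrite ler0n.
  move=> I2 /(ler_wpM2l p0) I1; apply: le_trans (lerD I1 I2) _.
  have -> : p * (clusterw (e |: S) * (p / q * (da%:R + db%:R) * Pi)) =
            q * clusterw (e |: S) * (p/q)^+2 * (da%:R + db%:R) * Pi.
    by field; rewrite gt_eqF.
  have W0 : 0 <= q * clusterw (e |: S) * (p/q)^+2 * Pi.
    apply: mulr_ge0 => //; apply: mulr_ge0; last exact: exprn_ge0.
    by apply: mulr_ge0 => //; exact: ltW.
  have H3 : 0 <= (q * clusterw (e |: S) * (p/q)^+2 * Pi) * (1 + p * (da%:R * db%:R)).
    by rewrite mulr_ge0 // addr_ge0 // !mulr_ge0.
  rewrite -subr_ge0; apply: le_trans H3 _.
  by rewrite le_eqVlt; apply/orP; left; apply/eqP; ring.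
have aE u : u \in A1 -> (u == phi a) = false.
  by move=> uA; apply/negbTE; apply: contraNneq aA => <-.
have -> : \prod_(u in A1) (p / q * (degree F phi u + (u == phi a) * db)%N%:R) =
  \prod_(u in A1) (p / q * (degree F phi u)%:R).
  by apply: eq_bigr => u /aE ->; rewrite addn0.
have -> : \prod_(u in A1) (p / q * ((u == phi a) + degree F phi u)%N%:R) =
  \prod_(u in A1) (p / q * (degree F phi u)%:R).
  by apply: eq_bigr => u /aE ->.
set Pi := \prod_(u in A1) _; have Pi0 : 0 <= Pi by apply: G0.
rewrite -natr1 Ec => I2 /(ler_wpM2l p0) I1; apply: le_trans (lerD I1 I2) _.
have -> : p * (clusterw (e |: S) * Pi) = q * clusterw (e |: S) * (p / q) * Pi.
  by field; rewrite gt_eqF.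
have W0 : 0 <= p * (q * clusterw (e |: S) * (p / q) * Pi * db%:R).
  do 5![apply: mulr_ge0 => //]; exact: ltW.
rewrite -subr_ge0; apply: le_trans W0 _.
by rewrite le_eqVlt; apply/orP; left; apply/eqP; ring.
Qed.

End RandomCluster.

(** * The two-colour expansion *)

Section Shift.
Variables (R : realFieldType) (T : finType) (pr : T -> R).
Implicit Types (F : seq T) (g : {set T} -> R) (S : {set T}).

Lemma expect_setU1 F g v S :
  expect pr F (fun B => g (v |: B)) S = expect pr F g (v |: S).
Proof. by elim: F S => //= e F IH S; rewrite !IH setUCA. Qed.

Lemma expect_setD1 F g v S : v \notin F ->
  expect pr F (fun B => g (B :\ v)) S = expect pr F g (S :\ v).
Proof.
elim: F S => //= e F IH S; rewrite inE negb_or => /andP[ve vF]; rewrite !IH //.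
suff -> : (e |: S) :\ v = e |: S :\ v by [].
by apply/setP => u; rewrite !inE; case: eqVneq => [->|//]; rewrite (negbTE ve).
Qed.

(** Revealing [u] and [v] first isolates the only two vertices whose colour
    enters the factor of a bond. *)
Lemma expect_two L u v g : uniq L -> u \in L -> v \in L -> u != v ->
  let L' := rem v (rem u L) in
  [/\ u \notin L', v \notin L' &
  expect pr L g set0
   = pr u * (pr v * expect pr L' g [set u; v] + (1 - pr v) * expect pr L' g [set u])
     + (1 - pr u) * (pr v * expect pr L' g [set v] + (1 - pr v) * expect pr L' g set0)].
Proof.
move=> UL uL vL uv L'.
have vL1 : v \in rem u L by rewrite (mem_rem_uniq _ UL) !inE eq_sym uv.
split.
+ by rewrite (mem_rem_uniq _ (rem_uniq _ UL)) !inE (mem_rem_uniq _ UL) !inE eqxx andbF.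
+ by rewrite (mem_rem_uniq _ (rem_uniq _ UL)) inE eqxx.
rewrite (@expect_perm _ _ _ _ (u :: v :: L')); last first.
  by apply: perm_trans (perm_to_rem uL) _; rewrite perm_cons; exact: perm_to_rem.
by rewrite /= !setU0 (setUC [set v] [set u]).
Qed.

End Shift.

Section Colouring.
Variables (R : realFieldType) (V X : finType) (src tgt : X -> V) (p q : R).
Hypotheses (Hp : 0 <= p <= 1) (q2 : 2 <= q).
Implicit Types (F : seq X) (S P : {set X}) (phi : V -> V) (B : {set V}).

Let p0 : 0 <= p. Proof. by case/andP: Hp. Qed.
Let p1 : 0 <= 1 - p. Proof. by rewrite subr_ge0; case/andP: Hp. Qed.
Let q0 : 0 < q. Proof. exact: lt_le_trans q2. Qed.
Let q1 : 1 <= q. Proof. by move: q2; lra. Qed.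

Local Notation conn := (conn src tgt).
Local Notation clusterw := (clusterw src tgt q).

(** Colour each cluster blue with probability [(q - 1) / q], and let [B] be the
    blue vertices.  Given [B], the bonds form a random-cluster model with parameter
    [q - 1] on [B] and with parameter 1 outside, and bonds between the two are
    closed.  The three values are the [bond_factor] of parameter [q - 1], the
    probability of a closed bond, and the [bond_factor] of parameter 1. *)
Definition colour_weight phi B e : R :=
  if phi (src e) \in B then
    if phi (tgt e) \in B then 1 - p + p / (q - 1) else 1 - p
  else if phi (tgt e) \in B then 1 - p else 1.

Definition colour_prob : V -> R := fun=> (q - 1) / q.

Local Notation EV := (expect colour_prob).
Local Notation G phi F := (fun B => \prod_(e <- F) colour_weight phi B e).

Let qp0 : 0 < q - 1. Proof. by move: q2; lra. Qed.

Lemma colour_weight_bounds phi B e : 0 <= colour_weight phi B e <= 1.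
Proof.
rewrite /colour_weight.
have H : 0 <= p / (q - 1) <= p.
  rewrite divr_ge0 ?(ltW qp0) //= ler_pdivrMr // ler_peMr //; move: q2; lra.
by have /andP[h1 h2] := Hp; case: ifP => _; case: ifP => _; lra.
Qed.

Lemma colour_prob01 u : 0 <= colour_prob u <= 1.
Proof.
by rewrite /colour_prob divr_ge0 ?(ltW qp0) ?(ltW q0) //= ler_pdivrMr // mul1r gerBl.
Qed.

(** Replacing the blue random-cluster model by its lower bound
    [(1 - p + p / (q - 1)) ^+ size] leaves an independent colouring of the
    vertices.  Induction on the bonds: when [e] joins two components their
    labels are merged, and the four colourings of the two labels are compared
    with the two colourings of the merged one; the weights of [colour_weight] are
    those for which both sides agree. *)
Lemma colouring_bound F S phi : labels src tgt S phi ->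
  clusterw S * EV (enum V) (G phi F) set0 <= expect (fun=> p) F clusterw S.
Proof.
elim: F S phi => [|e F IH] S phi Hphi /=.
  under eq_expect do rewrite big_nil.
  by rewrite expect_cst mulr1.
have IH2 := IH S phi Hphi.
have G0 phi' B : 0 <= G phi' F B.
  by apply: prodr_ge0 => f _; case/andP: (colour_weight_bounds phi' B f).
have [cS|ncS] := boolP (conn S (src e) (tgt e)).
  have IH1 := IH (e |: S) phi (labels_setU1_conn Hphi cS).
  have Ec : clusterw S = clusterw (e |: S) by rewrite (clusterw_setU1 _ _ q S e) cS mul1r.
  have H : EV (enum V) (G phi (e :: F)) set0 <= EV (enum V) (G phi F) set0.
    apply: (@expect_le _ _ (fun=> True)) => //; first exact: colour_prob01.
    move=> B _; rewrite big_cons -[leRHS]mul1r ler_wpM2r //.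
    by case/andP: (colour_weight_bounds phi B e).
  have := ler_wpM2l (clusterw_ge0 src tgt q1 S) H.
  move: (ler_wpM2l p0 IH1) (ler_wpM2l p1 IH2); rewrite -Ec; lra.
have [Hm _] := labels_merge_labels e Hphi.
have := IH _ _ Hm => IH1.
have Ec : clusterw S = q * clusterw (e |: S) by rewrite (clusterw_setU1 _ _ q S e) ncS expr1.
move: ncS; rewrite Hphi; set u := phi (src e); set v := phi (tgt e) => uv.
have [uL vL E2] := expect_two colour_prob (G phi F) (enum_uniq V) (mem_enum _ u) (mem_enum _
  v) uv.
have [_ _ E1] := expect_two colour_prob (G (merge_labels phi (src e) (tgt e)) F) (enum_uniq
  V) (mem_enum _ u) (mem_enum _ v) uv.
have [_ _ E3] := expect_two colour_prob (G phi (e :: F)) (enum_uniq V) (mem_enum _ u)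
  (mem_enum _ v) uv.
set L := rem v (rem u (enum V)) in uL vL E1 E2 E3.
have fix_uv (h1 h2 : {set V} -> R) B0 :
   (forall B, (u \in B) = (u \in B0) -> (v \in B) = (v \in B0) -> h1 B = h2 B) ->
   EV L h1 B0 = EV L h2 B0.
  move=> H; apply: (@expect_ext _ _ (fun B => (u \in B) = (u \in B0) /\ (v \in B) =
    (v \in B0))) => //.
    move=> f B fL [H1 H2]; rewrite !inE H1 H2.
    by split; case: eqVneq fL => // <-; rewrite ?(negbTE uL) ?(negbTE vL).
  by move=> B [H1 H2]; apply: H.
(* colourings of the merged labels are colourings of [phi] in which [v] copies
   the colour of [u] *)
have Hmem B x : (merge_labels phi (src e) (tgt e) x \in B) =
    (phi x \in (if u \in B then v |: B else B :\ v)).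
  rewrite /merge_labels -/u -/v; case: (eqVneq (phi x) v) => [->|xv]; case: ifP => uB;
    by rewrite !inE ?eqxx ?(negbTE xv).
have Gm1 B : u \in B -> G (merge_labels phi (src e) (tgt e)) F B = G phi F (v |: B).
  by move=> uB; apply: eq_bigr => f _; rewrite /colour_weight !Hmem uB.
have Gm0 B : u \notin B -> G (merge_labels phi (src e) (tgt e)) F B = G phi F (B :\ v).
  by move=> uB; apply: eq_bigr => f _; rewrite /colour_weight !Hmem (negbTE uB).
have uv' : (u == v) = false by apply/negbTE.
have vu' : (v == u) = false by rewrite eq_sym.
have M11 : EV L (G (merge_labels phi (src e) (tgt e)) F) [set u; v] = EV L (G phi F) [set u; v].
  rewrite (fix_uv _ (fun B => G phi F (v |: B))); last first.
    by move=> B uB _; apply: Gm1; rewrite uB !inE eqxx.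
  by rewrite (expect_setU1 _ _ (G phi F)) (setUidPr _) // sub1set !inE eqxx orbT.
have M10 : EV L (G (merge_labels phi (src e) (tgt e)) F) [set u] = EV L (G phi F) [set u; v].
  rewrite (fix_uv _ (fun B => G phi F (v |: B))); last first.
    by move=> B uB _; apply: Gm1; rewrite uB !inE eqxx.
  by rewrite (expect_setU1 _ _ (G phi F)) setUC.
have M01 : EV L (G (merge_labels phi (src e) (tgt e)) F) [set v] = EV L (G phi F) set0.
  rewrite (fix_uv _ (fun B => G phi F (B :\ v))); last first.
    by move=> B uB _; apply: Gm0; rewrite uB !inE uv'.
  by rewrite (expect_setD1 _ (G phi F)) // setDv.
have M00 : EV L (G (merge_labels phi (src e) (tgt e)) F) set0 = EV L (G phi F) set0.
  rewrite (fix_uv _ (fun B => G phi F (B :\ v))); last first.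
    by move=> B uB _; apply: Gm0; rewrite uB !inE.
  by rewrite (expect_setD1 _ (G phi F)) // set0D.
have N11 : EV L (G phi (e :: F)) [set u; v] = (1 - p + p / (q - 1)) * EV L (G phi F) [set u; v].
  rewrite -expectZ; apply: fix_uv => B uB vB.
  by rewrite big_cons /colour_weight -/u -/v uB vB !inE !eqxx orbT.
have N10 : EV L (G phi (e :: F)) [set u] = (1 - p) * EV L (G phi F) [set u].
  rewrite -expectZ; apply: fix_uv => B uB vB.
  by rewrite big_cons /colour_weight -/u -/v uB vB !inE !eqxx vu'.
have N01 : EV L (G phi (e :: F)) [set v] = (1 - p) * EV L (G phi F) [set v].
  rewrite -expectZ; apply: fix_uv => B uB vB.
  by rewrite big_cons /colour_weight -/u -/v uB vB !inE !eqxx uv'.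
have N00 : EV L (G phi (e :: F)) set0 = 1 * EV L (G phi F) set0.
  rewrite -expectZ; apply: fix_uv => B uB vB.
  by rewrite big_cons /colour_weight -/u -/v uB vB !inE.
rewrite {}M11 {}M10 {}M01 {}M00 in E1; rewrite {}N11 {}N10 {}N01 {}N00 in E3.
rewrite {}E1 in IH1; rewrite {}E2 in IH2; rewrite {}E3.
move: (ler_wpM2l p0 IH1) (ler_wpM2l p1 IH2) => I1 I2.
apply: le_trans (lerD I1 I2); rewrite Ec /colour_prob.
rewrite le_eqVlt; apply/orP; left; apply/eqP.
by field; rewrite !gt_eqF.
Qed.

End Colouring.

(** * Real estimates *)

Section Estimates.
Variable R : realType.
Implicit Types (x y t : R).

Lemma expR_ge_quadratic y : 0 <= y -> 1 + y + y ^+ 2 / 2 <= expR y.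
Proof.
move=> y0; have -> : 1 + y + y ^+ 2 / 2 = series (exp_coeff y) 3.
  by rewrite /series /= !big_nat_recr //= big_geq // /exp_coeff /= add0r !divr1.
apply: nondecreasing_cvgn_le; last exact: is_cvg_series_exp_coeff.
apply: nondecreasing_series => i _ _; exact: exp_coeff_ge0.
Qed.

(** With [t = expR y] this is [y < sinh y], for which the second-order expansion
    of the exponential suffices.  At [t = q - 1] it separates the critical density
    from [q]. *)
Lemma ln_lt_subinv t : 1 < t -> 2 * ln t < t - t^-1.
Proof.
move=> t1; have t0 : 0 < t by apply: lt_trans t1.
set y := ln t; have y0 : 0 < y by apply: ln_gt0.
have Et : t = expR y by rewrite /y lnK // posrE.
pose w := 1 + y + y ^+ 2 / 2.
have w0 : 0 < w by rewrite /w !addr_gt0 // divr_gt0 // exprn_gt0.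
have wt : w <= t by rewrite Et; apply: expR_ge_quadratic; exact: ltW.
apply: (@lt_le_trans _ _ (w - w^-1)); last first.
  by rewrite lerB // lef_pV2 ?posrE.
rewrite -(ltr_pM2r w0) mulrBl mulVf ?gt_eqF // -subr_gt0.
have : 0 < y ^+ 4 / 4 by rewrite divr_gt0 // exprn_gt0.
suff -> : w * w - 1 - 2 * y * w = y ^+ 4 / 4 by [].
by rewrite /w; field.
Qed.

Lemma ln_lt_sub1 t : 0 < t -> t != 1 -> ln t < t - 1.
Proof.
move=> t0 t1; have := @expR_gt1Dx R (ln t); rewrite ln_eq0 // lnK ?posrE // => /(_ t1).
lra.
Qed.

Lemma ln_sub_mono x t : 0 < x -> x <= t -> t <= 1 -> ln x - x <= ln t - t.
Proof.
move=> x0 xt t1; have t0 : 0 < t by apply: lt_le_trans xt.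
have H : ln (x / t) <= x / t - 1.
  have := @le_ln1Dx R (x / t - 1); have -> : 1 + (x / t - 1) = x / t by ring.
  by apply; rewrite ltrBrDl subrr divr_gt0.
rewrite ln_div ?posrE // in H.
have : x / t - 1 <= x - t; last by lra.
have -> : x / t - 1 = (x - t) / t by field; rewrite gt_eqF.
rewrite -subr_ge0.
have -> : x - t - (x - t) / t = (t - x) * (1 - t) / t by field; rewrite gt_eqF.
by rewrite divr_ge0 ?mulr_ge0 ?subr_ge0 // ltW.
Qed.

Lemma ffact_leq_exp m k : (m ^_ k <= m ^ k)%N.
Proof.
elim: k => // k IH; rewrite ffactnSr expnSr; apply: leq_mul => //; exact: leq_subr.
Qed.

(** Number of ways to choose [s] classes times the growth [s ^ s] of the number
    of trees on them. *)
Lemma bin_pow_le N s : 'C(N, s)%:R * s%:R ^+ s <= N%:R ^+ s * expR s%:R :> R.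
Proof.
case: s => [|s]; first by rewrite bin0 !expr0 !mul1r expR0.
have f0 : 0 < s.+1`!%:R :> R by rewrite ltr0n fact_gt0.
have H1 : s.+1%:R ^+ s.+1 <= s.+1`!%:R * expR s.+1%:R :> R.
  rewrite mulrC -ler_pdivrMr //; apply: le_trans (@expR_ge1Dxn R s.+1%:R s _) => //.
  by rewrite lerDr.
apply: le_trans (ler_wpM2l (ler0n _ _) H1) _.
rewrite mulrA ler_wpM2r ?expR_ge0 // -natrM bin_ffact -natrX ler_nat.
exact: ffact_leq_exp.
Qed.

Lemma sum_card_le N (Q : pred nat) (f : nat -> R) (b : R) :
  (forall s, (s <= N)%N -> Q s -> 'C(N, s)%:R * f s <= b) -> 0 <= b ->
  \sum_(D : {set 'I_N} | Q #|D|) f #|D| <= N.+1%:R * b.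
Proof.
move=> H b0.
rewrite (partition_big (fun D : {set 'I_N} => inord #|D| : 'I_N.+1) xpredT) //=.
have -> : N.+1%:R * b = \sum_(i < N.+1) b by rewrite sumr_const card_ord mulr_natl.
apply: ler_sum => i _.
have E (D : {set 'I_N}) : Q #|D| && (inord #|D| == i) = Q i && (#|D| == i).
  have : (#|D| <= N)%N by rewrite -[X in (_ <= X)%N]card_ord max_card.
  rewrite -ltnS => lt; rewrite -val_eqE /= inordK //.
  by case: (#|D| =P i) => [->|]; rewrite ?andbF.
rewrite (eq_bigl _ _ E); case: (boolP (Q i)) => [Qi|_] /=; last by rewrite big_pred0.
rewrite (eq_bigr (fun=> f i)); last by move=> D /eqP ->.
rewrite sumr_const -cardsE card_draws card_ord -mulr_natl; apply: H => //.
by rewrite -ltnS.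
Qed.

Lemma pow_le_expR (x b : R) (k : nat) : 0 <= x -> x <= expR b -> x ^+ k <= expR (k%:R * b).
Proof. by move=> x0 xb; rewrite expRM_natl; apply: lerXn2r; rewrite ?nnegrE ?expR_ge0. Qed.

End Estimates.

(** * A lower bound for the ordered phase *)

Lemma expR_convex (R : realType) (s a b : R) : 0 <= s <= 1 ->
  expR (s * a + (1 - s) * b) <= s * expR a + (1 - s) * expR b.
Proof.
by move=> /andP[s0 s1]; have := convex_expR (Itv01 s0 s1) a b; rewrite !convRE.
Qed.

(** Gibbs variational principle for a single colour: the density [(q - 1) / q] is
    replaced by [1 / q], at the price of a relative entropy
    [(q - 2) / q * ln (q - 1)]. *)
Lemma two_point_tilt (R : realType) (q a b : R) : 2 < q ->
  expR (- ((q - 2) / q * ln (q - 1)) + (q^-1 * a + (1 - q^-1) * b))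
  <= (q - 1) / q * expR a + (1 - (q - 1) / q) * expR b.
Proof.
move=> q2; have q0 : 0 < q by lra.
have q10 : 0 < q - 1 by lra.
set l := ln (q - 1).
have s01 : 0 <= q^-1 <= 1 by rewrite invr_ge0 ltW //= invf_le1 //; lra.
have := expR_convex (a + l) (b - l) s01.
have -> : expR (a + l) = (q - 1) * expR a by rewrite expRD lnK ?posrE // mulrC.
have -> : expR (b - l) = (q - 1)^-1 * expR b by rewrite expRD expRN lnK ?posrE // mulrC.
have -> : - ((q - 2) / q * l) + (q^-1 * a + (1 - q^-1) * b) =
   q^-1 * (a + l) + (1 - q^-1) * (b - l) by field; rewrite gt_eqF.
move=> H; apply: le_trans H _; rewrite le_eqVlt; apply/orP; left; apply/eqP.
by field; rewrite !gt_eqF.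
Qed.

(** Jensen's inequality under a change of product measure, one coordinate at a
    time; [kappa u] is minus the relative entropy of coordinate [u]. *)
Lemma gibbs (R : realType) (V : finType) (r s kappa : V -> R) L
    (f : {set V} -> R) S :
  (forall u, 0 <= r u <= 1) ->
  (forall u a b, expR (kappa u + (s u * a + (1 - s u) * b))
                 <= r u * expR a + (1 - r u) * expR b) ->
  expR (\sum_(u <- L) kappa u + expect s L f S) <= expect r L (fun B => expR (f B)) S.
Proof.
move=> Hr H; elim: L S => [|u L IH] S /=; first by rewrite big_nil add0r.
have /andP[r0 r1] := Hr u; have r1' : 0 <= 1 - r u by rewrite subr_ge0.
move: (ler_wpM2l r0 (IH (u |: S))) (ler_wpM2l r1' (IH S)) => H1 H2.
apply: le_trans (lerD H1 H2); apply: le_trans (H _ _ _).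
by rewrite ler_expR big_cons le_eqVlt; apply/orP; left; apply/eqP; ring.
Qed.

Lemma ln_ge_quadratic (R : realType) (p x : R) : 0 <= x -> x <= p -> p <= 2^-1 ->
  - (x + 2 * p ^+ 2) <= ln (1 - x).
Proof.
move=> x0 xp p2; have y0 : 0 < 1 - x by lra.
rewrite lerNl -lnV ?posrE //.
have -> : (1 - x)^-1 = 1 + x / (1 - x) by field; rewrite gt_eqF.
apply: le_trans (le_ln1Dx _) _.
  by apply: lt_le_trans (_ : 0 <= _); rewrite ?ltrN10 // divr_ge0 // ltW.
rewrite ler_pdivrMr //.
have a1 : 0 <= (p - x) * (p + x) by rewrite mulr_ge0 //; lra.
have a2 : 0 <= p ^+2 * (1 - 2 * x) by rewrite mulr_ge0 ?exprn_ge0 //; lra.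
rewrite -subr_ge0; apply: le_trans (addr_ge0 a1 a2) _.
by rewrite le_eqVlt; apply/orP; left; apply/eqP; ring.
Qed.

Section Ordered.
Variables (R : realType) (V X : finType) (src tgt : X -> V) (p q : R).
Hypotheses (p0 : 0 <= p) (p2 : p <= 2^-1) (q2 : 2 < q).

(** The mean of [- ln (colour_weight) / p] on a bond as [p] tends to 0, when both
    ends are independently blue with probability [1 / q]. *)
Definition ordered_rate : R := 2 * (q - 1) / q ^+ 2 + (q - 2) / (q ^+ 2 * (q - 1)).

(** Under the exchanged probabilities the dominating colour, of density
    [(q - 1) / q], is the one with parameter 1: it plays the role of the giant
    cluster.  Labels outside [C] meet no bond, and keep their original colour at no
    entropy cost. *)
Lemma ordered_bound (F : seq X) (S : {set X}) (phi : V -> V) (C : {set V}) :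
  labels src tgt S phi ->
  (forall e, e \in F -> phi (src e) \in C /\ phi (tgt e) \in C) ->
  clusterw src tgt q S *
    expR (- (#|C|%:R * ((q - 2) / q * ln (q - 1)))
          - (size F)%:R * (p * ordered_rate + 2 * p ^+ 2))
  <= expect (fun=> p) F (clusterw src tgt q) S.
Proof.
move=> Hphi HF.
have q0 : 0 < q by move: q2; lra.
have q10 : 0 < q - 1 by move: q2; lra.
have Hp : 0 <= p <= 1 by apply/andP; split => //; move: p2; lra.
have plt1 : p < 1 by move: p2; lra.
apply: le_trans (colouring_bound Hp (ltW q2) F Hphi).
apply: ler_wpM2l; first exact/clusterw_ge0/ltW/(lt_trans _ q2)/ltr1n.
pose w B e := colour_weight src tgt p q phi B e.
set rb : R := 1 - p + p / (q - 1).
have px : p / (q - 1) <= p by rewrite ler_pdivrMr // ler_peMr //; move: q2; lra.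
have px0 : 0 <= p / (q - 1) by rewrite divr_ge0 // ltW.
have w0 B e : 0 < w B e.
  by rewrite /w /colour_weight -/rb /rb; case: ifP => _; case: ifP => _; lra.
pose s u : R := if u \in C then q^-1 else (q - 1) / q.
pose kappa u : R := if u \in C then - ((q - 2) / q * ln (q - 1)) else 0.
pose f B := \sum_(e <- F) ln (w B e).
have -> : expect (@colour_prob _ V q) (enum V) (fun B => \prod_(e <- F) w B e) finset.set0
   = expect (@colour_prob _ V q) (enum V) (fun B => expR (f B)) finset.set0.
  apply: eq_expect => B; rewrite /f expR_sum; apply: eq_bigr => e _.
  by rewrite lnK ?posrE.
have cp := @colour_prob01 _ V _ (ltW q2).
apply: le_trans (@gibbs _ _ _ s kappa _ _ _ cp _); last first.
  move=> u a b; rewrite /kappa /s; case: ifP => _; first exact: two_point_tilt.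
  by rewrite add0r; apply: expR_convex; exact: cp u.
rewrite ler_expR; apply: lerD.
  rewrite big_enum /= /kappa -big_mkcond sumr_const /= mulr_natl mulNrn //.
rewrite /f expect_sum -mulNr.
have -> : - (size F)%:R * (p * ordered_rate + 2 * p ^+ 2) =
   \sum_(e <- F) - (p * ordered_rate + 2 * p ^+ 2).
  by rewrite big_const_seq count_predT iter_addr_0 -mulr_natr; ring.
rewrite big_seq [leRHS]big_seq; apply: ler_sum => e eF.
have [uC vC] := HF e eF.
have l1 : - (p + 2 * p^+2) <= ln (1 - p) by apply: ln_ge_quadratic.
have l2 : - (p * (q - 2) / (q - 1) + 2 * p^+2) <= ln rb.
  have -> : rb = 1 - p * (q - 2) / (q - 1) by rewrite /rb; field; rewrite gt_eqF.
  have E : p * (q - 2) / (q - 1) = p - p / (q - 1) by field; rewrite gt_eqF.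
  by apply: ln_ge_quadratic => //; rewrite E; move: px px0 p0; lra.
have iq0 : 0 < q^-1 by rewrite invr_gt0.
(* a bond sees both ends blue with probability [q^-1 ^+ 2], one of them with
   probability [2 * q^-1 * (1 - q^-1)] *)
have key : - (p * ordered_rate + 2 * p ^+ 2) <=
   q^-1 ^+ 2 * ln rb + 2 * q^-1 * (1 - q^-1) * ln (1 - p).
  have iq1 : 0 <= 1 - q^-1 by rewrite subr_ge0 invf_le1 //; move: q2; lra.
  have c1 : 0 <= q^-1 ^+ 2 by rewrite exprn_ge0 // ltW.
  have c2 : 0 <= 2 * q^-1 * (1 - q^-1) by rewrite !mulr_ge0 // ltW.
  apply: le_trans (lerD (ler_wpM2l c1 l2) (ler_wpM2l c2 l1)).
  have sq : 0 <= p ^+ 2 * (1 - q^-1) ^+ 2 * 2 by rewrite !mulr_ge0 ?exprn_ge0.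
  rewrite -subr_ge0; apply: le_trans sq _.
  rewrite le_eqVlt; apply/orP; left; apply/eqP; rewrite /ordered_rate.
  by field; rewrite !gt_eqF.
set u := phi (src e) in uC; set v := phi (tgt e) in vC.
have wE B : w B e = if u \in B then if v \in B then rb else 1 - p
                    else if v \in B then 1 - p else 1 by [].
have fixB (L : seq V) B0 : u \notin L -> v \notin L ->
    expect s L (fun B => ln (w B e)) B0 = ln (w B0 e).
  move=> uL vL; rewrite -[RHS](expect_cst s L _ B0).
  apply: (@expect_ext _ _ (fun B => (u \in B) = (u \in B0) /\ (v \in B) = (v \in B0))) => //.
    move=> g B gL [H1 H2]; rewrite !inE H1 H2.
    by split; case: eqVneq gL => // <-; rewrite ?(negbTE uL) ?(negbTE vL).
  by move=> B [H1 H2]; rewrite !wE H1 H2.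
case: (eqVneq u v) => [uv|uv].
  rewrite (@expect_perm _ _ _ _ (u :: rem u (enum V))); last by apply: perm_to_rem;
    rewrite mem_enum.
  have uL : u \notin rem u (enum V) by rewrite mem_rem_uniq ?enum_uniq // !inE eqxx.
  have vL : v \notin rem u (enum V) by rewrite -uv.
  rewrite /= !fixB // !wE -uv !inE eqxx ln1.
  rewrite /s uC mulr0 addr0; apply: le_trans key _.
  have rb1 : ln (1 - p) <= ln rb by rewrite ler_ln ?posrE /rb; move: px0 p2; lra.
  have lrb : ln rb <= 0 by apply: ln_le0; rewrite /rb; move: px; lra.
  have iq2 : 2 * q^-1 <= 1 by rewrite ler_pdivrMr //; move: q2; lra.
  have g1 : 0 <= q^-1 * (1 - q^-1) by rewrite mulr_ge0 //; move: iq0 iq2; lra.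
  have g2 := ler_wpM2l g1 rb1.
  have g3 : q^-1 * (1 - q^-1) * ln (1-p) <= 0.
    by rewrite mulr_ge0_le0 // (le_trans rb1).
  rewrite -subr_ge0.
  have -> : q^-1 * ln rb - (q^-1 ^+ 2 * ln rb + 2 * q^-1 * (1 - q^-1) * ln (1 - p))
    = q^-1 * (1 - q^-1) * ln rb - q^-1 * (1 - q^-1) * ln (1 - p) - q^-1 * (1 - q^-1) *
      ln (1-p) by ring.
  by move: g2 g3; lra.
have [uL vL ->] := expect_two s (fun B => ln (w B e)) (enum_uniq V) (mem_enum _ u) (mem_enum
  _ v) uv.
have vu : (v == u) = false by rewrite eq_sym; apply/negbTE.
rewrite !fixB //.
rewrite !wE !inE !eqxx orbT vu (negbTE uv) ln1.
rewrite /s uC vC; apply: le_trans key _.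
by rewrite le_eqVlt; apply/orP; left; apply/eqP; ring.
Qed.

End Ordered.

(** * Counting slots between classes *)

Lemma sum_mod_eq m j r : (r < m)%N ->
  (\sum_(0 <= t < j) (t %% m == r) = j %/ m + (r < j %% m))%N.
Proof.
move=> rm; have m0 : (0 < m)%N by lia.
elim: j => [|j IH]; first by rewrite big_geq // div0n mod0n.
rewrite big_nat_recr //= IH.
have E := divn_eq j m; have L := ltn_pmod j m0.
case: (ltnP (j %% m).+1 m) => H.
  have -> : (j.+1 %/ m = j %/ m)%N by rewrite {1}E -addnS divnMDl // (divn_small H) addn0.
  have -> : (j.+1 %% m = (j %% m).+1)%N by rewrite {1}E -addnS modnMDl modn_small.
  lia.
have Em : ((j %% m).+1 = m)%N by lia.
have -> : (j.+1 %/ m = (j %/ m).+1)%N.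
  by rewrite {1}E -addnS Em divnMDl // divnn m0 addn1.
have -> : (j.+1 %% m = 0)%N by rewrite {1}E -addnS Em modnMDl modnn.
lia.
Qed.

Section Pairs.
Variables (N : nat) (N0 : (0 < N)%N).

Definition left_class (t : nat) : 'I_N := Ordinal (ltn_pmod t N0).
Definition right_class (t : nat) : 'I_N := Ordinal (ltn_pmod (t %/ N)%N N0).

(** The residue of [t] modulo [N ^ 2] encodes the pair of classes of slot [t]:
    the pairs recur with period [N ^ 2]. *)
Lemma class_pair_code t (a b : 'I_N) :
  ((left_class t == a) && (right_class t == b)) = (t %% (N * N) == b * N + a)%N.
Proof.
rewrite -!val_eqE /=.
have E := divn_eq (t %% (N * N)) N.
have E1 : (t %% (N * N) %% N = t %% N)%N by rewrite modn_dvdm // dvdn_mulr.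
have E2 : ((t %/ N) %% N = t %% (N * N) %/ N)%N by rewrite modn_divl.
rewrite E2 -E1; apply/andP/eqP => [[/eqP<- /eqP<-]|->] //.
by rewrite modnMDl divnMDl // modn_small // (divn_small (ltn_ord a)) addn0 !eqxx.
Qed.

(** The pairs are served in rounds of [N ^ 2] slots, so the graph of slots is nearly
    uniform at every stage. *)
Lemma sum_pairs J j (Q : 'I_N -> 'I_N -> bool) : (j <= J)%N ->
  (j %/ (N * N) * (\sum_a \sum_b Q a b)
   <= \sum_(t < J | (t < j) && Q (left_class t) (right_class t)) 1
   <= (j %/ (N * N)).+1 * (\sum_a \sum_b Q a b))%N.
Proof.
move=> jJ; set c := (\sum_(t < J | _) 1)%N; set S := (\sum_a \sum_b Q a b)%N.
have -> : c = (\sum_a \sum_b Q a b * \sum_(0 <= t < j) (t %% (N * N) == b * N + a))%N.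
  transitivity (\sum_(0 <= t < j) \sum_a \sum_b Q a b * (t %% (N * N) == b * N + a))%N;
    last first.
    rewrite exchange_big /=; apply: eq_bigr => a _.
    by rewrite exchange_big /=; apply: eq_bigr => b _; rewrite big_distrr.
  rewrite /c -(big_mkord (fun t => (t < j) && Q (left_class t) (right_class t))%N (fun=> 1)%N).
  rewrite (big_cat_nat (n := j)) //=.
  have -> : (\sum_(j <= t < J | (t < j) && Q (left_class t) (right_class t)) 1 = 0)%N.
    rewrite big_nat_cond big_pred0 // => t.
    by case: (ltnP t j); rewrite ?andbF.
  rewrite addn0.
  rewrite big_mkcond /= !big_nat; apply: eq_bigr => t /= tj; rewrite tj /=.
  under [RHS]eq_bigr => a _ do under eq_bigr => b _ do rewrite -class_pair_code.
  rewrite (bigD1 (left_class t)) //= [X in (_ + X)%N]big1 ?addn0; last first.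
    by move=> a aP; apply: big1 => b _; rewrite eq_sym (negbTE aP) muln0.
  rewrite (bigD1 (right_class t)) //= [X in (_ + X)%N]big1 ?addn0; last first.
    by move=> b bP; rewrite [right_class t == b]eq_sym (negbTE bP) andbF muln0.
  by rewrite !eqxx muln1; case: (Q _ _).
rewrite /S !big_distrr /=; apply/andP; split; apply: leq_sum => a _;
  rewrite big_distrr /=; apply: leq_sum => b _; rewrite sum_mod_eq.
+ by case: (Q a b); rewrite ?muln0 ?mul0n // muln1 mul1n leq_addr.
+ by have := ltn_ord a; have := ltn_ord b; nia.
+ by case: (Q a b); rewrite ?muln0 ?mul0n // muln1 mul1n -[X in (_ <=
  X)%N]addn1 leq_add2l leq_b1.
by have := ltn_ord a; have := ltn_ord b; nia.
Qed.

Lemma sum_pairs_rect (A B : {set 'I_N}) :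
  (\sum_a \sum_b (a \in A) && (b \in B) = #|A| * #|B|)%N.
Proof.
rewrite -!sum1_card big_distrl /= [RHS]big_mkcond; apply: eq_bigr => a _.
case: ifP => _ /=; last by rewrite big1.
by rewrite mul1n [RHS]big_mkcond; apply: eq_bigr => b _; case: (b \in B).
Qed.

End Pairs.

(** * Classes joined by slots *)

Section Model.
Variables (R : realType) (V X : finType) (src tgt : X -> V) (p q : R).
Hypotheses (p0 : 0 < p) (p2 : p <= 2^-1) (q2 : 2 < q).
(** A graph with random bonds [EE] and, at stage [j], open wires [W j].  Class [a] is
    represented by the vertex [v a] and slot [t] is the bond [sl t]; [Rg t] is a
    neighbourhood of slot [t] of bounded size.  The hypothesis [isolated] is the
    only information about the bonds other than slots. *)
Variables (EE : seq X) (N K r : nat) (N0 : (0 < N)%N).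
Local Notation J := (K * (N * N))%N.
Variables (v : 'I_N -> V) (sl : 'I_J -> X) (Rg : 'I_J -> {set X}) (W : nat -> {set X}).
Local Notation conn := (conn src tgt).
Local Notation left_class := (left_class N0).
Local Notation right_class := (right_class N0).
Local Notation cw := (clusterw src tgt q).
Local Notation rho := (bond_factor p q).

Hypotheses (EEu : uniq EE) (sl_inj : injective sl) (slE : forall t, sl t \in EE)
  (WE : forall j e, e \in EE -> e \notin W j)
  (Wleft : forall j (P : {set X}) (t : 'I_J), W j \subset P ->
    conn P (src (sl t)) (v (left_class t)))
  (Wright : forall j (P : {set X}) (t : 'I_J), W j \subset P -> (t < j)%N ->
     conn P (tgt (sl t)) (v (right_class t)))
  (WS : forall j, (j < J)%N -> exists w, W j.+1 = w |: W j)
  (RgE : forall t e, e \in Rg t -> e \in EE)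
  (Rg_disj : forall t t' e, t != t' -> e \in Rg t -> e \notin Rg t')
  (Rg_card : forall t, (#|Rg t| <= r)%N)
  (isolated : forall j (P : {set X}) a, W j \subset P -> P \subset W j :|: [set x in EE] ->
     (forall t : 'I_J, (t < j)%N -> (left_class t == a) || (right_class t == a) ->
       sl t \notin P) ->
     (forall t : 'I_J, (left_class t == a) || (t < j)%N && (right_class t == a) ->
       ~~ busy (Rg t) P) ->
     forall b, conn P (v a) (v b) -> b = a).

Let Hp : 0 <= p <= 1. Proof. by apply/andP; split; [exact: ltW|move: p2; lra]. Qed.
Let plt1 : p < 1. Proof. by move: p2; lra. Qed.
Let q1 : 1 <= q. Proof. by move: q2; lra. Qed.
Let q0 : 0 < q. Proof. by move: q2; lra. Qed.

Definition stage_sum j (g : {set X} -> R) : R := expect (fun=> p) EE g (W j).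
Definition cluster_size P a := #|[set b | conn P (v a) (v b)]|.
Definition small_clusters M P := [forall a, cluster_size P a <= M]%N.
Definition medium_cluster M P :=
  [exists a, (M < 2 * cluster_size P a)%N && (cluster_size P a <= M)%N].
Definition is_cluster (D : {set 'I_N}) P :=
  [forall a in D, forall b, conn P (v a) (v b) == (b \in D)].
Definition isolated_class P a := [forall b, conn P (v a) (v b) ==> (b == a)].
Definition admissible j (P : {set X}) :=
  (W j \subset P) && (P \subset W j :|: [set x in EE]).

Lemma admissible0 j : admissible j (W j).
Proof. by rewrite /admissible subxx subsetUl. Qed.

Lemma admissibleU j P e : e \in EE -> admissible j P -> admissible j (e |: P).
Proof.
move=> eE /andP[H1 H2]; apply/andP; split.
  exact: subset_trans H1 (subsetU1 _ _).
by rewrite subUset H2 andbT sub1set !inE eE orbT.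
Qed.

Lemma stage_sum_le j g h : (forall P, admissible j P -> g P <= h P) ->
  stage_sum j g <= stage_sum j h.
Proof.
move=> H; apply: (@expect_le _ _ (admissible j)) => //; last exact: admissible0.
by move=> e P; apply: admissibleU.
Qed.

(** When the slots of [D] are closed, a class of [D] that is not isolated has a busy
    slot, and a busy slot serves at most two classes; whence the exponent 2. *)
Lemma nonisolated_le_busy j P (D : {set 'I_N}) (A : R) : 1 <= A -> admissible j P ->
  (forall t : 'I_J, (t < j)%N -> (left_class t \in D) || (right_class t \in D) ->
    sl t \notin P) ->
  \prod_(a in D) A ^+ (~~ isolated_class P a)
  <= \prod_(t <- enum 'I_J) (A ^+ 2) ^+ busy (Rg t) P.
Proof.
move=> A1 /andP[H1 H2] Hsl.
under [leRHS]eq_bigr do rewrite -exprM.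
rewrite !prodrXr ler_weXn2l // big_enum /=.
apply: (@leq_trans (\sum_(a in D) \sum_(t < J) busy (Rg t) P *
  ((left_class t == a) + (right_class t == a)))%N).
  apply: leq_sum => a aD; case: (boolP (isolated_class P a)) => // niso.
  have [/existsP[t /andP[Ht bt]]|/existsPn H] := boolP [exists t : 'I_J,
      ((left_class t == a) || (t < j)%N && (right_class t == a)) && busy (Rg t) P].
    rewrite (bigD1 t) //= bt mul1n; case/orP: Ht => [->|/andP[_ ->]].
      by rewrite !leq_addr.
    by rewrite addn1 addSn.
  case/negP: niso; apply/forallP => b; apply/implyP => Hab; apply/eqP.
  apply: (isolated H1 H2 _ _ Hab) => t Ht.
    by case/orP=> /eqP E; apply: Hsl; rewrite // E aD ?orbT.
  by have := H t; rewrite Ht.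
rewrite exchange_big /=; apply: leq_sum => t _; rewrite -big_distrr /= mulnC leq_mul2r.
apply/orP; right; rewrite big_split /= -(addn1 1).
have B (x : 'I_N) : (\sum_(a in D) (x == a) <= 1)%N.
  rewrite big_mkcond (bigD1 x) //= big1 ?addn0; first by case: ifP => // _; rewrite leq_b1.
  by move=> a; rewrite eq_sym => /negbTE ->; case: ifP.
exact: leq_add.
Qed.

Definition busy_factor (A : R) := (1 + A ^+ 2 * (r%:R * p) ^+ 2 / (1 - p) ^+ r) ^+ J.

Lemma busy_moment_model j (A : R) (Gs : seq X) : 1 <= A -> uniq Gs -> {subset Gs <= EE} ->
  expect (fun=> p) Gs (fun P => (\prod_(t <- enum 'I_J) (A ^+ 2) ^+ busy (Rg t) P) * cw P) (W j)
  <= busy_factor A * expect (fun=> p) Gs cw (W j).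
Proof.
move=> A1 Gu GE.
pose Fr t := [seq x <- Gs | x \in Rg t].
pose rest := [seq x <- Gs | [forall t, x \notin Rg t]].
have perm : perm_eq Gs (flatten (map Fr (enum 'I_J)) ++ rest).
  apply/allP => x _ /=; apply/eqP; rewrite count_cat.
  have cF t : count_mem x (Fr t) = ((x \in Rg t) * count_mem x Gs)%N.
    rewrite count_filter; case: (boolP (x \in Rg t)) => xt.
      rewrite mul1n; apply: eq_count => y /=; case: eqP => [->|//]; by rewrite xt.
    rewrite mul0n; apply/eqP; rewrite -leqn0 leqNgt -has_count; apply/hasPn => y _ /=.
    by case: eqP => [->|//]; rewrite (negbTE xt).
  have -> : count_mem x rest = ([forall t, x \notin Rg t] * count_mem x Gs)%N.
    rewrite count_filter; case: (boolP [forall t, x \notin Rg t]) => xt.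
      rewrite mul1n; apply: eq_count => y /=; case: eqP => [->|//]; by rewrite xt.
    rewrite mul0n; apply/eqP; rewrite -leqn0 leqNgt -has_count; apply/hasPn => y _ /=.
    by case: eqP => [->|//]; rewrite (negbTE xt).
  rewrite count_flatten -map_comp sumnE big_map big_enum /=.
  under eq_bigr => t _ do rewrite cF.
  rewrite -big_distrl /= -mulnDl -[LHS]mul1n; congr (_ * _)%N.
  have [/forallP H|/forallPn [t]] := boolP [forall t, x \notin Rg t].
    by rewrite big1 // => t _; rewrite (negbTE (H t)).
  rewrite negbK => xt; rewrite addn0 (bigD1 t) //= xt big1 // => t' tt'.
  by rewrite (negbTE (Rg_disj _ xt)) // eq_sym.
rewrite (expect_perm _ _ _ perm) (expect_perm _ cw _ perm).
have := @busy_moment _ _ _ Hp _ (enum 'I_J) Fr Rg rest cw (W j) r (A ^+ 2) plt1.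
rewrite size_enum_ord /busy_factor; apply => //.
+ by rewrite exprn_ege1.
+ exact: enum_uniq.
+ move=> t; apply: leq_trans (Rg_card t); rewrite cardE; apply: uniq_leq_size.
    exact: filter_uniq.
  by move=> x; rewrite mem_filter mem_enum => /andP[].
+ by move=> P; apply: clusterw_ge0.
+ by move=> f P; apply: clusterw_setU1_le.
+ move=> t _; apply/setP => x; rewrite !inE; apply/negbTE/negP => /andP[xW xR].
  by move/negP: (WE j (RgE xR)); apply.
+ move=> t t' _ _ tt' e; rewrite mem_filter => /andP[et _].
  by apply: Rg_disj et; rewrite eq_sym.
by move=> t _ e; rewrite mem_filter => /andP[/forallP].
Qed.

(** * The weight of a prescribed cluster *)

Definition slots j (Q : rel 'I_N) :=
  [seq sl t | t : 'I_J <- enum 'I_J & (t < j)%N && Q (left_class t) (right_class t)].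

Lemma mem_slots j (Q : rel 'I_N) x :
  reflect (exists t : 'I_J, [/\ (t < j)%N, Q (left_class t) (right_class t) & x = sl t])
    (x \in slots j Q).
Proof.
apply: (iffP mapP) => [[t]|[t [tj Qt ->]]].
  by rewrite mem_filter => /andP[/andP[tj Qt] _] ->; exists t.
by exists t; rewrite // mem_filter tj Qt mem_enum.
Qed.

Lemma slots_uniq j Q : uniq (slots j Q).
Proof. by rewrite map_inj_uniq // filter_uniq // enum_uniq. Qed.

Lemma sum_slots j Q (f : X -> nat) :
  (\sum_(e <- slots j Q) f e
   = \sum_(t < J | (t < j) && Q (left_class t) (right_class t)) f (sl t))%N.
Proof. by rewrite big_map big_filter big_enum_cond. Qed.

Lemma size_slots j Q :
  (size (slots j Q) = \sum_(t < J | (t < j) && Q (left_class t) (right_class t)) 1)%N.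
Proof. by rewrite -(sum_slots j Q (fun=> 1%N)) sum1_size. Qed.

Lemma perm_slots j Q : perm_eq EE ([seq x <- EE | x \notin slots j Q] ++ slots j Q).
Proof.
rewrite -(perm_filterC [pred x | x \notin slots j Q] EE) perm_sym.
rewrite perm_cat2l; apply: uniq_perm; rewrite ?filter_uniq ?slots_uniq // => x.
rewrite mem_filter /= negbK; case: mem_slots => // -[t [_ _ ->]]; by rewrite slE.
Qed.

Definition touch (D : {set 'I_N}) : rel 'I_N := fun a b => (a \in D) || (b \in D).
Local Notation all_pairs := (fun _ _ : 'I_N => true).
Definition cross (D : {set 'I_N}) : rel 'I_N := fun a b => (a \in D) (+) (b \in D).
Definition inside (D : {set 'I_N}) : rel 'I_N := fun a b => (a \in D) && (b \in D).
Definition rest j D := [seq x <- EE | x \notin slots j (touch D)].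

(** The slots with an end in [D] are put last, so that they are revealed when
    everything else is known. *)
Lemma perm_touch j D :
  perm_eq EE (rest j D ++ (slots j (cross D) ++ slots j (inside D))).
Proof.
apply: perm_trans (perm_slots j (touch D)) _; rewrite perm_cat2l.
apply: uniq_perm; rewrite ?cat_uniq ?slots_uniq //=.
  rewrite andbT; apply/hasPn => x /mem_slots[t [_ /andP[H1 H2] ->]].
  by apply/mem_slots => -[t' [_ + /sl_inj E]]; rewrite /cross -E H1 H2.
move=> x; rewrite mem_cat; apply/mem_slots/orP.
  case=> t [tj Ht ->]; case H : (cross D (left_class t) (right_class t)).
    by left; apply/mem_slots; exists t.
  right; apply/mem_slots; exists t; split=> //; move: H Ht; rewrite /cross /touch /inside.
  by do 2 case: (_ \in D).
by case=> /mem_slots[t [tj Ht ->]]; exists t; split=> //; move: Ht;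
  rewrite /cross /touch /inside; do 2 case: (_ \in D).
Qed.

Lemma block_product (z A : R) m : 0 < z -> 2 <= A -> 2 <= z * A -> (0 < m)%N ->
  z * m%:R <= (z * A) ^+ m.
Proof.
move=> z0 A2 zA; elim: m => // -[|m] IH _.
  by rewrite expr1 ler_wpM2l ?(ltW z0) //; move: A2; lra.
have IH' := IH isT; rewrite exprS.
have H : 2 * (z * m.+1%:R) <= z * A * (z * A) ^+ m.+1.
  by apply: ler_pM => //; rewrite mulr_ge0 // ltW.
apply: le_trans H; rewrite -[m.+2%:R]natr1.
have : 0 <= z * m%:R by rewrite mulr_ge0 // ltW.
by rewrite -[m.+1%:R]natr1; lra.
Qed.

(** Connections outside the slots may already have grouped the classes of [D] into
    blocks, which leaves fewer factors [z] in the spanning bound.  A block of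
    [m >= 2] classes contributes [z * m] instead of [z ^+ m], and this is repaid by
    a factor [A] for each of its non-isolated classes. *)
Lemma blocks_bound (phi : V -> V) P (D : {set 'I_N}) (z A : R) :
  labels src tgt P phi -> 0 < z -> 2 <= A -> 2 <= z * A ->
  \prod_(u in [set phi (v a) | a in D]) (z * #|[set a in D | phi (v a) == u]|%:R)
  <= z ^+ #|D| * \prod_(a in D) A ^+ (~~ isolated_class P a).
Proof.
move=> Hphi z0 A2 zA.
have A1 : 1 <= A by move: A2; lra.
rewrite -prodr_const -big_split /=.
rewrite [leRHS](partition_big_imset (fun a => phi (v a))) /=.
apply: ler_prod => u uU; rewrite mulr_ge0 ?(ltW z0) //=.
have /imsetP[a0 a0D Eu] := uU.
have [/existsP[a /and3P[aD /eqP au ia]]|/existsPn H] :=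
    boolP [exists a, [&& a \in D, phi (v a) == u & isolated_class P a]].
  have E b : (b \in D) && (phi (v b) == u) = (b == a).
    apply/andP/eqP => [[bD /eqP bu]|->]; last by rewrite aD au.
    by move/forallP: ia => /(_ b); rewrite Hphi au bu eqxx => /eqP.
  rewrite (eq_bigl _ _ E) big_pred1_eq ia expr0 mulr1.
  have -> : [set a1 in D | phi (v a1) == u] = [set a].
    by apply/setP => b; rewrite !inE E.
  by rewrite cards1 mulr1.
rewrite (eq_bigr (fun=> z * A)); last first.
  by move=> b /andP[bD bu]; have := H b; rewrite bD bu /= => ->; rewrite expr1.
rewrite (eq_bigl (mem [set a in D | phi (v a) == u])); last by move=> b; rewrite !inE.
rewrite prodr_const; apply: block_product => //.
by apply/card_gt0P; exists a0; rewrite !inE a0D Eu eqxx.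
Qed.

Lemma degree_inside j P phi (D : {set 'I_N}) u : (j <= J)%N -> labels src tgt P phi ->
  W j \subset P ->
  (degree src tgt (slots j (inside D)) phi u
   <= 2 * ((j %/ (N * N)).+1 * (#|[set a in D | phi (v a) == u]| * #|D|)))%N.
Proof.
move=> jJ Hphi HW; rewrite /degree sum_slots big_split mul2n -addnn /=.
have rect := sum_pairs_rect; set Du := [set a in D | _].
have E1 (t : 'I_J) : phi (src (sl t)) = phi (v (left_class t)).
  by apply/eqP; rewrite -Hphi; apply: Wleft HW.
have E2 (t : 'I_J) : (t < j)%N -> phi (tgt (sl t)) = phi (v (right_class t)).
  by move=> tj; apply/eqP; rewrite -Hphi; apply: Wright HW tj.
apply: leq_add.
  have /andP[_ ] := sum_pairs N0 (fun a b => (a \in Du) && (b \in D)) jJ.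
  rewrite rect; apply: leq_trans; rewrite [X in (X <= _)%N]big_mkcond [X in (_ <=
    X)%N]big_mkcond.
  apply: leq_sum => t _; rewrite E1 /inside !inE.
  by case: (t < j)%N; case: (left_class t \in D); case: (right_class t \in D); case: (_ == u).
have /andP[_ ] := sum_pairs N0 (fun a b => (a \in D) && (b \in Du)) jJ.
rewrite rect [X in (_.+1 * X)%N]mulnC; apply: leq_trans.
rewrite [X in (X <= _)%N]big_mkcond [X in (_ <= X)%N]big_mkcond.
apply: leq_sum => t _; rewrite /inside !inE; case: ifP => // /andP[tj /andP[-> ->]].
by rewrite tj E2 //=; case: (_ == u).
Qed.

(** The slots inside [D] have to connect it.  The degree of a block is at most its
    number of classes times [z * q / p]; the root of the spanning tree has no
    factor, whence the division by [z]. *)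
Lemma cluster_inner j (P : {set X}) (D : {set 'I_N}) a0 (A : R) :
  let z := 2 * (j %/ (N * N)).+1%:R * #|D|%:R * (p / q) in
  (j <= J)%N -> a0 \in D -> 2 <= A -> 2 <= z * A -> W j \subset P ->
  expect (fun=> p) (slots j (inside D)) (fun P : {set X} => (is_cluster D P)%:R * cw P) P
  <= cw P * (z ^+ #|D| / z * \prod_(a in D) A ^+ (~~ isolated_class P a)).
Proof.
move=> z jJ a0D A2 zA HW.
have pq : 0 < p / q by rewrite divr_gt0.
have s0 : (0 < #|D|)%N by apply/card_gt0P; exists a0.
have z0 : 0 < z by rewrite /z !mulr_gt0 ?ltr0n ?invr_gt0.
pose phi := fingraph.root (adj src tgt P).
have Hphi : labels src tgt P phi by apply: labels_root.
have vD : v a0 \in v @: D by apply: imset_f.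
have HF e : e \in slots j (inside D) -> phi (src e) \in [set phi x | x in v @: D] /\
                       phi (tgt e) \in [set phi x | x in v @: D].
  move=> /mem_slots[t [tj /andP[rD cD] ->]].
  have -> : phi (src (sl t)) = phi (v (left_class t)) by apply/eqP; rewrite -Hphi;
    apply: Wleft HW.
  have -> : phi (tgt (sl t)) = phi (v (right_class t)) by apply/eqP; rewrite -Hphi;
    apply: Wright HW tj.
  by split; apply/imset_f/imset_f.
have H := spanning_bound Hp q1 Hphi vD HF.
apply: le_trans (le_trans _ H) _.
  apply: (@expect_le _ _ (fun=> True)) => // P' _; rewrite ler_wpM2r ?clusterw_ge0 // ler_nat.
  case: (boolP (is_cluster D P')) => // /forall_inP HD.
  suff -> : [forall x in v @: D, conn P' (v a0) x] by [].
  apply/forall_inP => x /imsetP[b bD ->].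
  by have /forallP/(_ b)/eqP -> := HD _ a0D.
rewrite ler_wpM2l ?clusterw_ge0 //.
have -> : [set phi x | x in v @: D] = [set phi (v a) | a in D] by rewrite -imset_comp.
rewrite [leRHS]mulrAC ler_pdivlMr //.
apply: le_trans (blocks_bound D Hphi z0 A2 zA).
have uU : phi (v a0) \in [set phi (v a) | a in D] by apply: (imset_f (fun a => phi (v a))).
rewrite [leRHS](big_setD1 _ uU) /= mulrC; apply: ler_pM.
+ exact: ltW.
+ by apply: prodr_ge0 => u _; rewrite mulr_ge0 // ltW.
+ rewrite ler_peMr ?(ltW z0) // ler1n; apply/card_gt0P; exists a0.
  by rewrite !inE a0D eqxx.
apply: ler_prod => u _; rewrite mulr_ge0 ?(ltW pq) //=.
have := degree_inside D u jJ Hphi HW; rewrite -(ler_nat R) !natrM => Hd.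
apply: le_trans (ler_wpM2l (ltW pq) Hd) _.
by rewrite le_eqVlt; apply/orP; left; apply/eqP; rewrite /z; ring.
Qed.

(** If [g] vanishes as soon as an element of [F] is present, only the event that
    all of [F] is absent contributes. *)
Lemma expect_closed F (g : {set X} -> R) (S : {set X}) j : W j \subset S ->
  (forall (P : {set X}) e, W j \subset P -> e \in F -> e \in P -> g P = 0) ->
  expect (fun=> p) F g S = (1 - p) ^+ size F * g S.
Proof.
move=> WS0; elim: F S WS0 => [|e F IH] S WS0 Hg /=; first by rewrite expr0 mul1r.
have WSe := subset_trans WS0 (subsetU1 e S).
have Hg' (P : {set X}) f : W j \subset P -> f \in F -> f \in P -> g P = 0.
  by move=> H fF; apply: Hg; rewrite // inE fF orbT.
rewrite !IH // exprS.
by rewrite (Hg (e |: S) e) ?mem_head ?setU11 //; ring.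
Qed.

(** The slots leaving [D] must be closed and those inside must connect it.  Both
    sides compare with the same mean over the remaining bonds, which costs a power
    of [bond_factor] in the normalisation. *)
Lemma cluster_bound j (D : {set 'I_N}) a0 (A : R) :
  let z := 2 * (j %/ (N * N)).+1%:R * #|D|%:R * (p / q) in
  (j <= J)%N -> a0 \in D -> 2 <= A -> 2 <= z * A ->
  stage_sum j (fun P => (is_cluster D P)%:R * cw P)
  <= ((1 - p) / rho) ^+ size (slots j (cross D)) / rho ^+ size (slots j (inside D))
     * (z ^+ #|D| / z) * busy_factor A * stage_sum j cw.
Proof.
move=> z jJ a0D A2 zA.
have A1 : 1 <= A by move: A2; lra.
have pq : 0 < p / q by rewrite divr_gt0.
have s0 : (0 < #|D|)%N by apply/card_gt0P; exists a0.
have z0 : 0 < z by rewrite /z !mulr_gt0 ?ltr0n ?invr_gt0.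
have r0 : 0 < rho by apply: bond_factor_gt0 => //; rewrite (le_trans _ q1).
have p1' : 0 <= 1 - p by move: p2; lra.
rewrite /stage_sum !(expect_perm _ _ _ (perm_touch j D)) !expect_cat.
set F1 := slots j (cross D); set F2 := slots j (inside D); set G := rest j D.
have GE : {subset G <= EE} by move=> x; rewrite mem_filter => /andP[].
have Gu : uniq G by rewrite filter_uniq.
set c1 := (1 - p) ^+ size F1 * (z ^+ #|D| / z).
have c10 : 0 <= c1 by rewrite mulr_ge0 ?exprn_ge0 // divr_ge0 ?exprn_ge0 // ltW.
have up : expect (fun=> p) G
     (expect (fun=> p) (F1 ++ F2) (fun P => (is_cluster D P)%:R * cw P)) (W j)
   <= c1 * (busy_factor A * expect (fun=> p) G cw (W j)).
  apply: le_trans (ler_wpM2l c10 (busy_moment_model j A1 Gu GE)); rewrite -expectZ.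
  apply: (@expect_le _ _ (fun P => admissible j P /\ forall t : 'I_J, (t < j)%N ->
     (left_class t \in D) || (right_class t \in D) -> sl t \notin P)) => //.
  + move=> e P eG [adm Hsl]; split; first exact: admissibleU (GE _ eG) adm.
    move=> t tj Ht; rewrite !inE negb_or Hsl // andbT.
    move: eG; rewrite mem_filter => /andP[+ _]; apply: contraNneq => <-.
    by apply/mem_slots; exists t.
  + move=> P [adm Hsl]; have /andP[WP _] := adm.
    rewrite expect_cat (expect_closed WP); last first.
      move=> P' e HW /mem_slots[t [tj Ht ->]] tP'.
      rewrite -[RHS](expect_cst (fun=> p) F2 0 P').
      apply: (@expect_ext _ _ (fun Q => P' \subset Q)) => //.
        by move=> f Q _ H; apply: subset_trans H (subsetU1 _ _).
      move=> Q PQ; suff -> : is_cluster D Q = false by rewrite mul0r.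
      apply/negbTE/negP => /forall_inP HD.
      have WQ := subset_trans HW PQ.
      have C : conn Q (v (left_class t)) (v (right_class t)).
        apply: conn_trans (Wright WQ tj); apply: (@conn_trans _ _ _ _ _ (src (sl t))).
          by rewrite conn_sym; apply: Wleft WQ.
        by apply: conn_edge; apply: (subsetP PQ).
      move: Ht; rewrite /cross; case: (boolP (left_class t \in D)) => rD.
        by have /forallP/(_ (right_class t))/eqP := HD _ rD; rewrite C => <-.
      move=> /= cD; have /forallP/(_ (left_class t))/eqP := HD _ cD.
      by rewrite conn_sym C (negbTE rD).
    rewrite /c1 -mulrA; apply: ler_wpM2l; first exact: exprn_ge0.
    apply: le_trans (cluster_inner jJ a0D A2 zA WP) _.
    rewrite [leLHS]mulrC -[leLHS]mulrA; apply: ler_wpM2l;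
      first by rewrite divr_ge0 ?exprn_ge0 // ltW.
    by rewrite ler_wpM2r ?clusterw_ge0 //; apply: nonisolated_le_busy adm Hsl.
  split; first exact: admissible0.
  by move=> t _ _; apply: contraL (slE t) => tW; apply: contraTN tW => /WE.
(* the normalising weight retains every configuration of the touching slots *)
have lo : rho ^+ size (F1 ++ F2) * expect (fun=> p) G cw (W j) <=
   expect (fun=> p) G (expect (fun=> p) (F1 ++ F2) cw) (W j).
  rewrite -expectZ; apply: (@expect_le _ _ (fun=> True)) => // P _.
  exact: expect_clusterw_ge.
apply: le_trans up _.
set Y := expect _ G cw _ in lo *.
set c2 := ((1 - p) / rho) ^+ size F1 / rho ^+ size F2 * (z ^+ #|D| / z) * busy_factor A.
have B0 : 0 <= busy_factor A.
  rewrite exprn_ge0 // addr_ge0 // divr_ge0 ?exprn_ge0 //.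
  by rewrite mulr_ge0 ?exprn_ge0 // ?mulr_ge0 ?(ltW p0) // (le_trans _ A1).
have c20 : 0 <= c2.
  have [rr zz] := (ltW r0, ltW z0).
  apply: mulr_ge0 => //; apply: mulr_ge0; last by apply: divr_ge0; rewrite ?exprn_ge0.
  by apply: divr_ge0; apply: exprn_ge0 => //; apply: divr_ge0.
apply: le_trans (ler_wpM2l c20 lo).
rewrite le_eqVlt; apply/orP; left; apply/eqP; rewrite /c1 /c2 size_cat exprD expr_div_n.
by field; rewrite !gt_eqF ?exprn_gt0.
Qed.

Lemma size_cross j (D : {set 'I_N}) : (j <= J)%N ->
  (j %/ (N * N) * (2 * (#|D| * (N - #|D|))) <= size (slots j (cross D)))%N.
Proof.
move=> jJ; rewrite size_slots; have /andP[+ _] := sum_pairs N0 (cross D) jJ.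
suff -> : (\sum_a \sum_b cross D a b = 2 * (#|D| * (N - #|D|)))%N by [].
have -> : (N - #|D| = #|~: D|)%N by rewrite [RHS]cardsCs setCK card_ord.
rewrite mul2n -addnn {2}(mulnC #|D|) -!sum_pairs_rect -big_split; apply: eq_bigr => a _.
rewrite -big_split; apply: eq_bigr => b _; rewrite /cross !inE.
by do 2 case: (_ \in D).
Qed.

Lemma size_inside j (D : {set 'I_N}) : (j <= J)%N ->
  (size (slots j (inside D)) <= (j %/ (N * N)).+1 * (#|D| * #|D|))%N.
Proof.
move=> jJ; rewrite size_slots; have /andP[_] := sum_pairs N0 (inside D) jJ.
by rewrite /inside sum_pairs_rect.
Qed.

Lemma size_all_slots : size (slots J all_pairs) = J.
Proof.
by rewrite size_slots (eq_bigl xpredT) ?sum1_card ?card_ord // => t; rewrite ltn_ord.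
Qed.

(** * The small-cluster phase along the stages *)

Lemma isolated_cluster_size P a b : isolated_class P b -> conn P (v a) (v b) ->
  (cluster_size P a <= 1)%N.
Proof.
move=> /forallP ib ab; rewrite /cluster_size -(cards1 b); apply: subset_leq_card.
apply/subsetP => c; rewrite !inE => ac; apply: (implyP (ib c)).
by apply: conn_trans ac; rewrite conn_sym.
Qed.

(** At stage 0 no slot joins two classes, so every cluster of more than one class
    consists of non-isolated classes, each of which costs a factor [A]. *)
Lemma start_bound M (A : R) : (0 < M)%N -> 1 <= A ->
  stage_sum 0 (fun P => (~~ small_clusters M P)%:R * cw P) <=
    A ^- M * busy_factor A * stage_sum 0 cw.
Proof.
move=> M0 A1; have A0 : 0 < A by apply: lt_le_trans A1.
rewrite -mulrA; have AM : 0 <= A ^- M by rewrite invr_ge0 exprn_ge0 // ltW.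
apply: le_trans (ler_wpM2l AM (busy_moment_model 0 A1 EEu (fun _ H => H))).
rewrite -expectZ; apply: stage_sum_le => P adm; rewrite mulrA ler_wpM2r ?clusterw_ge0 //.
have [sm|/forallPn[a]] := boolP (small_clusters M P).
  by rewrite mulr_ge0 // prodr_ge0 // => t _; rewrite !exprn_ge0 // ltW.
rewrite -ltnNge => Ma.
have H := @nonisolated_le_busy 0 P [set b | conn P (v a) (v b)] A A1 adm (fun t H =>
  False_ind _ (notF H)).
rewrite mulrC ler_pdivlMr ?exprn_gt0 // mul1r; apply: le_trans H.
rewrite (eq_bigr (fun=> A)); first by rewrite prodr_const ler_weXn2l // ltnW.
move=> b; rewrite inE => ab; case: (boolP (isolated_class P b)) => [ib|]; last by rewrite expr1.
by have := isolated_cluster_size ib ab; rewrite leqNgt (leq_trans _ Ma).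
Qed.

Lemma medium_cluster_sum j M :
  stage_sum j (fun P => (medium_cluster M P)%:R * cw P) <=
  \sum_(D : {set 'I_N} | (M < 2 * #|D|)%N && (#|D| <= M)%N)
     stage_sum j (fun P => (is_cluster D P)%:R * cw P).
Proof.
rewrite /stage_sum -expect_sum; apply: stage_sum_le => P _;
  rewrite -big_distrl ler_wpM2r ?clusterw_ge0 //=.
case: (boolP (medium_cluster M P)) => [/existsP[a Ha]|_]; last by apply: sumr_ge0 => D _;
  rewrite ler0n.
rewrite (bigD1 [set b | conn P (v a) (v b)]) //=.
suff -> : is_cluster [set b | conn P (v a) (v b)] P by rewrite lerDl sumr_ge0.
apply/forall_inP => b; rewrite inE => ab; apply/forallP => c; rewrite inE; apply/eqP.
by rewrite /conn; apply/esym/same_connect => //; exact: conn_sym.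
Qed.

Lemma sub_small M (P Q : {set X}) : P \subset Q -> small_clusters M Q -> small_clusters M P.
Proof.
move=> PQ /forallP H; apply/forallP => a; apply: leq_trans (H a).
by apply: subset_leq_card; apply/subsetP => b; rewrite !inE; apply: sub_conn.
Qed.

(** A new bond merges at most two clusters.  If the result has more than [M] classes
    then one of the two has more than [M / 2]. *)
Lemma leave_small_clusters M P e : small_clusters M P -> ~~ small_clusters M (e |: P) ->
  medium_cluster M P.
Proof.
move=> /forallP sm /forallPn[a]; rewrite -ltnNge => Ma.
have Hphi : labels src tgt P (fingraph.root (adj src tgt P)) by apply: labels_root.
set phi := fingraph.root _ in Hphi.
have [Hm _] := labels_merge_labels e Hphi.
(* the label of the other component, if the one of [v a] meets [e] *)
pose y := if phi (v a) == phi (tgt e) then phi (src e)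
          else if phi (v a) == phi (src e) then phi (tgt e) else phi (v a).
have sub : [set b | conn (e |: P) (v a) (v b)] \subset
    [set b | conn P (v a) (v b)] :|: [set b | phi (v b) == y].
  apply/subsetP => b; rewrite !inE Hm Hphi /merge_labels /y => H; apply/orP; move: H.
  case: (phi (v a) =P phi (tgt e)) => [Ea|Na].
    by case: (phi (v b) =P phi (tgt e)) => [Eb _|Nb /eqP ->]; [left; rewrite Ea Eb|right].
  case: (phi (v b) =P phi (tgt e)) => [Eb /eqP ->|Nb ->]; last by left.
  by right; rewrite eqxx Eb.
have := leq_trans (subset_leq_card sub) (leq_card_setU _ _).
rewrite -/(cluster_size _ _) -/(cluster_size _ _) => le1.
have [b0 hb|nb] := pickP (fun b => phi (v b) == y); last first.
  have E0 : [set b | phi (v b) == y] = set0 by apply/setP => b; rewrite !inE nb.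
  by rewrite E0 cards0 addn0 in le1; have := leq_trans Ma (leq_trans le1 (sm a)); rewrite ltnn.
have Eb : [set b | phi (v b) == y] = [set b | conn P (v b0) (v b)].
  by apply/setP => b; rewrite !inE Hphi (eqP hb) eq_sym.
move: le1; rewrite Eb -/(cluster_size _ _) => le1.
have := sm a; have := sm b0 => s1 s2; apply/existsP.
case: (ltnP M (2 * cluster_size P a)) => H; first by exists a; rewrite H s2.
exists b0; rewrite s1 andbT; move: (leq_trans Ma le1) H.
by move: (cluster_size P a) (cluster_size P b0) => x z; clear; lia.
Qed.

(** Clusters with at most [M] classes contain at most [K.+1 * N * M] slots; all others
    are crossing. *)
Lemma small_clusters_upper M :
  stage_sum J (fun P => (small_clusters M P)%:R * cw P)
  <= rho ^+ (J - K.+1 * (N * M))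
     * expect (fun=> p) [seq x <- EE | x \notin slots J all_pairs] cw (W J).
Proof.
set L := (K.+1 * (N * M))%N; rewrite /stage_sum (expect_perm _ _ _ (perm_slots J all_pairs))
  expect_cat -expectZ.
set F := slots J _.
have r0 : 0 < rho by apply: bond_factor_gt0 => //; rewrite (le_trans _ q1).
have r1 : rho <= 1 by apply: bond_factor_le1.
apply: (@expect_le _ _ (fun P => W J \subset P)) => //.
  by move=> e P _ H; apply: subset_trans H (subsetU1 _ _).
move=> P WP; apply: le_trans (ler_wpM2l _ (expect_crossing_le src tgt Hp plt1 q1 F P));
  last by rewrite exprn_ge0 // ltW.
rewrite -expectZ; apply: (@expect_le _ _ (fun P => W J \subset P)) => //.
  by move=> e Q _ H; apply: subset_trans H (subsetU1 _ _).
move=> Q WQ; rewrite mulrCA [leLHS]mulrC ler_wpM2l ?clusterw_ge0 //.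
case: (boolP (small_clusters M Q)) => [/forallP sm|_]; last first.
  by rewrite mulr_ge0 ?invr_ge0 ?exprn_ge0 // ltW.
rewrite ler_pdivlMr ?exprn_gt0 // mul1r; apply: ler_wiXn2l; rewrite ?(ltW r0) //.
rewrite leq_subLR -size_all_slots -/F -(count_predC (fun e => conn Q (src e) (tgt e)) F).
rewrite leq_add2r -size_filter.
rewrite size_filter -sum1_count big_mkcond sum_slots.
have jJ : (J <= J)%N by [].
have /andP[_] := sum_pairs N0 (fun a b => conn Q (v a) (v b)) jJ.
have -> : (J %/ (N * N) = K)%N by rewrite mulnK // muln_gt0 N0.
move=> H; apply: leq_trans (leq_trans H _).
  rewrite [X in (X <= _)%N]big_mkcond [X in (_ <= X)%N]big_mkcond; apply: leq_sum => t _.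
  rewrite ltn_ord /=.
  have -> : conn Q (src (sl t)) (tgt (sl t)) = conn Q (v (left_class t)) (v (right_class t)).
    have h1 := Wleft t WQ; have h2 := Wright WQ (ltn_ord t).
    apply/idP/idP => h.
      by apply: conn_trans h2; apply: conn_trans h; rewrite conn_sym.
    apply: (conn_trans h1); apply: (conn_trans h); by rewrite conn_sym.
  by case: (conn Q _ _).
rewrite /L leq_mul2l /=; apply: (@leq_trans (\sum_(a < N) M)%N); last first.
  by rewrite sum_nat_const card_ord.
apply: leq_sum => a _; apply: leq_trans (sm a).
by rewrite /cluster_size -sum1_card [X in (_ <= X)%N]big_mkcond; apply: leq_sum => b _;
  rewrite inE; case: (conn Q _ _).
Qed.

Lemma total_lower (kappa : R) :
  (forall P : {set X}, W J \subset P -> kappa * cw P <=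
    expect (fun=> p) (slots J all_pairs) cw P) ->
  kappa * expect (fun=> p) [seq x <- EE | x \notin slots J all_pairs] cw (W J) <=
    stage_sum J cw.
Proof.
move=> H; rewrite /stage_sum (expect_perm _ _ _ (perm_slots J all_pairs)) expect_cat -expectZ.
apply: (@expect_le _ _ (fun P => W J \subset P)) => //.
by move=> e P _ HP; apply: subset_trans HP (subsetU1 _ _).
Qed.

(** Wiring one more slot is the opening of a bond: weights decrease, by a factor
    at most [q], and the small-cluster configurations that are lost have a medium
    cluster. *)
Lemma stage_step j w M : W j.+1 = w |: W j ->
  stage_sum j.+1 cw <= stage_sum j cw /\
  q^-1 * (stage_sum j (fun P => (small_clusters M P)%:R * cw P)
          - stage_sum j (fun P => (medium_cluster M P)%:R * cw P))
  <= stage_sum j.+1 (fun P => (small_clusters M P)%:R * cw P).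
Proof.
move=> Ew; rewrite /stage_sum Ew -!expect_setU1; split.
  by apply: (@expect_le _ _ (fun=> True)) => // P _; apply: clusterw_setU1_le.
rewrite -mulN1r -expectZ -expectD -expectZ; apply: (@expect_le _ _ (fun=> True)) => // P _.
have lip := clusterw_setU1_ge src tgt q1 w P; have c0 := clusterw_ge0 src tgt q1 P.
have iq : 0 <= q^-1 by rewrite invr_ge0 ltW.
have c1 := clusterw_ge0 src tgt q1 (w |: P).
case: (boolP (small_clusters M P)) => [sm|nsm].
  case: (boolP (small_clusters M (w |: P))) => [sm'|nsm'].
    apply: le_trans (_ : q^-1 * cw P <= _); last by rewrite mul1r.
    rewrite ler_wpM2l // mul1r gerDl mulN1r oppr_le0.
    by rewrite mulr_ge0 // ler0n.
  by rewrite (leave_small_clusters sm nsm') !mul1r mulN1r subrr mulr0 mul0r.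
rewrite mul0r add0r mulN1r mulrN; apply: le_trans (_ : 0 <= _).
  by rewrite oppr_le0 !mulr_ge0 // ler0n.
by rewrite mulr_ge0 // ler0n.
Qed.

(** The first stage at which the small-cluster phase carries at most half of the
    weight: at the previous stage it carried more than half, and one step divides
    it by at most about [q]. *)
Lemma tuning M (wb : R) : wb <= 4^-1 ->
  (forall j, (j <= J)%N ->
     stage_sum j (fun P => (medium_cluster M P)%:R * cw P) <= wb * stage_sum j cw) ->
  2 * stage_sum 0 (fun P => (~~ small_clusters M P)%:R * cw P) < stage_sum 0 cw ->
  2 * stage_sum J (fun P => (small_clusters M P)%:R * cw P) <= stage_sum J cw ->
  exists2 j, (j <= J)%N &
    2 * stage_sum j (fun P => (small_clusters M P)%:R * cw P) <= stage_sum j cw /\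
    stage_sum j cw <= 4 * q * stage_sum j (fun P => (small_clusters M P)%:R * cw P).
Proof.
move=> wb4 Hwin Hstart Hend.
have Z0 j : 0 <= stage_sum j cw by apply: expect_ge0 => // P; apply: clusterw_ge0.
pose low j := 2 * stage_sum j (fun P => (small_clusters M P)%:R * cw P) <= stage_sum j cw.
have ex : exists j, low j by exists J.
have := ex_minnP ex; move=> [[|j] lj minj].
  exfalso; move: lj; rewrite /low.
  have : stage_sum 0 cw = stage_sum 0 (fun P => (small_clusters M P)%:R * cw P)
                        + stage_sum 0 (fun P => (~~ small_clusters M P)%:R * cw P).
    rewrite /stage_sum -expectD; apply: eq_expect => P; rewrite -mulrDl.
    by case: (small_clusters M P); rewrite ?addr0 ?add0r mul1r.
  by move: Hstart; lra.
have jJ : (j.+1 <= J)%N by apply: minj; exact: Hend.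
exists j.+1 => //; split=> //.
have nlj : ~~ low j by apply/negP => /minj; rewrite ltnn.
rewrite /low -ltNge in nlj.
have [w Ew] := WS jJ; have [s1 s2] := stage_step M Ew.
have hw := Hwin j (ltnW jJ).
have h4 : wb * stage_sum j cw <= 4^-1 * stage_sum j cw by rewrite ler_wpM2r.
move: s2; rewrite ler_pdivrMl // => s2.
rewrite -mulrA; apply: le_trans s1 _; move: s2 nlj hw h4.
set a := stage_sum j.+1 _; set b := stage_sum j _; set d := stage_sum j _;
  set e := stage_sum j _; lra.
Qed.

(** * Exponential rates and the bottleneck *)

Lemma cross_factor_le : (1 - p) / rho <= expR (- (p / q)).
Proof.
have r0 : 0 < rho by apply: bond_factor_gt0 => //; rewrite (le_trans _ q1).
apply: le_trans (expR_ge1Dx _); rewrite ler_pdivrMr // /bond_factor.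
have up : p / q <= p by rewrite ler_pdivrMr // ler_peMr // ltW.
have u0 : 0 <= p / q by rewrite divr_ge0 // ltW.
have : 0 <= p / q * (p - p / q) by rewrite mulr_ge0 // subr_ge0.
set u := p / q; nra.
Qed.

Lemma inv_rho_le : rho^-1 <= expR (2 * p).
Proof.
have r0 : 0 < rho by apply: bond_factor_gt0 => //; rewrite (le_trans _ q1).
have H := ln_ge_quadratic (ltW p0) (lexx p) p2.
rewrite -[2 * p]opprK expRN lef_pV2 ?posrE ?expR_gt0 //.
apply: (@le_trans _ _ (1 - p)); last by rewrite /bond_factor lerDl divr_ge0 // ltW.
have p1' : 0 < 1 - p by move: p2; lra.
rewrite -[leRHS]lnK ?posrE // ler_expR; apply: le_trans H.
have : p * p <= p * 2^-1 by rewrite ler_wpM2l // ltW.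
by rewrite expr2; lra.
Qed.

(** The density stays below [q * t] with [t <= 1], and [c1] is the gap of the exponent
    [1 + ln t - t] below 0.  Medium clusters have about [eps * N] classes, for which the
    factor [z] of [cluster_bound] is at least [delta]; [A] is then large enough for
    [blocks_bound]. *)
Variables (M : nat) (g eps t c1 delta A B0 : R).
Hypotheses (hg : p * N%:R <= g) (hK : 2 * K.+1%:R * g <= q * t) (ht : t <= 1)
  (hc1 : c1 <= t - 1 - ln t) (hg2 : 2 * g / q <= c1 / 4)
  (eps0 : 0 < eps) (eps1 : eps <= 1) (heps : (1 + q) * eps <= c1 / 4)
  (hM1 : M%:R <= eps * N%:R) (hM2 : eps * N%:R <= M.+1%:R)
  (delta0 : 0 < delta) (hdelta : delta <= M.+1%:R * (p / q))
  (A2 : 2 <= A) (dA : 2 <= delta * A) (BF : busy_factor A <= B0).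

Let c10 : 0 <= c1.
Proof.
have : 0 <= (1 + q) * eps by rewrite mulr_ge0 ?addr_ge0 // ltW.
by move: heps; lra.
Qed.

Let pq0 : 0 < p / q. Proof. by rewrite divr_gt0. Qed.

(** [s * (1 + ln Y)] counts the choices of the classes and the trees on them; the
    second term is the cost of closing the slots that leave them, close to
    [- s * Y] since [s] is at most [eps * N]; the last one is the normalisation
    of the slots inside.  Up to errors of order [eps] and [g], the sum is
    [s * (1 + ln Y - Y)], which is increasing in [Y <= t]. *)
Lemma exponent_le (l s : R) : 0 <= l -> l <= K%:R -> 0 <= s -> s <= eps * N%:R ->
  s * (1 + ln (2 * (l + 1) * (p / q) * N%:R))
   - (p / q) * (l * (2 * (s * (N%:R - s)))) + 2 * p * ((l + 1) * (s * s))
  <= - (c1 / 2) * s.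
Proof.
move=> l0 lK s0 sN; set n := N%:R in sN *.
have n0 : 0 < n by rewrite ltr0n.
set Y := 2 * (l + 1) * (p / q) * n.
have l10 : 0 < l + 1 by rewrite ltr_wpDl.
have Y0 : 0 < Y by rewrite /Y !mulr_gt0 // invr_gt0.
have Yt : Y <= t.
  have E : Y = 2 * (l + 1) * (p * n) / q by rewrite /Y; field; rewrite gt_eqF.
  rewrite E ler_pdivrMr // [t * q]mulrC; apply: le_trans hK.
  have l1 : 2 * (l + 1) <= 2 * K.+1%:R by rewrite ler_wpM2l // -natr1 lerD2r.
  by apply: ler_pM => //; apply: mulr_ge0 => //; exact: ltW.
have Y1 : Y <= 1 by apply: le_trans ht.
have H1 := ln_sub_mono Y0 Yt ht.
have H2 : Y * eps + q * (Y * eps) <= c1 / 4.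
  have -> : Y * eps + q * (Y * eps) = (1 + q) * eps * Y by ring.
  apply: le_trans heps; rewrite ler_piMr // mulr_ge0 ?(ltW eps0) // addr_ge0 //; exact: ltW.
have H3 : 2 * (p * n) / q <= c1 / 4.
  by apply: le_trans hg2; rewrite ler_wpM2r ?invr_ge0 ?(ltW q0) // ler_wpM2l.
have H4 : 2 * (l + 1) * (p / q) * s <= Y * eps.
  have -> : Y * eps = 2 * (l + 1) * (p / q) * (eps * n) by rewrite /Y; ring.
  by rewrite ler_wpM2l // !mulr_ge0 // ?invr_ge0 ltW.
have H5 : 2 * l * (p / q) * s <= 2 * (l + 1) * (p / q) * s.
  by rewrite ler_wpM2r // ler_wpM2r ?(ltW pq0) // ler_wpM2l // lerDl.
have H6 : 2 * p * (l + 1) * s <= q * (Y * eps).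
  have -> : 2 * p * (l + 1) * s = q * (2 * (l + 1) * (p / q) * s) by field; rewrite gt_eqF.
  by rewrite ler_wpM2l // ltW.
have -> : s * (1 + ln Y) - (p / q) * (l * (2 * (s * (n - s)))) + 2 * p * ((l + 1) * (s * s))
  = s * (1 + ln Y - (Y - 2 * (p * n) / q) + 2 * l * (p / q) * s + 2 * p * (l + 1) * s).
  by rewrite /Y; field; rewrite gt_eqF.
rewrite mulrC ler_wpM2r //; move: H1 H2 H3 H4 H5 H6 hc1.
set a1 := 2 * (p * n) / q; set a2 := 2 * l * (p / q) * s; set a3 := 2 * p * (l + 1) * s.
set a4 := 2 * (l + 1) * (p / q) * s; set a5 := Y * eps; set a6 := q * a5; lra.
Qed.

Definition medium_cluster_rate : R := N.+1%:R * (expR (- (c1 / 4 * (eps * N%:R))) / delta * B0).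

Lemma medium_cluster_bound j : (j <= J)%N ->
  stage_sum j (fun P => (medium_cluster M P)%:R * cw P) <= medium_cluster_rate * stage_sum j cw.
Proof.
move=> jJ; set Z := stage_sum j cw.
have Z0 : 0 <= Z by apply: expect_ge0 => // P; apply: clusterw_ge0.
have NN0 : (0 < N * N)%N by rewrite muln_gt0 N0.
set lo := (j %/ (N * N))%N.
have loK : (lo <= K)%N by rewrite -(mulnK K NN0); apply: leq_div2r.
have A1 : 1 <= A by move: A2; lra.
have BF0 : 0 <= busy_factor A.
  rewrite exprn_ge0 // addr_ge0 // divr_ge0 ?exprn_ge0 //.
    by rewrite mulr_ge0 ?exprn_ge0 // ?mulr_ge0 ?(ltW p0) // (le_trans _ A1).
  by move: p2; lra.
have B00 : 0 <= B0 by apply: le_trans BF.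
pose f (s : nat) := expR (- (p / q) * (lo%:R * (2 * (s%:R * (N%:R - s%:R))))
       + 2 * p * ((lo%:R + 1) * (s%:R * s%:R)))
     * ((2 * (lo%:R + 1) * (p / q) * s%:R) ^+ s / delta * B0 * Z).
pose Q s := (M < 2 * s)%N && (s <= M)%N.
have MN : (M <= N)%N.
  rewrite -(ler_nat R); apply: le_trans hM1 _; rewrite ler_piMl //.
apply: le_trans (medium_cluster_sum j M) _;
  apply: (@le_trans _ _ (\sum_(D : {set 'I_N} | Q #|D|) f #|D|)).
  apply: ler_sum => D /andP[D1 D2].
  have Dpos : (0 < #|D|)%N by rewrite lt0n; apply: contraTneq D1 => ->; rewrite muln0.
  have [a0 a0D] : exists a0, a0 \in D by apply/card_gt0P.
  set s := #|D| in D1 D2 Dpos *.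
  have s0 : 0 < s%:R :> R by rewrite ltr0n.
  set z := 2 * lo.+1%:R * s%:R * (p / q).
  have dz : delta <= z.
    apply: le_trans hdelta _; rewrite /z ler_wpM2r ?(ltW pq0) //.
    rewrite -!natrM ler_nat; apply: leq_trans D1 _.
    by rewrite leq_mul2r leq_pmulr ?orbT.
  have z0 : 0 < z by apply: lt_le_trans dz.
  have zA : 2 <= z * A.
    by apply: le_trans dA _; rewrite ler_wpM2r // (le_trans _ A1).
  apply: le_trans (cluster_bound jJ a0D A2 zA) _; rewrite -/s -/z -/lo -/Z.
  have F1 : ((1 - p) / rho) ^+ size (slots j (cross D)) <=
     expR (- (p / q) * (lo%:R * (2 * (s%:R * (N%:R - s%:R))))).
    have r0 : 0 < rho by apply: bond_factor_gt0 => //; rewrite (le_trans _ q1).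
    have b0 : 0 <= (1 - p) / rho by rewrite divr_ge0 ?(ltW r0) //; move: p2; lra.
    apply: le_trans (pow_le_expR _ b0 cross_factor_le) _.
    rewrite ler_expR mulrC mulNr mulNr lerN2 ler_wpM2l ?(ltW pq0) //.
    rewrite -natrB; last by exact: leq_trans D2 MN.
    by rewrite -!natrM ler_nat; apply: size_cross.
  have F2 : (rho ^+ size (slots j (inside D)))^-1 <=
     expR (2 * p * ((lo%:R + 1) * (s%:R * s%:R))).
    rewrite -exprVn; have r0 : 0 < rho by apply: bond_factor_gt0 => //; rewrite (le_trans _ q1).
    have b0 : 0 <= rho^-1 by rewrite invr_ge0 ltW.
    apply: le_trans (pow_le_expR _ b0 inv_rho_le) _.
    rewrite ler_expR mulrC ler_wpM2l ?mulr_ge0 ?(ltW p0) //.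
    by rewrite natr1 -!natrM ler_nat; apply: size_inside.
  have F3 : z ^+ s / z <= (2 * (lo%:R + 1) * (p / q) * s%:R) ^+ s / delta.
    have -> : 2 * (lo%:R + 1) * (p / q) * s%:R = z by rewrite /z natr1; ring.
    by rewrite ler_wpM2l ?exprn_ge0 ?(ltW z0) // lef_pV2 ?posrE.
  have r0 : 0 < rho by apply: bond_factor_gt0 => //; rewrite (le_trans _ q1).
  have p1' : 0 <= 1 - p by move: p2; lra.
  have a0' : 0 <= ((1 - p) / rho) ^+ size (slots j (cross D)).
    by rewrite exprn_ge0 // divr_ge0 // ltW.
  have b0' : 0 <= (rho ^+ size (slots j (inside D)))^-1 by rewrite invr_ge0 exprn_ge0 // ltW.
  have z0' : 0 <= z ^+ s / z by rewrite divr_ge0 ?exprn_ge0 // ltW.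
  rewrite /f expRD.
  set e1 := expR _ in F1 *; set e2 := expR _ in F2 *; set w3 := _ / delta in F3 *.
  have -> : e1 * e2 * (w3 * B0 * Z) = e1 * e2 * w3 * B0 * Z by ring.
  apply: ler_wpM2r => //; apply: ler_pM => //; first by do 2![apply: mulr_ge0 => //].
  apply: ler_pM => //; first exact: mulr_ge0.
  exact: ler_pM.
rewrite /medium_cluster_rate -mulrA.
apply: (sum_card_le (Q := Q) (f := f)) => [s sN /andP[s1 s2]|]; last first.
  by rewrite !mulr_ge0 ?expR_ge0 // ?invr_ge0 // ltW.
have s0 : 0 <= s%:R :> R by [].
have seps : s%:R <= eps * N%:R by apply: le_trans hM1; rewrite ler_nat.
have lo0 : 0 <= lo%:R :> R by [].
have loK' : lo%:R <= K%:R :> R by rewrite ler_nat.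
have EL := exponent_le lo0 loK' s0 seps.
set Y := 2 * (lo%:R + 1) * (p / q) * N%:R in EL.
have Y0 : 0 < Y by rewrite /Y !mulr_gt0 ?ltr0n ?invr_gt0 // ltr_wpDl.
have B1 : 'C(N, s)%:R * (2 * (lo%:R + 1) * (p / q) * s%:R) ^+ s <= expR (s%:R * (1 + ln Y)).
  have -> : expR (s%:R * (1 + ln Y)) = (2 * (lo%:R + 1) * (p / q)) ^+ s * (N%:R ^+ s *
    expR s%:R).
    rewrite mulrDr mulr1 expRD (expRM_natl _ (ln Y)) lnK ?posrE // /Y exprMn; ring.
  have y0 : 0 <= 2 * (lo%:R + 1) * (p / q).
    by apply: mulr_ge0; [apply: mulr_ge0 => //; apply: addr_ge0|exact: ltW].
  by rewrite exprMn mulrCA ler_wpM2l ?bin_pow_le // exprn_ge0.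
set E1 := - (p / q) * (lo%:R * (2 * (s%:R * (N%:R - s%:R))))
       + 2 * p * ((lo%:R + 1) * (s%:R * s%:R)).
have C1 : - (c1 / 2) * s%:R <= - (c1 / 4 * (eps * N%:R)).
  have : eps * N%:R <= 2 * s%:R.
    by apply: le_trans hM2 _; rewrite -natrM ler_nat.
  by move=> /(ler_wpM2l c10); lra.
set X0 := expR (- (c1 / 4 * (eps * N%:R))).
have -> : 'C(N, s)%:R * f s = ('C(N, s)%:R * (2 * (lo%:R + 1) * (p / q) * s%:R) ^+ s
    * expR E1) * (delta^-1 * B0 * Z) by rewrite /f -/E1; ring.
have -> : X0 / delta * B0 * Z = X0 * (delta^-1 * B0 * Z) by ring.
apply: ler_wpM2r; first by rewrite !mulr_ge0 ?invr_ge0 // ltW.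
apply: (@le_trans _ _ (expR (s%:R * (1 + ln Y)) * expR E1)).
  by rewrite ler_wpM2r ?expR_ge0.
rewrite -expRD ler_expR; apply: le_trans C1; apply: le_trans EL.
by rewrite /E1 mulNr addrA.
Qed.

Lemma stage_sum_gt0 j : 0 < stage_sum j cw.
Proof.
apply: lt_le_trans (_ : rho ^+ size EE * cw (W j) <= _); last exact: expect_clusterw_ge.
by rewrite mulr_gt0 ?clusterw_gt0 ?exprn_gt0 // bond_factor_gt0.
Qed.

Lemma start_half : (0 < M)%N -> 2 * B0 < A ^+ M ->
  2 * stage_sum 0 (fun P => (~~ small_clusters M P)%:R * cw P) < stage_sum 0 cw.
Proof.
move=> M0 BM; have A1 : 1 <= A by move: A2; lra.
have Z0 := stage_sum_gt0 0.
have H := start_bound M0 A1.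
have A0 : 0 < A ^+ M by rewrite exprn_gt0 // (lt_le_trans _ A1).
apply: (@le_lt_trans _ _ (2 * (A ^- M * B0 * stage_sum 0 cw))).
  rewrite ler_wpM2l //; apply: le_trans H _; rewrite ler_wpM2r ?(ltW Z0) //.
  by rewrite ler_wpM2l // invr_ge0 ltW.
rewrite !mulrA -[ltRHS]mul1r ltr_pM2r // mulrAC ltr_pdivrMr // mul1r //.
Qed.

(** The hypothesis says that the free energy of the ordered phase, from
    [ordered_bound], exceeds that of the small-cluster phase, from
    [small_clusters_upper], by [ln 2]. *)
Lemma end_half :
  ln 2 + N%:R * ((q - 2) / q * ln (q - 1)) + J%:R * (p * ordered_rate q + 2 * p ^+ 2)
    <= p * (1 - q^-1) * (J%:R - K.+1%:R * (N%:R * M%:R)) ->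
  2 * stage_sum J (fun P => (small_clusters M P)%:R * cw P) <= stage_sum J cw.
Proof.
move=> H.
set kappa := expR (- (N%:R * ((q - 2) / q * ln (q - 1)))
                   - J%:R * (p * ordered_rate q + 2 * p ^+ 2)).
have lnq : 0 <= (q - 2) / q * ln (q - 1).
  rewrite mulr_ge0 ?divr_ge0 ?ln_ge0 //; move: q2; lra.
have L := @total_lower kappa.
have {}L : kappa * expect (fun=> p) [seq x <- EE | x \notin slots J all_pairs] cw (W J) <=
  stage_sum J cw.
  apply: L => P WP.
  pose phi := fingraph.root (adj src tgt P).
  have Hphi : labels src tgt P phi by apply: labels_root.
  have HC e : e \in slots J all_pairs ->
     phi (src e) \in [set phi (v a) | a : 'I_N] /\ phi (tgt e) \in [set phi (v a) | a : 'I_N].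
    case/mem_slots => s [sJ _ ->]; split; apply/imsetP.
      by exists (left_class s) => //; apply/eqP; rewrite -Hphi; apply: Wleft WP.
    by exists (right_class s) => //; apply/eqP; rewrite -Hphi; apply: Wright WP sJ.
  rewrite mulrC; apply: le_trans (ordered_bound (ltW p0) p2 q2 Hphi HC).
  rewrite ler_wpM2l ?clusterw_ge0 // ler_expR size_all_slots lerD2r lerN2 ler_wpM2r //.
  by rewrite ler_nat; apply: leq_trans (leq_imset_card _ _) _; rewrite cardT size_enum_ord.
apply: le_trans L; apply: le_trans (ler_wpM2l _ (small_clusters_upper M)) _ => //.
rewrite mulrA ler_wpM2r ?expect_ge0 // => [P|]; first exact: clusterw_ge0.
have r0 : 0 < rho by apply: bond_factor_gt0 => //; rewrite (le_trans _ q1).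
have r1 : rho <= expR (- (p * (1 - q^-1))).
  by apply: le_trans (expR_ge1Dx _); rewrite /bond_factor; lra.
apply: le_trans (ler_wpM2l _ (pow_le_expR _ (ltW r0) r1)) _ => //.
rewrite -[X in X * _](@lnK _ 2) ?posrE // -expRD /kappa ler_expR.
have H2 : J%:R - K.+1%:R * (N%:R * M%:R) <= (J - K.+1 * (N * M))%:R :> R.
  case: (leqP (K.+1 * (N * M)) J) => h; first by rewrite natrB // !natrM.
  apply: (@le_trans _ _ 0); last by [].
  by rewrite subr_le0 -!natrM ler_nat ltnW.
have iq : 0 <= p * (1 - q^-1) by rewrite mulr_ge0 ?(ltW p0) // subr_ge0 invf_le1 //.
have := ler_wpM2l iq H2; move: H; set a := p * _; set b := (J - _)%:R; lra.
Qed.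

Lemma model_bottleneck (T : R) : (0 < M)%N -> 2 * B0 < A ^+ M ->
  ln 2 + N%:R * ((q - 2) / q * ln (q - 1)) + J%:R * (p * ordered_rate q + 2 * p ^+ 2)
    <= p * (1 - q^-1) * (J%:R - K.+1%:R * (N%:R * M%:R)) ->
  1 <= T -> T ^+ 2 <= expR (c1 / 4 * (eps * N%:R)) ->
  16 * q * (N.+1%:R * (B0 / delta)) <= T ->
  exists2 j, (j <= J)%N &
   [/\ 0 < stage_sum j (fun P => (small_clusters M P)%:R * cw P),
    2 * stage_sum j (fun P => (small_clusters M P)%:R * cw P) <= stage_sum j cw &
    4 * T * stage_sum j (fun P => (medium_cluster M P)%:R * cw P)
      <= stage_sum j (fun P => (small_clusters M P)%:R * cw P)].
Proof.
move=> M0 BM Hend T1 TT HT.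
have T0 : 0 < T by apply: lt_le_trans T1.
(* one factor [T] of [T ^+ 2] absorbs the polynomial term, the other one is the
   conductance *)
have wbT : medium_cluster_rate * (16 * q * T) <= 1.
  rewrite /medium_cluster_rate expRN.
  have E0 : 0 < expR (c1 / 4 * (eps * N%:R)) by apply: expR_gt0.
  have -> : N.+1%:R * ((expR (c1 / 4 * (eps * N%:R)))^-1 / delta * B0) * (16 * q * T)
    = (16 * q * (N.+1%:R * (B0 / delta))) * T / expR (c1 / 4 * (eps * N%:R)).
    by field; rewrite !gt_eqF.
  rewrite ler_pdivrMr // mul1r; apply: le_trans TT.
  by rewrite expr2 ler_wpM2r // ltW.
have wb4 : medium_cluster_rate <= 4^-1.
  have w16 : 4 <= 16 * q * T.
    have : 1 * 1 <= q * T by apply: ler_pM.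
    by rewrite -mulrA; lra.
  have w0 : 0 < 16 * q * T by apply: lt_le_trans w16.
  apply: le_trans (_ : (16 * q * T)^-1 <= _); last by rewrite lef_pV2 ?posrE.
  by rewrite -ler_pdivlMr // in wbT; move: wbT; rewrite mul1r.
have [j jJ [h1 h2]] := tuning wb4 (fun j => @medium_cluster_bound j) (start_half M0 BM)
  (end_half Hend).
exists j => //; split=> //.
  have : 0 < 4 * q * stage_sum j (fun P => (small_clusters M P)%:R * cw P).
    by apply: lt_le_trans h2; exact: stage_sum_gt0.
  by rewrite pmulr_rgt0 // mulr_gt0.
have S0 : 0 <= stage_sum j (fun P => (small_clusters M P)%:R * cw P).
  by apply: expect_ge0 => // P; rewrite mulr_ge0 ?clusterw_ge0.
have Hw := medium_cluster_bound jJ.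
have W0 : 0 <= medium_cluster_rate.
  have B00 : 0 <= B0.
    apply: le_trans BF; rewrite exprn_ge0 // addr_ge0 // divr_ge0 ?exprn_ge0 //.
      by rewrite mulr_ge0 ?exprn_ge0 // ?mulr_ge0 ?(ltW p0) //; move: A2; lra.
    by move: p2; lra.
  by rewrite !mulr_ge0 ?expR_ge0 ?invr_ge0 // ltW.
have Hw2 : stage_sum j (fun P => (medium_cluster M P)%:R * cw P) <=
    medium_cluster_rate * (4 * q * stage_sum j (fun P => (small_clusters M P)%:R * cw P)).
  by apply: le_trans Hw _; rewrite ler_wpM2l.
have T40 : 0 <= 4 * T by rewrite mulr_ge0 // ltW.
apply: le_trans (ler_wpM2l T40 Hw2) _.
have := ler_wpM2r S0 wbT; rewrite mul1r.
set S := stage_sum j _; set w := medium_cluster_rate => H.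
by rewrite (_ : 4 * T * (w * (4 * q * S)) = w * (16 * q * T) * S) //; ring.
Qed.

End Model.

(** * Conductance and mixing time *)

Section Bottleneck.
Variables (R : realType) (X : finType) (K : X -> X -> R) (mu : X -> R).
Hypotheses (K0 : forall x y, 0 <= K x y) (K1 : forall x, \sum_y K x y = 1).
Hypotheses (mu0 : forall x, 0 <= mu x) (mu1 : \sum_x mu x = 1).
Hypothesis stat : forall y, \sum_x mu x * K x y = mu y.

Lemma chain_law_ge0 x t y : 0 <= chain_law K x t y.
Proof.
elim: t y => [|t IH] y /=; first by rewrite ler0n.
by apply: sumr_ge0 => z _; rewrite mulr_ge0.
Qed.

Lemma chain_law_sum1 x t : \sum_y chain_law K x t y = 1.
Proof.
elim: t => [|t IH] /=.
  by rewrite (bigD1 x) //= eqxx big1 ?addr0 // => y /negbTE ->.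
rewrite exchange_big /= -[RHS]IH; apply: eq_bigr => z _.
by rewrite -big_distrr /= K1 mulr1.
Qed.

Lemma tv_dist_event (nu : X -> R) (P : pred X) : \sum_x nu x = 1 ->
  \sum_(x | P x) mu x - tv_dist nu mu <= \sum_(x | P x) nu x.
Proof.
move=> nu1; rewrite lerBlDr -lerBlDl -sumrB /tv_dist.
have E : \sum_(x | P x) (mu x - nu x) = \sum_(x | ~~ P x) (nu x - mu x).
  apply/eqP; rewrite -subr_eq0 -sumrN; under [X in _ + X]eq_bigr do rewrite opprB.
  by rewrite -(bigID P xpredT (fun x => mu x - nu x)) sumrB mu1 nu1 subrr.
have H1 : \sum_(x | P x) (mu x - nu x) <= \sum_(x | P x) `|nu x - mu x|.
  by apply: ler_sum => x _; rewrite distrC ler_norm.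
have H2 : \sum_(x | ~~ P x) (nu x - mu x) <= \sum_(x | ~~ P x) `|nu x - mu x|.
  by apply: ler_sum => x _; rewrite ler_norm.
have H3 := bigID P xpredT (fun x => `|nu x - mu x|) : \sum_x `|nu x - mu x| = _.
rewrite H3 /=; rewrite -E in H2; move: H1 H2.
set a := \sum_(x | P x) (mu x - nu x); set b := \sum_(x | P x) `|_|;
  set d := \sum_(x | ~~ P x) _; lra.
Qed.

Variables (A B : {set X}).
Hypothesis exit : forall x y, x \in A -> x \notin B -> y \notin A -> K x y = 0.

(** Mass at [y] of the chain started from [mu] restricted to [A].  It stays below
    [mu], so at each step at most [mu B] can leave [A]. *)
Let mass t y := \sum_(x in A) mu x * chain_law K x t y.

Let mass_step t y : mass t.+1 y = \sum_z mass t z * K z y.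
Proof.
rewrite /mass /=; under eq_bigr do rewrite big_distrr /=.
rewrite exchange_big /=; apply: eq_bigr => z _; rewrite big_distrl /=.
by apply: eq_bigr => x _; rewrite mulrA.
Qed.

Let mass_ge0 t y : 0 <= mass t y.
Proof. by apply: sumr_ge0 => x _; rewrite mulr_ge0 // chain_law_ge0. Qed.

Let mass_le t y : mass t y <= mu y.
Proof.
elim: t y => [|t IH] y.
  apply: (@le_trans _ _ (\sum_x mu x * (y == x)%:R)).
    rewrite /mass big_mkcond; apply: ler_sum => x _.
    by case: ifP => // _; rewrite mulr_ge0.
  rewrite (bigD1 y) //= eqxx mulr1 big1 ?addr0 // => x xy.
  by rewrite eq_sym (negbTE xy) mulr0.
by rewrite mass_step -stat; apply: ler_sum => z _; apply: ler_wpM2r.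
Qed.

Lemma escape_le t : \sum_(y | y \notin A) mass t y <= t%:R * \sum_(x in B) mu x.
Proof.
elim: t => [|t IH].
  rewrite mul0r big1 // => y yA; rewrite /mass big1 // => x xA /=.
  by case: eqP yA => [->|_ _]; rewrite ?xA ?mulr0.
rewrite -natr1 mulrDl mul1r; apply: le_trans (lerD IH (lexx _)).
under eq_bigr do rewrite mass_step.
rewrite exchange_big /= (bigID (mem A)) /= addrC; apply: lerD.
  apply: ler_sum => z _; rewrite -big_distrr /= -[leRHS]mulr1 ler_wpM2l //.
  by rewrite -(K1 z) [leRHS](bigID (fun y => y \notin A)) /= lerDl sumr_ge0.
rewrite (bigID (mem B)) /= [X in _ + X]big1 ?addr0; last first.
  by move=> z /andP[zA zB]; rewrite big1 // => y yA; rewrite exit // mulr0.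
rewrite [leRHS](bigID (mem A)) /=; apply: le_trans (_ : _ <= \sum_(i in B | i \in A) mu i) _;
  last first.
  by rewrite lerDl sumr_ge0.
rewrite (eq_bigl (fun i => (i \in B) && (i \in A))); last by move=> i; rewrite andbC.
apply: ler_sum => z _; rewrite -big_distrr /=; apply: le_trans (mass_le t z).
rewrite -[leRHS]mulr1 ler_wpM2l //.
by rewrite -(K1 z) [leRHS](bigID (fun y => y \notin A)) /= lerDl sumr_ge0.
Qed.

Lemma mixing_bottleneck t : \sum_(x in A) mu x <= 2^-1 ->
  (forall x, tv_dist (chain_law K x t) mu <= 4^-1) ->
  \sum_(x in A) mu x <= 4 * (t%:R * \sum_(x in B) mu x).
Proof.
move=> Ahalf Htv.
have Ac : 2^-1 <= \sum_(y | y \notin A) mu y.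
  by move: mu1; rewrite (bigID (mem A)) /=; move: Ahalf; lra.
have H x : 4^-1 <= \sum_(y | y \notin A) chain_law K x t y.
  have := tv_dist_event (fun y => y \notin A) (chain_law_sum1 x t).
  move: (Htv x) Ac; lra.
have := escape_le t; rewrite /mass exchange_big /= => E.
have : \sum_(x in A) mu x * 4^-1 <= t%:R * \sum_(x in B) mu x.
  apply: le_trans E; apply: ler_sum => x _; rewrite -big_distrr /=.
  exact: ler_wpM2l.
rewrite -big_distrl /=; lra.
Qed.

Lemma mixing_time_ge (m : R) : 0 < \sum_(x in A) mu x -> \sum_(x in A) mu x <= 2^-1 ->
  4 * m * \sum_(x in B) mu x <= \sum_(x in A) mu x ->
  (m%:E <= mixing_time K mu)%E.
Proof.
move=> A0 Ah Hm; apply: le_ereal_inf_tmp => _ [t /= Ht <-]; rewrite lee_fin.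
have H := mixing_bottleneck Ah Ht.
have B0 : 0 < \sum_(x in B) mu x.
  have : 0 <= \sum_(x in B) mu x by apply: sumr_ge0.
  rewrite le_eqVlt => /orP[/eqP E|//]; move: H A0; rewrite -E !mulr0; lra.
rewrite -(ler_pM2r B0); move: (le_trans Hm H); lra.
Qed.

End Bottleneck.

(** * Stationarity of the FK-dynamics *)

Section EdgeUpdates.
Variables (R : realType) (E : finType).
Implicit Types (S T : {set E}) (f : {set E} -> R).

Lemma setD1_notin T e : e \notin T -> T :\ e = T.
Proof. by move=> eT; apply/setP => f; rewrite !inE; case: eqP => // ->;
  rewrite (negbTE eT). Qed.

Lemma sum_preimage_add f T e : \sum_S f S * (T == e |: S)%:R =
  if e \in T then f T + f (T :\ e) else 0.
Proof.
case: ifP => eT; last first.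
  by rewrite big1 // => S _; case: eqP eT => [->|]; rewrite ?mulr0 // !inE eqxx.
rewrite (bigD1 T) //= (bigD1 (T :\ e)) /=; last first.
  by apply: contraL eT => /eqP <-; rewrite !inE eqxx.
have -> : e |: T = T by apply/finset.setUidPr; rewrite finset.sub1set.
rewrite finset.setD1K // !eqxx !mulr1 big1 ?addr0 // => S /andP[ST STe].
case: eqP => [TE|]; rewrite ?mulr0 //; case/eqP: STe.
rewrite TE finset.setU1K //; apply: contra ST => eS; rewrite TE; apply/eqP/esym.
by apply/finset.setUidPr; rewrite finset.sub1set.
Qed.

Lemma sum_preimage_del f T e : \sum_S f S * (T == S :\ e)%:R =
  if e \in T then 0 else f T + f (e |: T).
Proof.
case: ifP => [eT|/negbT eT].
  by rewrite big1 // => S _; case: eqP eT => [->|]; rewrite ?mulr0 // !inE eqxx.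
rewrite (bigD1 T) //= (bigD1 (e |: T)) /=; last first.
  by apply: contraNneq eT => <-; rewrite !inE eqxx.
rewrite finset.setU1K // setD1_notin // !eqxx !mulr1 big1 ?addr0 // => S /andP[ST STe].
case: eqP => [TE|]; rewrite ?mulr0 //; case: (boolP (e \in S)) => eS.
  by case/eqP: STe; rewrite TE finset.setD1K.
by case/eqP: ST; rewrite TE setD1_notin.
Qed.

(** Detailed balance on the pair [T :\ e], [e |: T]: both states send to each of the
    two a share of their mass proportional to its weight. *)
Lemma heat_bath_stationary f T e : (forall S, 0 < f S) ->
  \sum_S f S * (f (e |: S) / (f (e |: S) + f (S :\ e)) * (T == e |: S)%:R
     + (1 - f (e |: S) / (f (e |: S) + f (S :\ e))) * (T == S :\ e)%:R) = f T.
Proof.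
move=> f0; under eq_bigr do rewrite mulrDr !mulrA.
rewrite big_split /= sum_preimage_add sum_preimage_del.
have pos S S' : f S + f S' != 0 by rewrite gt_eqF // addr_gt0.
case: (boolP (e \in T)) => eT.
  have -> : e |: T = T by apply/finset.setUidPr; rewrite finset.sub1set.
  have -> : (T :\ e) :\ e = T :\ e by rewrite finset.setDDl finset.setUid.
  by rewrite finset.setD1K // addr0; field.
have -> : e |: (e |: T) = e |: T by rewrite finset.setUA finset.setUid.
rewrite finset.setU1K // setD1_notin //.
by rewrite add0r; field.
Qed.

End EdgeUpdates.

Section FK.
Variables (n : nat) (R : realType) (p q : R) (xi : {set {set vertex n}}).
Hypotheses (p0 : 0 < p) (p1 : p < 1) (q0 : 0 < q) (E0 : (0 < #|edge n|)%N).

Local Notation w := (rc_weight p q xi).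
Local Notation Pi := (rc_measure p q xi).

Lemma rc_weight_gt0 S : 0 < w S.
Proof.
by rewrite /rc_weight !mulr_gt0 ?exprn_gt0 // subr_gt0.
Qed.

Lemma partition_function_gt0 : 0 < \sum_(T : {set edge n}) w T.
Proof.
rewrite (bigD1 finset.set0) //= ltr_wpDr ?rc_weight_gt0 // sumr_ge0 // => S _.
exact/ltW/rc_weight_gt0.
Qed.

Lemma rc_measure_gt0 S : 0 < Pi S.
Proof. by rewrite /rc_measure divr_gt0 ?rc_weight_gt0 ?partition_function_gt0. Qed.

Lemma rc_measure_sum (A : {set {set edge n}}) :
  \sum_(S in A) Pi S = (\sum_(S in A) w S) / \sum_(T : {set edge n}) w T.
Proof. by rewrite big_distrl. Qed.

Lemma fk_add_prob01 S e : 0 <= fk_add_prob p q xi S e <= 1.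
Proof.
have H := rc_measure_gt0; rewrite /fk_add_prob divr_ge0 ?addr_ge0 ?(ltW (H _)) //=.
by rewrite ler_pdivrMr ?mul1r ?lerDl ?(ltW (H _)) // addr_gt0.
Qed.

Lemma fk_kernel_ge0 S T : 0 <= fk_kernel p q xi S T.
Proof.
apply: sumr_ge0 => e _; have /andP[h0 h1] := fk_add_prob01 S e.
by rewrite mulr_ge0 ?invr_ge0 // addr_ge0 // mulr_ge0 // subr_ge0.
Qed.

Lemma sum_indicator (T0 : {set edge n}) (k : R) : \sum_(T : {set edge n}) k * (T == T0)%:R = k.
Proof.
rewrite (bigD1 T0) //= eqxx mulr1 big1 ?addr0 // => T /negbTE ->.
by rewrite mulr0.
Qed.

Lemma sum_edge_cst : \sum_(e : edge n) #|edge n|%:R^-1 = 1 :> R.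
Proof.
rewrite sumr_const -[X in X *+ _]mul1r -mulrnAl.
by rewrite divff // pnatr_eq0 -lt0n.
Qed.

Lemma fk_kernel_sum1 S : \sum_T fk_kernel p q xi S T = 1.
Proof.
rewrite /fk_kernel exchange_big /= -[RHS]sum_edge_cst; apply: eq_bigr => e _.
rewrite -big_distrr /= big_split /= !sum_indicator; ring.
Qed.

Lemma fk_kernel_stationary T : \sum_S Pi S * fk_kernel p q xi S T = Pi T.
Proof.
rewrite /fk_kernel; under eq_bigr do rewrite big_distrr /=.
rewrite exchange_big /= -[RHS]mul1r -[X in X * Pi T]sum_edge_cst big_distrl /=.
apply: eq_bigr => e _; under eq_bigr do rewrite mulrCA.
rewrite -big_distrr /=; congr (_ * _).
exact: (heat_bath_stationary (f := Pi)) rc_measure_gt0.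
Qed.

(** For a decreasing event [A] only the opening of an edge leaves [A], so its inner
    boundary consists of the configurations from which one added edge leads out. *)
Lemma fk_mixing_time_ge (A : {set {set edge n}}) (m : R) :
  (forall S e, S \in A -> S :\ e \in A) -> A != finset.set0 ->
  2 * (\sum_(S in A) w S) <= \sum_(S : {set edge n}) w S ->
  4 * m * (\sum_(S in A | [exists e, e |: S \notin A]) w S) <= \sum_(S in A) w S ->
  (m%:E <= fk_mixing_time p q xi)%E.
Proof.
move=> Adec /set0Pn[S0 S0A] Ahalf Hm.
have Z0 := partition_function_gt0.
pose B := [set S in A | [exists e, e |: S \notin A]]%SET.
apply: (@mixing_time_ge _ _ _ _ fk_kernel_ge0 fk_kernel_sum1 _ _ fk_kernel_stationary A B).
+ by move=> S; exact/ltW/rc_measure_gt0.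
+ by rewrite /rc_measure -big_distrl /= divff // gt_eqF.
+ move=> S T SA; rewrite inE SA /= negb_exists => /forallP HS TA.
  rewrite /fk_kernel big1 // => e _.
  have -> : (T == e |: S) = false.
    by apply/negbTE; apply: contraNneq TA => ->; have := HS e; rewrite negbK.
  have -> : (T == S :\ e) = false.
    by apply/negbTE; apply: contraNneq TA => ->; apply: Adec.
  by rewrite !mulr0 addr0 mulr0.
+ rewrite (bigD1 S0) //= ltr_wpDr ?rc_measure_gt0 // sumr_ge0 // => S _.
  exact/ltW/rc_measure_gt0.
+ by rewrite rc_measure_sum ler_pdivrMr //; move: Ahalf; lra.
rewrite !rc_measure_sum mulrA ler_pM2r ?invr_gt0 //.
apply: le_trans Hm; rewrite le_eqVlt; apply/orP; left; apply/eqP.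
by congr (_ * _); apply: eq_bigl => S; rewrite inE.
Qed.

End FK.

(** * Sums over configurations as expectations *)

Lemma expect_subset_sum (R : realFieldType) (T : finType) (p : R) (F : seq T) g S0 : uniq F ->
  expect (fun=> p) F g S0 = \sum_(S : {set T} | S \subset [set x in F])
     p ^+ #|S| * (1 - p) ^+ (size F - #|S|) * g (S :|: S0).
Proof.
elim: F S0 => [|e F IH] S0 /=.
  move=> _; rewrite (big_pred1 set0) => [|S]; first by rewrite cards0 !expr0 !mul1r set0U.
  by rewrite set_nil subset0.
case/andP=> eF Fu; rewrite !IH // [RHS](bigID (fun S : {set T} => e \in S)) /=; congr (_ + _).
  rewrite big_distrr /= [RHS](reindex_onto (fun S => e |: S) (fun S => S :\ e)) /=; last first.
    by move=> S /andP[_ eS]; rewrite setD1K.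
  rewrite [LHS]big_mkcond [RHS]big_mkcond; apply: eq_bigr => S _.
  have -> : (e |: S \subset [set x in e :: F]) && (e \in e |: S) && ((e |: S) :\ e == S)
          = (S \subset [set x in F]).
    rewrite setU11 andbT; apply/andP/idP => [[H /eqP E]|H].
      rewrite -E; apply/subsetP => x; rewrite !inE => /andP[xe]; rewrite (negbTE xe) /= => xS.
      have : x \in [set x in e :: F] by apply: (subsetP H); rewrite !inE xS orbT.
      by rewrite !inE (negbTE xe).
    have eS : e \notin S by apply: contra eF => eS; have := subsetP H _ eS; rewrite inE.
    split; last by rewrite setU1K.
    apply/subsetP => x; rewrite !inE => /orP[->//|xS]; have := subsetP H _ xS.
    by rewrite inE => ->; rewrite orbT.
  case: ifP => // H.
  have eS : e \notin S by apply: contra eF => eS; have := subsetP H _ eS; rewrite inE.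
  rewrite cardsU1 eS add1n subSS exprS setUCA setUA; ring.
rewrite big_distrr /=; apply: eq_big => S.
  apply/idP/andP => [H|[H eS]].
    split; last by apply: contra eF => eS; have := subsetP H _ eS; rewrite inE.
    by apply: subset_trans H _; apply/subsetP => x; rewrite !inE => ->; rewrite orbT.
  apply/subsetP => x xS; have := subsetP H _ xS; rewrite !inE.
  by case: eqP xS eS => [->->|].
move=> H; have le : (#|S| <= size F)%N.
  by apply: leq_trans (subset_leq_card H) _; rewrite cardsE card_size.
rewrite subSn // exprS; ring.
Qed.

Lemma expect_map_inl (R : realFieldType) (T U : finType) (p : R) (F : seq T)
    (g : {set T + U} -> R) (S : {set T}) W :
  expect (fun=> p) (map inl F) g ([set inl x | x in S] :|: W)
  = expect (fun=> p) F (fun S => g ([set inl x | x in S] :|: W)) S.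
Proof.
elim: F S => [|e F IH] S //=; rewrite -!IH; congr (_ * expect _ _ _ _ + _).
by rewrite setUA imsetU1.
Qed.

Lemma expect_configurations (R : realFieldType) (T U : finType) (p : R)
    (g : {set T + U} -> R) W :
  expect (fun=> p) (map inl (enum T)) g W = \sum_(S : {set T})
     p ^+ #|S| * (1 - p) ^+ #|~: S| * g ([set inl x | x in S] :|: W).
Proof.
rewrite -[W in LHS]set0U -(imset0 (inl : T -> T + U)).
rewrite expect_map_inl expect_subset_sum ?enum_uniq //.
apply: eq_big => S; first by apply/subsetP => x _; rewrite inE mem_enum.
by move=> _; rewrite setU0 -cardE (cardsCs (~: S)) setCK.
Qed.

(** * Slots and wirings of the box *)

Lemma set2_eq (T : finType) (x y a b : T) : a != b -> [set x; y] = [set a; b] ->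
  x = a /\ y = b \/ x = b /\ y = a.
Proof.
move=> ab E.
have ha : a \in [set x; y] by rewrite E !inE eqxx.
have hb : b \in [set x; y] by rewrite E !inE eqxx orbT.
move: ha hb; rewrite !inE => /orP[/eqP ax|/eqP ay] /orP[/eqP bx|/eqP bY]; subst.
+ by rewrite eqxx in ab.
+ by left.
+ by right.
by rewrite eqxx in ab.
Qed.

Section Geometry.
Variables (n N K : nat) (N0 : (0 < N)%N) (K0 : (0 < K)%N).
Local Notation J := (K * (N * N))%N.
Hypothesis Hn : (6 * J <= n)%N.
Local Notation left_class := (left_class N0).
Local Notation right_class := (right_class N0).
Local Notation V := (vertex n).

Definition slot_left (t : nat) : V := (inord (6 * t + 2), ord0).
Definition slot_right (t : nat) : V := (inord (6 * t + 3), ord0).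

Lemma val_slot_left t : (t < J)%N -> ((slot_left t).1 = 6 * t + 2 :> nat)%N.
Proof. by move=> tJ; rewrite /= inordK //; move: Hn; lia. Qed.

Lemma val_slot_right t : (t < J)%N -> ((slot_right t).1 = 6 * t + 3 :> nat)%N.
Proof. by move=> tJ; rewrite /= inordK //; move: Hn; lia. Qed.

Lemma vertex_eq (x y : V) : (x == y) = ((x.1 : nat) == y.1) && ((x.2 : nat) == y.2).
Proof. by []. Qed.

Lemma NJ : (N <= J)%N. Proof. by move: N0 K0; nia. Qed.

Lemma nearest_neighborE (x y : V) : nearest_neighbor (to_Z2 x) (to_Z2 y) =
  [|| (y.1 == x.1.+1 :> nat) && (y.2 == x.2 :> nat),
      (x.1 == y.1.+1 :> nat) && (y.2 == x.2 :> nat),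
      (y.1 == x.1 :> nat) && (y.2 == x.2.+1 :> nat) |
      (y.1 == x.1 :> nat) && (x.2 == y.2.+1 :> nat)]%N.
Proof. by rewrite /nearest_neighbor /to_Z2 /=; lia. Qed.

Definition ends (e : edge n) : V * V :=
  odflt ((ord0, ord0), (ord0, ord0))
    [pick u : V * V | (val e == [set u.1; u.2]) && (u.1.1 + u.1.2 < u.2.1 + u.2.2)%N].

Lemma endsP (e : edge n) : let u := ends e in
  val e = [set u.1; u.2] /\
  ((u.2.1 = u.1.1.+1 :> nat /\ u.2.2 = u.1.2 :> nat) \/
   (u.2.1 = u.1.1 :> nat /\ u.2.2 = u.1.2.+1 :> nat))%N.
Proof.
have := valP e; rewrite inE => /existsP[x /existsP[y /andP[nn /eqP E]]].
rewrite nearest_neighborE in nn.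
rewrite /ends; case: pickP => [[a b] /= /andP[/eqP E' lt]|H] /=.
  split=> //; have nab : a != b by apply: contraTneq lt => ->; rewrite ltnn.
  move: E'; rewrite E => /(set2_eq nab) [] [xE yE]; subst; move: nn lt => /=; lia.
have h1 : (x.1 + x.2 < y.1 + y.2)%N = false by have := H (x, y); rewrite /= E eqxx.
have h2 : (y.1 + y.2 < x.1 + x.2)%N = false by have := H (y, x); rewrite /= E setUC eqxx.
by move: nn h1 h2; lia.
Qed.

(** The wires of slot [t] are bonds of their own, [inr (false, t)] at its left end
    and [inr (true, t)] at its right end; a boundary condition is a set of bonds that
    are always open. *)
Definition box_bond : finType := (edge n + bool * 'I_J)%type.

Definition bond_src (x : box_bond) : V :=
  match x with inl e => (ends e).1 | inr (b, t) => if b then slot_right t else slot_left t end.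
(** A class is wired through a hub: class [a] is represented by the left end of
    slot [a], which itself belongs to class [a]. *)
Definition bond_tgt (x : box_bond) : V :=
  match x with
  | inl e => (ends e).2
  | inr (b, t) => slot_left (if b then right_class t else left_class t)
  end.

Definition wires (j : nat) : {set box_bond} :=
  [set x : box_bond | if x is inr (b, t) then ~~ b || (t < j)%N else false].

Definition box_list : seq box_bond := map inl (enum (edge n)).

Lemma slot_edge_subproof (t : 'I_J) : [set slot_left t; slot_right t] \in box_edges n.
Proof.
rewrite inE; apply/existsP; exists (slot_left t); apply/existsP; exists (slot_right t).
rewrite eqxx andbT nearest_neighborE val_slot_left // val_slot_right //=; lia.
Qed.

Definition slot_edge (t : 'I_J) : edge n :=
  @exist {set V} (fun e => e \in box_edges n) _ (slot_edge_subproof t).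
Definition slot (t : 'I_J) : box_bond := inl (slot_edge t).

Lemma ends_unique (e : edge n) (x y : V) : val e = [set x; y] ->
  (x.1 + x.2 < y.1 + y.2)%N -> ends e = (x, y).
Proof.
have [E H] := endsP e; rewrite E => Exy lt.
have nxy : x != y by apply: contraTneq lt => ->; rewrite ltnn.
case: (set2_eq nxy Exy) => [] [xE yE]; first by rewrite -xE -yE; case: (ends e).
by move: H lt; rewrite xE yE; lia.
Qed.

Lemma ends_slot (t : 'I_J) : ends (slot_edge t) = (slot_left t, slot_right t).
Proof. by apply: ends_unique => //; rewrite val_slot_left // val_slot_right //=; lia. Qed.

Lemma slot_inj : injective slot.
Proof.
move=> t t' [] E.
have : ends (slot_edge t) = ends (slot_edge t') by congr ends; apply/val_inj.
rewrite !ends_slot => -[/(congr1 (fun i : 'I_n.+1 => nat_of_ord i))].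
have := val_slot_left (ltn_ord t); have := val_slot_left (ltn_ord t'); rewrite /= => -> -> H _.
by apply/val_inj => /=; lia.
Qed.

Lemma left_class_id (a : 'I_N) : left_class a = a.
Proof. by apply/val_inj; rewrite /= modn_small. Qed.

Lemma ord_ltJ (a : 'I_N) : (a < J)%N.
Proof. exact: leq_trans (ltn_ord a) NJ. Qed.

Local Notation conn := (conn bond_src bond_tgt).

Lemma conn_left_class j (P : {set box_bond}) (t : 'I_J) : wires j \subset P ->
  conn P (slot_left t) (slot_left (left_class t)).
Proof.
by move=> /subsetP HW; apply: (@conn_edge _ _ bond_src bond_tgt P (inr (false, t))); apply: HW;
  rewrite inE.
Qed.

Lemma conn_right_class j (P : {set box_bond}) (t : 'I_J) : wires j \subset P -> (t < j)%N ->
  conn P (slot_right t) (slot_left (right_class t)).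
Proof.
by move=> /subsetP HW tj; apply: (@conn_edge _ _ bond_src bond_tgt P (inr (true, t)));
  apply: HW; rewrite inE.
Qed.

Lemma wiresS j : (j < J)%N -> exists w, wires j.+1 = w |: wires j.
Proof.
move=> jJ; exists (inr (true, Ordinal jJ)); apply/setP => -[e|[[] t]]; rewrite !inE //=.
have -> : (inr (true, t) == inr (true, Ordinal jJ) :> box_bond) = (t == j :> nat).
  by apply/eqP/eqP => [[->]|E] //; congr (inr (_, _)); exact/val_inj.
by rewrite ltnS leq_eqVlt.
Qed.

(** A block of 6 columns and 3 rows, with the slot in the middle of its lower
    side: a path of two bonds from an end of the slot stays inside. *)
Definition in_region (t : nat) (x : V) := ((x.1 %/ 6 == t) && (x.2 <= 2))%N.
Definition region (t : 'I_J) : {set box_bond} :=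
  [set x : box_bond | if x is inl e then in_region t (ends e).1 && in_region t (ends e).2
    else false].

Lemma region_sub t e : e \in region t -> e \in box_list.
Proof. by case: e => [e _|[b t']]; rewrite ?inE // map_f ?mem_enum. Qed.

Lemma region_disj t t' e : t != t' -> e \in region t -> e \notin region t'.
Proof.
move=> tt'; case: e => [e|[b s]]; rewrite !inE // => /andP[/andP[/eqP E _] _].
by rewrite /in_region E -val_eqE /= in tt' *; rewrite (negbTE tt').
Qed.

(** There are at most 18 vertices in a region, hence at most [18 * 18] bonds. *)
Lemma region_card t : (#|region t| <= 324)%N.
Proof.
pose cell (x : V) : 'I_6 * 'I_3 := (inord (x.1 %% 6), inord x.2).
pose code (x : box_bond) := if x is inl e then Some (cell (ends e).1, cell (ends e).2) else
  None.
have cell_inj (x y : V) : in_region t x -> in_region t y -> cell x = cell y -> x = y.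
  move=> /andP[/eqP x1 x2] /andP[/eqP y1 y2] [] /(congr1 (@nat_of_ord _)) + /(congr1
    (@nat_of_ord _)).
  rewrite !inordK ?ltn_mod ?ltnS // => E1 E2.
  apply/eqP; rewrite vertex_eq E2 eqxx andbT; apply/eqP.
  by rewrite (divn_eq x.1 6) (divn_eq y.1 6) x1 y1 E1.
rewrite -(@card_in_imset _ _ (fun x => odflt (cell (ord0, ord0), cell (ord0, ord0)) (code x))).
  by apply: leq_trans (max_card _) _; rewrite !card_prod !card_ord.
move=> [e|[b s]] [e'|[b' s']]; rewrite !inE //= => /andP[h1 h2] /andP[h3 h4] [E1 E2 E3 E4].
have F1 : (ends e).1 = (ends e').1 by apply: cell_inj => //; congr (_, _).
have F2 : (ends e).2 = (ends e').2 by apply: cell_inj => //; congr (_, _).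
congr inl; apply/val_inj; have [-> _] := endsP e; have [-> _] := endsP e'.
by rewrite F1 F2.
Qed.

Definition attached (j : nat) (a : 'I_N) (x : V) : bool :=
  [exists t : 'I_J, (x == slot_left t) && (left_class t == a)
                 || [&& (t < j)%N, x == slot_right t & right_class t == a]].

Lemma attached_left_inv j a t : (t < J)%N -> attached j a (slot_left t) -> left_class t = a.
Proof.
move=> tJ /existsP[s]; rewrite !vertex_eq val_slot_left // val_slot_left // val_slot_right //
  /=.
case/orP => [/andP[/andP[/eqP E _] /eqP <-]|/and3P[_ /andP[/eqP E _] _]]; last by lia.
by congr left_class; lia.
Qed.

Lemma attached_left j (t : 'I_J) : attached j (left_class t) (slot_left t).
Proof. by apply/existsP; exists t; rewrite !eqxx. Qed.

Lemma attached_core j (a : 'I_N) : attached j a (slot_left a).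
Proof. rewrite -{1}(left_class_id a); exact: (attached_left j (Ordinal (ord_ltJ a))). Qed.

Lemma attached_right j a (t : 'I_J) : (t < j)%N ->
  attached j a (slot_right t) = (right_class t == a).
Proof.
move=> tj; apply/existsP/eqP => [[s]|E].
  rewrite !vertex_eq val_slot_right // val_slot_left // val_slot_right // /=.
  case/orP => [/andP[/andP[/eqP E _] _]|/and3P[_ /andP[/eqP E _] /eqP <-]]; first by lia.
  by congr right_class; lia.
by exists t; rewrite tj E !eqxx orbT.
Qed.

Lemma wire_attached j a (b : bool) (t : 'I_J) : (~~ b || (t < j)%N) ->
  attached j a (bond_src (inr (b, t))) = attached j a (bond_tgt (inr (b, t))).
Proof.
case: b => /= [tj|_].
  rewrite attached_right //; apply/eqP/idP => [<-|/attached_left_inv H].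
    exact: attached_core.
  by rewrite -(left_class_id (right_class t)) (H (ord_ltJ (right_class t))).
apply/idP/idP => [/attached_left_inv <- //|/attached_left_inv H].
  exact: attached_core.
by rewrite -(H (ord_ltJ (left_class t))) (left_class_id (left_class t)); exact: attached_left.
Qed.

Definition joins (e : edge n) (x y : V) :=
  (ends e == (x, y)) || (ends e == (y, x)).

Lemma joins_coord e x y : joins e x y ->
  [\/ (y.1 = x.1.+1 :> nat /\ y.2 = x.2 :> nat),
      (x.1 = y.1.+1 :> nat /\ y.2 = x.2 :> nat),
      (y.1 = x.1 :> nat /\ y.2 = x.2.+1 :> nat) |
      (y.1 = x.1 :> nat /\ x.2 = y.2.+1 :> nat)]%N.
Proof.
have [_ H] := endsP e; case/orP => /eqP E; rewrite E /= in H; case: H => H.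
+ by constructor 1.
+ by constructor 3.
constructor 2; case: H => H1 H2; split=> //.
by constructor 4; case: H.
Qed.

Lemma joins_slot e (t : 'I_J) :
  joins e (slot_left t) (slot_right t) \/ joins e (slot_right t) (slot_left t) ->
    e = slot_edge t.
Proof.
move=> H; have [E _] := endsP e; apply/val_inj; rewrite /= E.
by case: H => /orP[/eqP->|/eqP->] //=; rewrite setUC.
Qed.

Lemma joins_region e (t : 'I_J) x y : joins e x y -> in_region t x -> in_region t y ->
  inl e \in region t.
Proof. by rewrite !inE; case/orP => /eqP -> /= -> ->. Qed.

Lemma in_regionI (t : nat) (x : V) : (6 * t <= x.1)%N -> (x.1 < 6 * t + 6)%N -> (x.2 <= 2)%N ->
  in_region t x.
Proof.
move=> h1 h2 h3; rewrite /in_region h3 andbT.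
by move: h1 h2; move: (nat_of_ord x.1) => k; clear; lia.
Qed.

Lemma joins_near e (t : nat) (l h : nat) (x y : V) : joins e x y ->
  (6 * t + l <= x.1)%N -> (x.1 <= 6 * t + h)%N -> (0 < l)%N ->
  [/\ (6 * t + l.-1 <= y.1)%N, (y.1 <= 6 * t + h.+1)%N & (y.2 <= x.2.+1)%N].
Proof.
move=> /joins_coord; move: (nat_of_ord x.1) (nat_of_ord x.2) (nat_of_ord y.1) (nat_of_ord y.2).
by move=> x1 x2 y1 y2 H h1 h2 h3; case: H => -[]; split; lia.
Qed.

(** The vertices attached to [a], together with their neighbours along open bonds,
    form a closed set: an open path of two bonds from an attached vertex would lie
    in the region of its slot and make it busy.  No neighbour is the end of a slot
    wired elsewhere, since slots are at distance and those of class [a] are closed. *)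
Lemma slot_isolated j (P : {set box_bond}) a : wires j \subset P ->
  P \subset wires j :|: [set x in box_list] ->
  (forall t : 'I_J, (t < j)%N -> (left_class t == a) || (right_class t == a) ->
    slot t \notin P) ->
  (forall t : 'I_J, (left_class t == a) || (t < j)%N && (right_class t == a) ->
    ~~ busy (region t) P) ->
  forall b : 'I_N, conn P (slot_left a) (slot_left b) -> b = a.
Proof.
move=> WP PW Hslot Hbusy.
have vleft (t : 'I_J) := val_slot_left (ltn_ord t).
have vright (t : 'I_J) := val_slot_right (ltn_ord t).
(* attached vertices and their neighbours *)
pose C x := attached j a x || [exists e : edge n, (inl e \in P) &&
   [exists z, attached j a z && joins e z x]].
have F2 e z x : inl e \in P -> attached j a z -> joins e z x ->
    (forall t : 'I_J, x <> slot_left t) /\ (forall t : 'I_J, (t < j)%N -> x <> slot_right t).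
  move=> eP /existsP[s Hs] L; have Lc := joins_coord L.
  case/orP: Hs => [/andP[/eqP Ez rs]|/and3P[sj /eqP Ez cs]]; subst z.
    split=> [t xE|t tj xE]; subst x; have := Lc; rewrite !vleft ?vright /=.
      by case; lia.
    move=> H; have ts : s = t by apply/val_inj => /=; case: H; lia.
    subst s; have Ee := joins_slot (or_introl L); subst e.
    by have := Hslot t tj; rewrite rs => /(_ isT) /negP; apply.
  split=> [t xE|t tj xE]; subst x; have := Lc; rewrite ?vleft !vright /=; last by case; lia.
  move=> H; have ts : s = t by apply/val_inj => /=; case: H; lia.
  subst s; have Ee := joins_slot (or_intror L); subst e.
  by have := Hslot t sj; rewrite cs orbT => /(_ isT) /negP; apply.
have F3 e e' z x y : inl e \in P -> inl e' \in P -> e != e' -> attached j a z ->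
   joins e z x -> joins e' x y -> False.
  move=> eP e'P ee' /existsP[s Hs] L L'.
  have zs : (z.1 = 6 * s + 2 :> nat \/ z.1 = 6 * s + 3 :> nat)%N.
    case/orP: Hs => [/andP[/eqP-> _]|/and3P[_ /eqP-> _]]; [left; exact: vleft|right;
      exact: vright].
  have zs2 : (z.2 = 0 :> nat)%N by case/orP: Hs => [/andP[/eqP-> _]|/and3P[_ /eqP-> _]].
  have Hb : ~~ busy (region s) P.
    apply: Hbusy; case/orP: Hs => [/andP[_ ->]|/and3P[-> _ ->]] //; by rewrite orbT.
  have z1 : (6 * s + 2 <= z.1)%N by case: zs => ->; rewrite ?leqnn // leq_add2l.
  have z2 : (z.1 <= 6 * s + 3)%N by case: zs => ->; rewrite ?leqnn // leq_add2l.
  have [x1 x2 x3] := joins_near L z1 z2 isT; rewrite zs2 in x3.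
  have [y1 y2 y3] := joins_near L' x1 x2 isT.
  have dz : in_region s z.
    apply: in_regionI; rewrite ?zs2 //; first exact: leq_trans (leq_addr _ _) z1.
    by apply: leq_ltn_trans z2 _; rewrite ltn_add2l.
  have dx : in_region s x.
    apply: in_regionI; first exact: leq_trans (leq_addr _ _) x1.
      by apply: leq_ltn_trans x2 _; rewrite ltn_add2l.
    exact: leq_trans x3 _.
  have dy : in_region s y.
    apply: in_regionI; first exact: leq_trans (leq_addr _ _) y1.
      by apply: leq_ltn_trans y2 _; rewrite ltn_add2l.
    exact: leq_trans y3 _.
  have eR := joins_region L dz dx; have eR' := joins_region L' dx dy.
  case/negP: Hb; rewrite /busy; apply: (@leq_trans #|[set inl e; inl e'] : {set box_bond}|).
    by rewrite cards2 (_ : (inl e != inl e' :> box_bond)).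
  apply: subset_leq_card; apply/subsetP => u; rewrite in_set2.
  by case/orP => /eqP->; rewrite in_setI ?eP ?e'P ?eR ?eR'.
have cl : closed (adj bond_src bond_tgt P) C.
  apply: intro_closed => [|x y]; first exact: conn_sym.
  move=> /existsP[[e|[b t]] /andP[eP Hxy]] Cx.
    have L : joins e x y.
      move: Hxy => /=; rewrite /joins; case: (ends e) => u1 u2 /=.
      by case/orP=> /andP[/eqP-> /eqP->]; rewrite eqxx ?orbT.
    case/orP: Cx => [ax|/existsP[e' /andP[e'P /existsP[z /andP[az Lz]]]]].
      apply/orP; right; apply/existsP; exists e; rewrite eP /=.
      by apply/existsP; exists x; rewrite ax.
    case: (eqVneq e' e) => [E|ne]; last by case: (F3 _ _ _ _ _ e'P eP ne az Lz L).
    subst e'; apply/orP; left; move: L Lz; rewrite /joins.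
    suff E : (ends e == (x, y)) || (ends e == (y, x)) ->
        (ends e == (z, x)) || (ends e == (x, z)) -> y = z by move=> h1 h2; rewrite (E h1 h2).
    by case/orP => /eqP-> /orP[] /eqP[]; congruence.
  have Wt : ~~ b || (t < j)%N.
    have := subsetP PW _ eP; rewrite !inE => /orP[//|/mapP[f _ //]].
  have E := wire_attached a Wt.
  have ax : attached j a x.
    case/orP: Cx => // /existsP[e' /andP[e'P /existsP[z /andP[az Lz]]]].
    have [G1 G2] := F2 _ _ _ e'P az Lz.
    case/orP: Hxy => /andP[/eqP E1 /eqP E2]; move: Wt E1 E2; case: (b) => /= [tj|_] E1 E2.
    - by case: (G2 t tj).
    - by case: (G1 t).
    - by case: (G1 (Ordinal (ord_ltJ (right_class t)))).
    by case: (G1 (Ordinal (ord_ltJ (left_class t)))).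
  apply/orP; left; case/orP: Hxy => /andP[/eqP E1 /eqP E2]; subst.
    by rewrite -E.
  by rewrite E.
move=> b Hab.
have Ca : C (slot_left a).
  by apply/orP; left; exact: attached_core.
have : C (slot_left b) by have := closed_connect cl Hab; rewrite /in_mem /= Ca => <-.
case/orP => [/attached_left_inv H|/existsP[e /andP[eP /existsP[z /andP[az Lz]]]]].
  by rewrite -(left_class_id b) (H (ord_ltJ _)).
have [G1 _] := F2 _ _ _ eP az Lz.
by case: (G1 (Ordinal (ord_ltJ b))).
Qed.

(** A representative of the block of [x] in the boundary condition; vertices
    that are not wired represent themselves. *)
Definition class_label (j : nat) (x : V) : V :=
  if [pick t : 'I_J | x == slot_left t] is Some t then slot_left (left_class t)
  else if [pick t : 'I_J | (x == slot_right t) && (t < j)%N] is Some t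
  then slot_left (right_class t)
  else x.

Definition wiring (j : nat) : {set {set V}} := preim_partition (class_label j) (boundary n).

Lemma wiring_boundary_condition j : boundary_condition (wiring j).
Proof. exact: preim_partitionP. Qed.

Lemma slot_left_inj (t s : 'I_J) : slot_left t = slot_left s -> t = s.
Proof.
move=> /(congr1 (fun x : V => nat_of_ord x.1)); rewrite !val_slot_left // => E.
by apply/val_inj => /=; lia.
Qed.

Lemma slot_right_inj (t s : 'I_J) : slot_right t = slot_right s -> t = s.
Proof.
move=> /(congr1 (fun x : V => nat_of_ord x.1)); rewrite !val_slot_right // => E.
by apply/val_inj => /=; lia.
Qed.

Lemma slot_right_neq_left (t s : 'I_J) : slot_right t <> slot_left s.
Proof.
move=> /(congr1 (fun x : V => nat_of_ord x.1)); rewrite val_slot_left // val_slot_right //; lia.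
Qed.

Lemma class_label_left j (t : 'I_J) : class_label j (slot_left t) = slot_left (left_class t).
Proof.
by rewrite /class_label; case: pickP => [s /eqP/slot_left_inj->//|/(_ t)]; rewrite eqxx.
Qed.

Lemma class_label_right j (t : 'I_J) : (t < j)%N ->
  class_label j (slot_right t) = slot_left (right_class t).
Proof.
move=> tj; rewrite /class_label; case: pickP => [s /eqP/slot_right_neq_left//|_].
by case: pickP => [s /andP[/eqP/slot_right_inj-> //]|/(_ t)]; rewrite eqxx tj.
Qed.

Lemma class_label_core j (a : 'I_N) : class_label j (slot_left a) = slot_left a.
Proof.
rewrite -[X in slot_left X]/(nat_of_ord (Ordinal (ord_ltJ a))) class_label_left /=.
by congr (slot_left _); rewrite /= modn_small.
Qed.

Lemma bottom_boundary (i : 'I_n.+1) : ((i, ord0) : V) \in boundary n.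
Proof.
rewrite inE; apply/asboolP; exists (Posz i, Negz 0); split.
  by rewrite /nearest_neighbor /to_Z2 /= subrr.
by case=> y; rewrite /to_Z2 => -[].
Qed.

Lemma wiringP j x y :
  reflect [/\ x \in boundary n, y \in boundary n & class_label j x = class_label j y]
    [exists B in wiring j, (x \in B) && (y \in B)].
Proof.
apply: (iffP existsP) => [[B /and3P[/imsetP[z zb ->]]]|[xb yb E]].
  by rewrite !inE => /andP[-> /eqP <-] /andP[-> /eqP <-].
exists [set y in boundary n | class_label j x == class_label j y].
rewrite !inE in xb yb *; rewrite xb yb E eqxx !andbT.
by apply/imsetP; exists x; rewrite ?inE // E.
Qed.

Lemma conn_class_label j (P : {set box_bond}) x : wires j \subset P ->
  conn P x (class_label j x).
Proof.
move=> HW; rewrite /class_label; case: pickP => [t /eqP->|_]; first exact: conn_left_class HW.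
case: pickP => [t /andP[/eqP-> tj]|_]; first exact: conn_right_class HW tj.
exact: conn_refl.
Qed.

Lemma conn_wired j (S : {set edge n}) :
  connect (wired_rel S (wiring j)) =2
  conn ([set inl e | e in S] :|: wires j).
Proof.
set P := _ :|: _; have HW : wires j \subset P by apply: subsetUr.
have wsym : connect_sym (wired_rel S (wiring j)).
  apply: sym_connect_sym => x y; rewrite /wired_rel; congr (_ || _).
    by apply: eq_existsb => e; rewrite setUC.
  by apply: eq_existsb => B; rewrite [(x \in B) && _]andbC.
move=> x y; apply/idP/idP; apply: connect_sub => {}x {}y.
  case/orP => [/existsP[e /andP[eS /eqP E]]|/wiringP[_ _ E]].
    have [Ee Hc] := endsP e.
    have ne : (ends e).1 != (ends e).2.
      by apply/eqP => H; rewrite H in Hc; move: Hc; lia.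
    have eP : inl e \in P by rewrite inE imset_f.
    have H : conn P (ends e).1 (ends e).2 := @conn_edge _ _ bond_src bond_tgt _ _ eP.
    by case: (set2_eq ne (etrans (esym E) Ee)) => -[-> ->] //;
      exact: etrans (conn_sym _ _ _ _ _) H.
  suff H : conn P x y by exact: H.
  apply: conn_trans (conn_class_label _ HW) _.
  by rewrite E conn_sym; apply: conn_class_label HW.
case/existsP => u /andP[uP Hu].
suff H : connect (wired_rel S (wiring j)) (bond_src u) (bond_tgt u).
  by case/orP: Hu => /andP[/eqP<- /eqP<-] //; rewrite wsym.
apply: connect1; case: u uP {Hu} => [e|[b t]]; rewrite !inE => /orP[H|H] //.
+ apply/orP; left; apply/existsP; exists e; have [-> _] := endsP e; rewrite eqxx andbT.
  by case/imsetP: H => f fS [->].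
+ by case/imsetP: H.
apply/orP; right; apply/wiringP; case: b H => /= H; split; try exact: bottom_boundary.
  exact: etrans (class_label_right H) (esym (class_label_core j (right_class t))).
exact: etrans (class_label_left j t) (esym (class_label_core j (left_class t))).
Qed.

Lemma num_components_wiring j (S : {set edge n}) :
  num_components S (wiring j) = comps bond_src bond_tgt ([set inl e | e in S] :|: wires j).
Proof. by apply: eq_n_comp; apply: conn_wired. Qed.

(** The sums over edge sets that define the random-cluster measure are percolation
    means in the multigraph of edges and wires. *)
Lemma rc_weight_sum (R : realType) (p q : R) j (g : {set box_bond} -> R) :
  expect (fun=> p) (box_list) (fun P => g P * clusterw bond_src bond_tgt q P) (wires j)
  = \sum_(S : {set edge n}) rc_weight p q (wiring j) S
      * g ([set inl e | e in S] :|: wires j).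
Proof.
rewrite expect_configurations; apply: eq_bigr => S _.
rewrite /rc_weight num_components_wiring /clusterw.
by rewrite -!mulrA; congr (_ * (_ * _)); rewrite mulrC.
Qed.

Lemma edge_card : (0 < #|edge n|)%N.
Proof.
have J0 : (0 < J)%N by rewrite !muln_gt0 N0 K0.
by apply/card_gt0P; exists (slot_edge (Ordinal J0)).
Qed.

Lemma wires_box_list j e : e \in box_list -> e \notin wires j.
Proof. by case/mapP => f _ ->; rewrite inE. Qed.

Lemma box_list_uniq : uniq (box_list).
Proof. by rewrite map_inj_uniq ?enum_uniq // => x y []. Qed.

End Geometry.

(** * Slow mixing on one box *)

(** Only the existence of a bound matters; forgetting its value keeps powers of it
    from being computed. *)
Lemma region_bound : exists r : nat, forall n N K (t : 'I_(K * (N * N))),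
  (0 < N)%N -> (0 < K)%N -> (6 * (K * (N * N)) <= n)%N -> (#|@region n N K t| <= r)%N.
Proof. by exists 324%N => n N K t N0 K0 Hn; apply: region_card. Qed.

Section BoxBottleneck.
Variables (R : realType) (p q : R) (n N K r : nat).
Hypotheses (p0 : 0 < p) (p2 : p <= 2^-1) (q2 : 2 < q) (N0 : (0 < N)%N) (K0 : (0 < K)%N).
Local Notation J := (K * (N * N))%N.
Hypotheses (Hn : (6 * J <= n)%N) (Hr : forall t, (#|@region n N K t| <= r)%N).
Variables (M : nat) (g eps t c1 delta A B0 : R).
Hypotheses (hg : p * N%:R <= g) (hK : 2 * K.+1%:R * g <= q * t) (ht : t <= 1)
  (hc1 : c1 <= t - 1 - ln t) (hg2 : 2 * g / q <= c1 / 4)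
  (eps0 : 0 < eps) (eps1 : eps <= 1) (heps : (1 + q) * eps <= c1 / 4)
  (hM1 : M%:R <= eps * N%:R) (hM2 : eps * N%:R <= M.+1%:R)
  (delta0 : 0 < delta) (hdelta : delta <= M.+1%:R * (p / q))
  (A2 : 2 <= A) (dA : 2 <= delta * A) (BF : busy_factor p N K r A <= B0).

Lemma box_bottleneck (T : R) : (0 < M)%N -> 2 * B0 < A ^+ M ->
  ln 2 + N%:R * ((q - 2) / q * ln (q - 1)) + J%:R * (p * ordered_rate q + 2 * p ^+ 2)
    <= p * (1 - q^-1) * (J%:R - K.+1%:R * (N%:R * M%:R)) ->
  1 <= T -> T ^+ 2 <= expR (c1 / 4 * (eps * N%:R)) ->
  16 * q * (N.+1%:R * (B0 / delta)) <= T ->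
  exists2 xi : {set {set vertex n}}, boundary_condition xi &
    (T%:E <= fk_mixing_time p q xi)%E.
Proof.
move=> M0 BM Hend T1 TT HT.
pose v (a : 'I_N) : vertex n := slot_left n a.
have Wleft j (P : {set box_bond n N K}) s : wires n N K j \subset P ->
    conn (@bond_src n N K) (@bond_tgt n N K N0) P (bond_src (slot N0 K0 Hn s)) (v (left_class
      N0 s)).
  by rewrite /= ends_slot; apply: conn_left_class.
have Wright j (P : {set box_bond n N K}) (s : 'I_J) : wires n N K j \subset P -> (s < j)%N ->
    conn (@bond_src n N K) (@bond_tgt n N K N0) P (bond_tgt N0 (slot N0 K0 Hn s)) (v
      (right_class N0 s)).
  by rewrite /= ends_slot; apply: conn_right_class.
have WS j : (j < J)%N -> exists w, wires n N K j.+1 = w |: wires n N K j by apply: wiresS.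
have isol j (P : {set box_bond n N K}) a H1 H2 H3 H4 :=
  @slot_isolated n N K N0 K0 Hn j P a H1 H2 H3 H4.
have [j jJ [h0 h1 h2]] := model_bottleneck p0 p2 q2 (box_list_uniq n N K)
  (@slot_inj n N K N0 K0 Hn) (fun s => map_f inl (mem_enum _ _)) (@wires_box_list n N K)
  Wleft Wright WS (@region_sub n N K) (@region_disj n N K) Hr isol
  hg hK ht hc1 hg2 eps0 eps1 heps hM1 hM2 delta0 hdelta A2 dA BF M0 BM Hend T1 TT HT.
exists (@wiring n N K N0 j); first exact: wiring_boundary_condition.
rewrite /stage_sum in h0 h1 h2.
set W := wires n N K j in h0 h1 h2.
pose cfg (S : {set edge n}) : {set box_bond n N K} := [set inl e | e in S] :|: W.
pose sm S := small_clusters (@bond_src n N K) (@bond_tgt n N K N0) v M (cfg S).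
pose w := rc_weight p q (@wiring n N K N0 j).
have EA : expect (fun=> p) (box_list n N K) (fun P => (small_clusters (@bond_src n N K)
  (@bond_tgt n N K N0) v M P)%:R
     * clusterw (@bond_src n N K) (@bond_tgt n N K N0) q P) W = \sum_(S in [set S | sm S]) w S.
  rewrite rc_weight_sum // [RHS]big_mkcond; apply: eq_bigr => S _.
  by rewrite inE -/(cfg S) /sm; case: small_clusters; rewrite ?mulr1 ?mulr0.
have EZ : expect (fun=> p) (box_list n N K) (clusterw (@bond_src n N K) (@bond_tgt n N K N0)
  q) W
    = \sum_S w S.
  rewrite (eq_expect _ _ _ (h := fun P => 1 *
    clusterw (@bond_src n N K) (@bond_tgt n N K N0) q P)) => [|P]; last by rewrite mul1r.
  by rewrite (rc_weight_sum _ _ _ _ _ _ (fun=> 1)) //; apply: eq_bigr => S _; rewrite mulr1.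
have mono (S S' : {set edge n}) : S \subset S' -> cfg S \subset cfg S'.
  by move=> SS; apply: setSU; apply: imsetS.
have cfgU (S : {set edge n}) e : cfg (e |: S) = inl e |: cfg S by rewrite /cfg imsetU1 setUA.
rewrite EA in h0 h1 h2; rewrite EZ in h1.
apply: (@fk_mixing_time_ge _ _ _ _ _ p0 _ _ (edge_card N0 K0 Hn) [set S | sm S]) => //.
+ by move: p2; lra.
+ by move: q2; lra.
+ move=> S e; rewrite !inE; apply: sub_small; apply: mono; exact: subD1set.
+ by apply: contraTneq h0 => ->; rewrite big_set0 ltxx.
apply: le_trans h2; rewrite ler_wpM2l //; first by rewrite mulr_ge0 // (le_trans _ T1).
rewrite rc_weight_sum // big_mkcond; apply: ler_sum => S _.
have w0 : 0 <= w S by apply/ltW/rc_weight_gt0 => //; move: p2 q2; lra.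
case: ifP => [/andP[SA /existsP[e eA]]|_]; last by rewrite mulr_ge0.
rewrite !inE in SA eA; rewrite /sm cfgU in eA.
by rewrite (leave_small_clusters SA eA) mulr1.
Qed.

End BoxBottleneck.

(** * Choice of the constants *)

Section Constants.
Variables (R : realType).
Implicit Types (p q g : R).

Lemma busy_factor_le p g (N K r : nat) (A : R) : 0 < p -> p <= 2^-1 -> p * N%:R <= g ->
  0 <= A -> busy_factor p N K r A <= expR (K%:R * A ^+ 2 * r%:R ^+ 2 * 2 ^+ r * g ^+ 2).
Proof.
move=> p0 p2 hg A0.
have p1 : 0 < 1 - p by lra.
have i2 : (1 - p)^-1 <= 2 by rewrite -[leRHS]invrK lef_pV2 ?posrE //; lra.
have b0 : 0 <= A ^+ 2 * (r%:R * p) ^+ 2.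
  by rewrite mulr_ge0 ?exprn_ge0 // mulr_ge0 // ltW.
have H : 1 + A ^+ 2 * (r%:R * p) ^+ 2 / (1 - p) ^+ r <=
  expR (A ^+ 2 * (r%:R * p) ^+ 2 * 2 ^+ r).
  apply: le_trans (expR_ge1Dx _); rewrite lerD2l ler_wpM2l // -exprVn.
  by apply: lerXn2r; rewrite ?nnegrE ?invr_ge0 // ltW.
have H0 : 0 <= 1 + A ^+ 2 * (r%:R * p) ^+ 2 / (1 - p) ^+ r.
  by rewrite addr_ge0 // divr_ge0 // exprn_ge0 // ltW.
apply: le_trans (pow_le_expR _ H0 H) _; rewrite ler_expR !natrM.
have -> : K%:R * (N%:R * N%:R) * (A ^+ 2 * (r%:R * p) ^+ 2 * 2 ^+ r) =
  K%:R * A ^+ 2 * r%:R ^+ 2 * 2 ^+ r * (p * N%:R) ^+ 2 :> R by ring.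
rewrite ler_wpM2l //; first by rewrite !mulr_ge0 ?exprn_ge0.
by apply: lerXn2r; rewrite ?nnegrE // ?(le_trans _ hg) // mulr_ge0 // ltW.
Qed.

(** The left side is the critical density of the model on the complete graph. *)
Lemma critical_lt q : 2 < q -> 2 * (q - 1) * ln (q - 1) / (q - 2) < q.
Proof.
move=> q2; have u1 : 1 < q - 1 by lra.
have u0 : 0 < q - 1 by lra.
rewrite ltr_pdivrMr ?subr_gt0 //.
have := ln_lt_subinv u1; rewrite -(ltr_pM2l u0) => H.
have E : (q - 1) * (q - 1 - (q - 1)^-1) = q * (q - 2) by field; rewrite gt_eqF.
by rewrite E in H; apply: le_lt_trans H; rewrite le_eqVlt; apply/orP; left; apply/eqP; ring.
Qed.

Lemma powR_large (alpha Y : R) : 0 < alpha -> exists n0 : nat, forall n : nat,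
  (n0 <= n)%N -> Y <= n%:R `^ alpha.
Proof.
move=> a0; pose Y1 := Num.max Y 1.
exists (Num.truncn (Y1 `^ alpha^-1)).+1 => n hn.
have Y10 : 0 < Y1 by rewrite /Y1 lt_max ltr01 orbT.
apply: (@le_trans _ _ Y1); first by rewrite /Y1 le_max lexx.
have -> : Y1 = (Y1 `^ alpha^-1) `^ alpha.
  by rewrite -powRrM mulVf ?gt_eqF // powRr1 // ltW.
apply: (ge0_ler_powR (ltW a0)); rewrite ?nnegrE ?powR_ge0 //.
apply: ltW; apply: lt_le_trans (_ : (Num.truncn (Y1 `^ alpha^-1)).+1%:R <= _).
  exact: truncnS_gt.
by rewrite ler_nat.
Qed.

(** The coefficient of [N] in the difference of free energies is [G].  One
    half of it pays for the slots inside small clusters, which is where [eps] must be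
    small, and the other half for the terms that stay bounded as [N] grows. *)
Lemma end_condition p q g eps (N K M : nat) : 0 < p -> 2 < q -> 0 < eps ->
  let d := (q - 2) ^+ 2 / (q * (q - 1)) in
  let h := (q - 2) / q * ln (q - 1) in
  let G := K%:R * g * d - h in
  p * N%:R <= g -> g - p <= p * N%:R -> M%:R <= eps * N%:R ->
  K.+1%:R * g * eps <= G / 2 ->
  K%:R * g * d + ln 2 + 2 * K%:R * g ^+ 2 <= N%:R * (G / 2) ->
  ln 2 + N%:R * h + (K * (N * N))%:R * (p * ordered_rate q + 2 * p ^+ 2)
    <= p * (1 - q^-1) * ((K * (N * N))%:R - K.+1%:R * (N%:R * M%:R)).
Proof.
move=> p0 q2 e0 d h G hg1 hg2 hM he hN.
have q0 : 0 < q by lra.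
have q10 : 0 < q - 1 by lra.
have d0 : 0 <= d by rewrite divr_ge0 ?exprn_ge0 ?mulr_ge0 //; lra.
have Hd : 1 - q^-1 - ordered_rate q = d by rewrite /ordered_rate /d; field; rewrite !gt_eqF.
clearbody d h.
set n := N%:R in hg1 hg2 hM hN *; set k := K%:R in G he hN *; set m := M%:R in hM *.
have n0 : 0 <= n by []. have k0 : 0 <= k by []. have m0 : 0 <= m by [].
set x := p * n in hg1 hg2.
have x0 : 0 <= x by rewrite mulr_ge0 // ltW.
have g0 : 0 <= g by apply: le_trans hg1.
have iq : 0 <= 1 - q^-1 <= 1.
  by rewrite subr_ge0 invf_le1 // gerBl invr_ge0 !ltW //; lra.
have e1 : k * n * d * (g - p) <= k * n * d * x by apply: ler_wpM2l => //;
  do 2![apply: mulr_ge0 => //].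
have e2 : k * d * x <= k * d * g by apply: ler_wpM2l => //; apply: mulr_ge0.
have e3 : (1 - q^-1) * (K.+1%:R * x * m) <= n * (G / 2).
  have [iq0 iq1] := andP iq.
  apply: (@le_trans _ _ (1 * (K.+1%:R * g * (eps * n)))).
    apply: ler_pM => //; first by apply: mulr_ge0 => //; apply: mulr_ge0.
    apply: ler_pM => //; first exact: mulr_ge0.
    by rewrite ler_wpM2l.
  have := ler_wpM2r n0 he; rewrite mul1r [n * (G / 2)]mulrC.
  by rewrite (_ : K.+1%:R * g * eps * n = K.+1%:R * g * (eps * n)); last ring.
have e4 : k * x ^+ 2 <= k * g ^+ 2.
  by rewrite ler_wpM2l // lerXn2r ?nnegrE.
rewrite !natrM -/n -/k -/m.
have -> : k * (n * n) * (p * ordered_rate q + 2 * p ^+ 2) =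
   k * n * x * ordered_rate q + 2 * (k * x ^+ 2) by rewrite /x; ring.
have -> : p * (1 - q^-1) * (k * (n * n) - K.+1%:R * (n * m)) =
   k * n * d * x + k * n * x * ordered_rate q - (1 - q^-1) * (K.+1%:R * x * m).
  by rewrite -Hd /x; ring.
have e5 : k * n * d * (g - p) = n * (k * g * d) - k * d * x by rewrite /x; ring.
rewrite e5 in e1.
have e6 : n * G = n * (k * g * d) - n * h by rewrite /G; ring.
move: e1 e2 e3 e4 hN e6.
have -> : n * (G / 2) = n * G / 2 by rewrite mulrA.
have -> : 2 * k * g ^+ 2 = 2 * (k * g ^+ 2) by ring.
have -> : k * d * g = k * g * d by ring.
set b1 := k * n * d * x; set b2 := n * (k * g * d); set b3 := k * d * x.
set b4 := (1 - q^-1) * _; set b5 := n * G; set b6 := n * h; set b7 := k * x ^+ 2;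
  set b8 := k * g ^+ 2.
set b9 := k * g * d; set b10 := k * n * x * _; lra.
Qed.

End Constants.

Section Regime.
Variables (R : realType) (q g t c1 eps delta A B0 G : R) (K r : nat).
Hypotheses (q2 : 2 < q) (K0 : (0 < K)%N) (g0 : 0 < g).
Hypothesis Hr : forall n N (t : 'I_(K * (N * N))),
  (0 < N)%N -> (0 < K)%N -> (6 * (K * (N * N)) <= n)%N -> (#|@region n N K t| <= r)%N.
Hypotheses (hK : 2 * K.+1%:R * g <= q * t) (ht : t <= 1) (c10 : 0 < c1)
  (hc1 : c1 <= t - 1 - ln t) (hg2 : 2 * g / q <= c1 / 4)
  (eps0 : 0 < eps) (eps1 : eps <= 1) (heps : (1 + q) * eps <= c1 / 4).
Hypotheses (G0 : 0 < G)
  (hG : G = K%:R * g * ((q - 2) ^+ 2 / (q * (q - 1))) - (q - 2) / q * ln (q - 1))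
  (heps2 : K.+1%:R * g * eps <= G / 2).
Hypotheses (hdelta : delta = eps * (g / 2) / q) (A2 : 2 <= A) (dA : 2 <= delta * A)
  (hB0 : expR (K%:R * A ^+ 2 * r%:R ^+ 2 * 2 ^+ r * g ^+ 2) <= B0) (B01 : 1 <= B0).

Let a := c1 * eps / 8.
Let E0 := K%:R * g * ((q - 2) ^+ 2 / (q * (q - 1))) + ln 2 + 2 * K%:R * g ^+ 2.

(** [M] is the integer part of [eps * N].  All that is required of [N] is to be large
    compared with the constants; the polynomial factor in the conductance is
    absorbed by half of the exponential rate. *)
Lemma scale_bottleneck (n N : nat) (p : R) : 0 < p -> p <= 2^-1 -> p <= g / 2 ->
  p * N%:R <= g -> g - p <= p * N%:R -> (6 * (K * (N * N)) <= n)%N -> 1 <= N%:R :> R ->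
  2 * B0 / eps <= N%:R -> 4 * (16 * q * (B0 / delta)) / a ^+ 2 <= N%:R ->
  E0 / (G / 2) <= N%:R ->
  exists2 xi : {set {set vertex n}}, boundary_condition xi &
    ((expR (a * N%:R))%:E <= fk_mixing_time p q xi)%E.
Proof.
move=> p0 p2 pg pN1 pN2 Hn N1 Y1 Y2 Y3.
have q0 : 0 < q by move: q2; lra.
have delta0 : 0 < delta.
  by rewrite hdelta; apply: divr_gt0 => //; apply: mulr_gt0 => //; apply: divr_gt0.
have a0 : 0 < a by apply: divr_gt0 => //; apply: mulr_gt0.
have N0 : (0 < N)%N by rewrite -(ltr0n R); apply: lt_le_trans N1.
pose M := Num.truncn (eps * N%:R).
have eN0 : 0 <= eps * N%:R by rewrite mulr_ge0 // ltW.
have /andP[M1 M2] := truncn_itv eN0; rewrite -/M in M1 M2.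
have B2 : 2 * B0 <= eps * N%:R by rewrite [leRHS]mulrC -ler_pdivrMr.
have M0 : (0 < M)%N.
  by rewrite -(ltr0n R); move: M2 B2 B01; rewrite -natr1; lra.
have BM : 2 * B0 < A ^+ M.
  apply: (@lt_le_trans _ _ (2 ^+ M)); last by rewrite lerXn2r ?nnegrE // (le_trans _ A2).
  apply: le_lt_trans B2 _; apply: lt_le_trans M2 _.
  by rewrite -natrX ler_nat; apply: ltn_expl.
have hd : delta <= M.+1%:R * (p / q).
  apply: (@le_trans _ _ (eps * N%:R * (p / q))); last first.
    by apply: ler_wpM2r; [apply: divr_ge0; exact: ltW|exact: ltW].
  have -> : eps * N%:R * (p / q) = eps * (p * N%:R) / q by ring.
  rewrite hdelta; apply: ler_wpM2r; first by rewrite invr_ge0 ltW.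
  by apply: ler_wpM2l; [exact: ltW|move: pN2 pg; lra].
have Hend : ln 2 + N%:R * ((q - 2) / q * ln (q - 1))
    + (K * (N * N))%:R * (p * ordered_rate q + 2 * p ^+ 2)
    <= p * (1 - q^-1) * ((K * (N * N))%:R - K.+1%:R * (N%:R * M%:R)).
  apply: (end_condition p0 q2 eps0 pN1 pN2 M1); rewrite -hG //.
  by rewrite -ler_pdivrMr // divr_gt0.
have BF : busy_factor p N K r A <= B0.
  by apply: le_trans hB0; apply: busy_factor_le => //; apply: le_trans A2.
have T1 : 1 <= expR (a * N%:R).
  by rewrite -[leLHS]expR0 ler_expR; apply: mulr_ge0 => //; exact: ltW.
have TT : expR (a * N%:R) ^+ 2 <= expR (c1 / 4 * (eps * N%:R)).
  by rewrite -expRM_natl ler_expR /a le_eqVlt; apply/orP; left; apply/eqP; field.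
have HT : 16 * q * (N.+1%:R * (B0 / delta)) <= expR (a * N%:R).
  have aN0 : 0 <= a * N%:R by apply: mulr_ge0 => //; exact: ltW.
  apply: le_trans (_ : (a * N%:R) ^+ 2 / 2 <= _); last first.
    by apply: le_trans (expR_ge_quadratic aN0); rewrite lerDr addr_ge0.
  move: Y2; set C0 := 16 * q * (B0 / delta); rewrite ler_pdivrMr ?exprn_gt0 // => Y2.
  have C00 : 0 <= C0.
    have B00 : 0 <= B0 by apply: le_trans B01.
    by apply: mulr_ge0; [apply: mulr_ge0 => //; exact: ltW|apply: divr_ge0 => //; exact: ltW].
  have -> : 16 * q * (N.+1%:R * (B0 / delta)) = C0 * N.+1%:R by rewrite /C0; ring.
  apply: (@le_trans _ _ (C0 * (2 * N%:R))).
    by apply: ler_wpM2l => //; rewrite -natr1; move: N1; lra.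
  have := ler_wpM2r (ler0n R N) Y2.
  have -> : (a * N%:R) ^+ 2 = N%:R * a ^+ 2 * N%:R by ring.
  have -> : 4 * C0 * N%:R = 2 * (C0 * (2 * N%:R)) by ring.
  by set x := C0 * _; set y := _ * N%:R; lra.
have [xi bxi Hxi] := box_bottleneck p0 p2 q2 N0 K0 Hn (fun s => Hr s N0 K0 Hn) pN1 hK ht hc1 hg2
  eps0 eps1 heps M1 (ltW M2) delta0 hd A2 dA BF M0 BM Hend T1 TT HT.
by exists xi.
Qed.

Variables (alpha lambda : R).
Hypotheses (alpha0 : 0 < alpha) (alpha2 : alpha <= 2^-1) (lambda0 : 0 < lambda).
Hypothesis hkappa : 6 * K%:R * (g / lambda) ^+ 2 <= 1.

(** [N] is the integer part of [kappa * n ^ alpha] with [kappa = g / lambda], so that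
    [p * N] is within [p] of [g].  The hypothesis on [kappa] makes the slots fit in the
    bottom row. *)
Lemma slow_mixing_eventually : exists c : R, 0 < c /\ exists n0 : nat, forall n,
  (n0 <= n)%N -> exists2 xi : {set {set vertex n}}, boundary_condition xi &
    ((expR (c * n%:R `^ alpha))%:E <= fk_mixing_time (lambda * n%:R `^ (- alpha)) q xi)%E.
Proof.
have a0 : 0 < a by apply: divr_gt0 => //; apply: mulr_gt0.
pose Y1 := 2 * B0 / eps; pose Y2 := 4 * (16 * q * (B0 / delta)) / a ^+ 2.
pose Y3 := E0 / (G / 2).
pose YN := Num.max 1 (Num.max Y1 (Num.max Y2 Y3)).
have [YN1 YNY1 YNY2 YNY3] : [/\ 1 <= YN, Y1 <= YN, Y2 <= YN & Y3 <= YN].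
  by rewrite /YN; split; rewrite !le_max lexx ?orbT.
clearbody YN; have hk := hkappa; set kappa := g / lambda in hk.
have kappa0 : 0 < kappa by apply: divr_gt0.
pose Y := Num.max (2 * YN / kappa) (Num.max (2 * lambda) (2 * lambda / g)).
have [n0 Hn0] := powR_large Y alpha0.
exists (a * kappa / 2); split; first by apply: divr_gt0 => //; apply: mulr_gt0.
exists (maxn n0 1) => n; rewrite geq_max => /andP[hn npos].
have := Hn0 n hn; rewrite /Y !ge_max => /and3P[hY1 hY2 hY3].
have : n%:R `^ (alpha * 2%:R) <= n%:R :> R.
  rewrite -[leRHS]powRr1 //; apply: ler_powR; rewrite ?ler1n //.
  by move: alpha2; lra.
rewrite powRrM powR_mulrn ?powR_ge0 // powRN.
have : 0 < n%:R `^ alpha by apply: powR_gt0; rewrite ltr0n.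
move: (n%:R `^ alpha) hY1 hY2 hY3 => y hY1 hY2 hY3 y0 y2.
set p := lambda / y; pose N := Num.truncn (kappa * y).
have ky0 : 0 <= kappa * y by apply: mulr_ge0; exact: ltW.
have /andP[N1 N2] := truncn_itv ky0; rewrite -/N in N1 N2.
rewrite ler_pdivrMr // [y * kappa]mulrC in hY1.
have p0 : 0 < p by apply: divr_gt0.
have p2 : p <= 2^-1 by rewrite ler_pdivrMr // mulrC ler_pdivlMr // mulrC.
have pg : p <= g / 2.
  rewrite ler_pdivrMr // mulrAC ler_pdivlMr // mulrC [g * y]mulrC.
  by rewrite -ler_pdivrMr.
have Nhalf : kappa * y / 2 <= N%:R.
  by move: N2 hY1 YN1; rewrite -natr1; lra.
have NY : YN <= N%:R by move: Nhalf hY1; lra.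
have gE : g = p * (kappa * y) by rewrite /p /kappa; field; rewrite !gt_eqF.
have pN1 : p * N%:R <= g by rewrite gE; apply: ler_wpM2l => //; exact: ltW.
have pN2 : g - p <= p * N%:R.
  rewrite gE; have := ler_wpM2l (ltW p0) (ltW N2); rewrite -natr1 mulrDr mulr1.
  lra.
have Hn : (6 * (K * (N * N)) <= n)%N.
  rewrite -(ler_nat R) !natrM.
  have N2' : N%:R * N%:R <= (kappa * y) ^+ 2 by rewrite expr2 ler_pM.
  apply: (@le_trans _ _ (6 * (K%:R * (kappa * y) ^+ 2))).
    by do 2![apply: ler_wpM2l => //].
  have -> : 6 * (K%:R * (kappa * y) ^+ 2) = 6 * K%:R * kappa ^+ 2 * y ^+ 2 by ring.
  rewrite -[leRHS]mul1r; apply: ler_pM => //; last by rewrite exprn_ge0 // ltW.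
  by apply: mulr_ge0 => //; rewrite exprn_ge0 // ltW.
have [xi bxi Hxi] := scale_bottleneck p0 p2 pg pN1 pN2 Hn (le_trans YN1 NY)
  (le_trans YNY1 NY) (le_trans YNY2 NY) (le_trans YNY3 NY).
exists xi => //; apply: le_trans Hxi; rewrite lee_fin ler_expR.
have -> : a * kappa / 2 * y = a * (kappa * y / 2) by ring.
by apply: ler_wpM2l => //; exact: ltW.
Qed.

End Regime.

Local Open Scope classical_set_scope.
Local Open Scope ring_scope.

Theorem theorem1p5 (R : realType) (q : R) (hq : 2 < q)
    (alpha : R) (halpha0 : 0 < alpha) (halpha : alpha <= 2^-1)
    (lambda : R) (hlambda : 0 < lambda) :
  exists xi : forall n : nat, {set {set vertex n}},
    (forall n : nat, boundary_condition (xi n)) /\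
    exists c : R, 0 < c /\
      \forall n \near \oo,
        ((expR (c * n%:R `^ alpha))%:E
           <= fk_mixing_time (lambda * n%:R `^ (- alpha)) q (xi n))%E.
Proof.
have q0 : 0 < q by lra.
have q10 : 0 < q - 1 by lra.
have [r Hr] := region_bound.
(* the density at the last stage is [mu], strictly between the critical value and
   [q]; [mu'] leaves room for the slots of an incomplete round, [K.+1] instead of [K] *)
pose lc := 2 * (q - 1) * ln (q - 1) / (q - 2).
have lcq : lc < q by apply: critical_lt.
have lc0 : 0 < lc.
  by rewrite divr_gt0 ?subr_gt0 // !mulr_gt0 // ln_gt0 //; lra.
pose mu := (lc + q) / 2; pose mu' := (mu + q) / 2; pose t := mu' / q.
have mu0 : 0 < mu by rewrite /mu; lra.
have mulc : lc < mu by rewrite /mu; lra.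
have mumu : mu < mu' by rewrite /mu' /mu; lra.
have mu'q : mu' < q by rewrite /mu' /mu; lra.
have mu'0 : 0 < mu' by apply: lt_trans mumu.
have t0 : 0 < t by rewrite divr_gt0.
have t1 : t < 1 by rewrite ltr_pdivrMr // mul1r.
pose c1 := t - 1 - ln t.
have c10 : 0 < c1 by rewrite /c1 subr_gt0 ln_lt_sub1 // lt_eqF.
pose d := (q - 2) ^+ 2 / (q * (q - 1)).
have d0 : 0 < d by rewrite divr_gt0 ?exprn_gt0 ?mulr_gt0 // subr_gt0.
pose h := (q - 2) / q * ln (q - 1).
pose G := mu / 2 * d - h.
have G0 : 0 < G.
  have -> : G = (mu - lc) / 2 * d.
    rewrite /G /h /d /lc; field; rewrite !gt_eqF //; lra.
  by rewrite mulr_gt0 // divr_gt0 // subr_gt0.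
pose S1 := mu / (mu' - mu); pose S2 := 4 * mu / (q * c1);
  pose S3 := 6 * mu ^+ 2 / (4 * lambda ^+ 2).
have S10 : 0 < S1 by rewrite divr_gt0 // subr_gt0.
have S20 : 0 < S2 by rewrite divr_gt0 // mulr_gt0.
have S30 : 0 < S3 by rewrite divr_gt0 // mulr_gt0 // exprn_gt0.
(* [S1] makes the last round negligible, [S2] makes [g] small, and [S3] makes the
   slots fit when [lambda] is small *)
pose K := (Num.truncn (S1 + S2 + S3)).+1.
have KS : S1 + S2 + S3 < K%:R by apply: truncnS_gt.
have K0 : 0 < K%:R :> R by rewrite ltr0n.
pose g := mu / (2 * K%:R); pose kappa := g / lambda.
have g0 : 0 < g by rewrite divr_gt0 // mulr_gt0.
have kappa0 : 0 < kappa by rewrite divr_gt0.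
have Kg : K%:R * g = mu / 2 by rewrite /g; field; rewrite gt_eqF.
have hK : 2 * K.+1%:R * g <= q * t.
  have -> : q * t = mu' by rewrite /t; field; rewrite gt_eqF.
  have -> : 2 * K.+1%:R * g = mu + mu / K%:R.
    by rewrite -natr1 /g; field; rewrite gt_eqF.
  rewrite -lerBrDl ler_pdivrMr // mulrC -ler_pdivrMr ?subr_gt0 //.
  by rewrite -/S1; move: KS S20 S30; lra.
have hg2 : 2 * g / q <= c1 / 4.
  have -> : 2 * g / q = mu / q / K%:R by rewrite /g; field; rewrite !gt_eqF.
  rewrite ler_pdivrMr // [leRHS]mulrC -ler_pdivrMr ?divr_gt0 //.
  have -> : mu / q / (c1 / 4) = S2 by rewrite /S2; field; rewrite !gt_eqF.
  by move: KS S10 S30; lra.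
have hkap : 6 * K%:R * kappa ^+ 2 <= 1.
  have -> : 6 * K%:R * kappa ^+ 2 = S3 / K%:R.
    by rewrite /kappa /g /S3; field; rewrite !gt_eqF.
  by rewrite ler_pdivrMr // mul1r; move: KS S10 S20; lra.
pose eps1 := c1 / 4 / (1 + q); pose eps2 := G / 2 / (K.+1%:R * g).
pose eps := Num.min 1 (Num.min eps1 eps2).
have q1p : 0 < 1 + q by lra.
have Kg0 : 0 < K.+1%:R * g by rewrite mulr_gt0.
have eps0 : 0 < eps by rewrite !lt_min ltr01 !divr_gt0.
have epsl1 : eps <= 1 by rewrite ge_min lexx.
have heps : (1 + q) * eps <= c1 / 4.
  by rewrite mulrC -ler_pdivlMr // !ge_min lexx orbT.
have heps2 : K.+1%:R * g * eps <= G / 2.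
  by rewrite mulrC -ler_pdivlMr // !ge_min lexx !orbT.
clearbody eps.
pose delta := eps * (g / 2) / q; pose A := 2 + 2 / delta.
have delta0 : 0 < delta.
  by apply: divr_gt0 => //; apply: mulr_gt0 => //; apply: divr_gt0.
have A2 : 2 <= A by rewrite lerDl divr_ge0 // ltW.
have dA : 2 <= delta * A.
  have -> : delta * A = 2 * delta + 2 by rewrite /A; field; rewrite gt_eqF.
  by rewrite lerDr mulr_ge0 // ltW.
have B01 : 1 <= expR (K%:R * A ^+ 2 * r%:R ^+ 2 * 2 ^+ r * g ^+ 2).
  have A0 : 0 <= A by apply: le_trans A2.
  have g0' := ltW g0.
  rewrite -[leLHS]expR0 ler_expR.
  by do 4![apply: mulr_ge0; last exact: exprn_ge0].
have hG : G = K%:R * g * d - h by rewrite Kg.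
have [c [c0 [n0 Hc]]] := slow_mixing_eventually hq (isT : (0 < K)%N) g0
  (fun n N => Hr n N K) hK (ltW t1) c10 (lexx _) hg2 eps0 epsl1 heps G0 hG heps2
  erefl A2 dA (lexx _) B01 halpha0 halpha hlambda hkap.
have ex n : exists xi : {set {set vertex n}}, boundary_condition xi /\
   ((n0 <= n)%N ->
    ((expR (c * n%:R `^ alpha))%:E <= fk_mixing_time (lambda * n%:R `^ (- alpha)) q xi)%E).
  case: (leqP n0 n) => [/Hc[xi bxi Hxi]|_]; first by exists xi.
  by exists (preim_partition id (boundary n)); split => //; exact: preim_partitionP.
exists (fun n => sval (cid (ex n))); split; first by move=> n; case: cid => xi [].
exists c; split=> //; exists n0 => // n /= hn.
by case: cid => xi /= [_]; apply.
Qed.
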